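(* Let $D\ge1$, let $X$ be a $(2,D)$-smooth Banach space, $H$ a separable Hilbert space, $W_H$ an $H$-cylindrical Brownian motion, $T>0$ and $p\in[2,\infty)$. Let $k>0$ with $N_k:=T/k\in\mathbb N$, $t_j:=jk$, and $\Delta W_j:=W_H(t_j)-W_H(t_{j-1})$. Let $N\in\mathbb N$ with $N\le N_k$, and let $Q\colon\Omega\times[0,T]\to\gamma(H,X)$ be such that $Q_i:=Q(\cdot,t_i)\in L^p(\Omega;\gamma(H,X))$ is $\mathcal F_{t_i}$-measurable for $0\le i\le N-1$. Suppose that $(R_k)_{k>0}\subseteq\mathcal L(X)$ is contractive, i.e. $\|R_k\|_{\mathcal L(X)}\le1$. Then there is a constant $B_{p,D}\ge0$ depending only on $p$ and $D$ such that $$\Big\|\max_{0\le j\le N}\Big\|\sum_{i=0}^{j-1}R_k^{j-i}Q_i\,\Delta W_{i+1}\Big\|_X\Big\|_{L^p(\Omega)}\le B_{p,D}\Big(k\sum_{i=0}^{N-1}\|Q_i\|_{L^p(\Omega;\gamma(H,X))}^2\Big)^{1/2}.$$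
   Context: $(\Omega,\mathscr F,\mathbb P)$ is a probability space with a filtration $(\mathcal F_t)_{t\in[0,T]}$. A Banach space $X$ is $(2,D)$-smooth if $\|x+y\|^2+\|x-y\|^2\le 2\|x\|^2+2D^2\|y\|^2$ for all $x,y\in X$. $\gamma(H,X)$: the space of $\gamma$-radonifying operators, i.e. the closure of the finite rank operators $H\to X$ in the norm $\|R\|_{\gamma(H,X)}=\sup\big(\mathbb E\|\sum_{n=1}^N\gamma_nRh_n\|_X^2\big)^{1/2}$, the supremum over all finite orthonormal systems $\{h_1,\dots,h_N\}$ in $H$, where $(\gamma_n)$ are i.i.d. standard Gaussian variables. An $H$-cylindrical Brownian motion is a mapping $W_H\colon L^2(0,T;H)\to L^2(\Omega)$ such that every $W_Hh$ is centred Gaussian and $\mathbb E(W_Hh_1\cdot W_Hh_2)=\langle h_1,h_2\rangle_{L^2(0,T;H)}$ (with a complex conjugate on $W_H h_2$ in the complex case). Write $W_H(t)h:=W_H(\mathbf 1_{(0,t)}\otimes h)$ for $h\in H$. It is taken relative to $(\mathcal F_t)$: $W_H(t)h$ is $\mathcal F_t$-measurable and the increments $\{W_H(t)h-W_H(s)h: h\in H\}$, $t\ge s$, are independent of $\mathcal F_s$. For a $\gamma(H,X)$-valued random variable $Q$, $Q\,\Delta W_j:=\sum_nQh_n\,(W_H(t_j)h_n-W_H(t_{j-1})h_n)$ with $(h_n)$ an orthonormal basis of $H$. *)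

(* Defs.v *)
From HB Require Import structures.
From mathcomp Require Import all_boot all_order all_algebra.
From mathcomp Require Import sesquilinear complex.
From mathcomp Require Import all_classical all_reals all_analysis.
Set Implicit Arguments.
Unset Strict Implicit.
Unset Printing Implicit Defensive.
Import Order.TTheory GRing.Theory Num.Theory.
Import numFieldNormedType.Exports.
Local Open Scope classical_set_scope.
Local Open Scope ring_scope.

(* The Banach space X and the Hilbert space H are over one scalar field, which
   is either R or R[i]. Norms of MathComp-Analysis take their values in the
   scalar field; [nrm] is the real-valued norm. *)
Inductive scalar_kind := real_scalars | complex_scalars.

Definition scalars (R : realType) (s : scalar_kind) : numFieldType :=
  match s with real_scalars => R | complex_scalars => complex R end.

Definition sre (R : realType) (s : scalar_kind) : scalars R s -> R :=
  match s return scalars R s -> R with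
  | real_scalars => fun x => x
  | complex_scalars => fun z => complex.Re z
  end.

Definition sim (R : realType) (s : scalar_kind) : scalars R s -> R :=
  match s return scalars R s -> R with
  | real_scalars => fun=> 0
  | complex_scalars => fun z => complex.Im z
  end.

Definition sconj (R : realType) (s : scalar_kind) :
    scalars R s -> scalars R s :=
  match s return scalars R s -> scalars R s with
  | real_scalars => fun x => x
  | complex_scalars => fun z => conjc z
  end.

Definition of_real (R : realType) (s : scalar_kind) : R -> scalars R s :=
  match s return R -> scalars R s with
  | real_scalars => fun x => x
  | complex_scalars => fun x => Complex x 0
  end.

Definition nrm (R : realType) (s : scalar_kind)
  (V : normedModType (scalars R s)) (x : V) : R := sre `|x|.

Definition scalar_integral (R : realType) (s : scalar_kind) d (T : measurableType d)
    (mu : {measure set T -> \bar R}) (A : set T) :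
    (T -> scalars R s) -> scalars R s :=
  match s return (T -> scalars R s) -> scalars R s with
  | real_scalars => fun f => Rintegral mu A f
  | complex_scalars => fun f =>
      Complex (Rintegral mu A (fun x => complex.Re (f x)))
              (Rintegral mu A (fun x => complex.Im (f x)))
  end.

Definition smooth2 (R : realType) (s : scalar_kind)
    (X : normedModType (scalars R s)) (D : R) : Prop :=
  forall x y : X,
    nrm (x + y) ^+ 2 + nrm (x - y) ^+ 2 <=
    2 * nrm x ^+ 2 + 2 * D ^+ 2 * nrm y ^+ 2.

Definition op_norm (R : realType) (s : scalar_kind)
    (V W : normedModType (scalars R s)) (f : V -> W) : \bar R :=
  ereal_sup [set (nrm (f x))%:E | x in [set x : V | nrm x <= 1]].

Definition separable_space (V : topologicalType) : Prop :=
  exists A : set V, countable A /\ dense A.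

(* [ip] is linear in its first and conjugate-linear in its second argument.
   Completeness of H is part of its type, so this makes H a Hilbert space. *)
Definition hilbert_inner (R : realType) (s : scalar_kind)
    (H : completeNormedModType (scalars R s))
    (ip : {dot H for @sconj R s}) : Prop :=
  forall x : H, ip x x = `|x| ^+ 2.

Definition orthonormal_on (R : realType) (s : scalar_kind)
    (H : completeNormedModType (scalars R s)) (ip : {dot H for @sconj R s})
    (I : eqType) (J : set I) (h : I -> H) : Prop :=
  forall i j, J i -> J j -> ip (h i) (h j) = (i == j)%:R.

(* Bases are indexed by a set J of natural numbers, so that H may have any
   finite or countably infinite dimension. *)
Definition orthonormal_basis (R : realType) (s : scalar_kind)
    (H : completeNormedModType (scalars R s)) (ip : {dot H for @sconj R s})
    (J : set nat) (h : nat -> H) : Prop :=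
  orthonormal_on ip J h /\
  dense [set x : H | exists (n : nat) (c : nat -> scalars R s),
                       x = \sum_(i < n | (i : nat) \in J) c i *: h i].

Definition finite_rank (R : realType) (s : scalar_kind)
    (V W : normedModType (scalars R s)) (f : V -> W) : Prop :=
  [/\ linear f, continuous f &
      exists (n : nat) (y : 'I_n -> W), forall x : V,
        exists c : 'I_n -> scalars R s, f x = \sum_i c i *: y i].

Definition iid_std_gaussian (R : realType) d (T : measurableType d)
    (P : probability T R) (g : nat -> {RV P >-> R}) : Prop :=
  (forall n (B : set R), measurable B ->
     distribution P (g n) B = normal_prob 0 1 B) /\
  (forall (n : nat) (B : nat -> set R), (forall i, measurable (B i)) ->
     P (\big[setI/setT]_(i < n) (g i @^-1` B i)) =
     (\prod_(i < n) P (g i @^-1` B i))%E).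

(* The Gaussian sequence is a parameter; it is real-valued for both scalar
   fields, and the value of the norm does not depend on its choice. *)
Definition gamma_norm (R : realType) (s : scalar_kind)
    (H : completeNormedModType (scalars R s)) (ip : {dot H for @sconj R s})
    (X : normedModType (scalars R s)) d (T : measurableType d)
    (P : probability T R) (g : nat -> {RV P >-> R}) (f : H -> X) : \bar R :=
  ereal_sup [set y | exists (n : nat) (h : 'I_n -> H),
    orthonormal_on ip setT h /\
    y = poweR
      (expectation P
         (fun w => nrm (\sum_(i < n) of_real s (g i w) *: f (h i)) ^+ 2)) 2^-1].

Definition gamma_dist (R : realType) (s : scalar_kind)
    (H : completeNormedModType (scalars R s)) (ip : {dot H for @sconj R s})
    (X : normedModType (scalars R s)) d (T : measurableType d)
    (P : probability T R) (g : nat -> {RV P >-> R}) (f1 f2 : H -> X) : \bar R :=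
  gamma_norm ip g (fun x => f1 x - f2 x).

Definition gamma_space (R : realType) (s : scalar_kind)
    (H : completeNormedModType (scalars R s)) (ip : {dot H for @sconj R s})
    (X : normedModType (scalars R s)) d (T : measurableType d)
    (P : probability T R) (g : nat -> {RV P >-> R}) : set (H -> X) :=
  [set f | [/\ linear f, continuous f &
     forall e : R, 0 < e ->
       exists f0 : H -> X, finite_rank f0 /\ (gamma_dist ip g f f0 < e%:E)%E]].

Definition simple_in T V (C : set V) (G : set (set T)) (f : T -> V) : Prop :=
  [/\ finite_set (range f), range f `<=` C & forall v, G (f @^-1` [set v])].

(* Strong measurability for a sigma-algebra G, with values in a set C on which
   [dist] is a metric: pointwise limits of G-measurable simple functions. *)
Definition strongly_measurable (R : realType) T V (dist : V -> V -> \bar R)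
    (C : set V) (G : set (set T)) (f : T -> V) : Prop :=
  range f `<=` C /\
  exists u : nat -> T -> V, (forall n, simple_in C G (u n)) /\
    forall x, dist (u n x) (f x) @[n --> \oo] --> 0%E.

(* Measurability of an equivalence class of functions modulo null sets. *)
Definition ae_strongly_measurable (R : realType) d (T : measurableType d)
    (mu : {measure set T -> \bar R}) V (dist : V -> V -> \bar R)
    (C : set V) (G : set (set T)) (f : T -> V) : Prop :=
  exists f0 : T -> V, strongly_measurable dist C G f0 /\
    {ae mu, forall x, f x = f0 x}.

Definition norm_dist (R : realType) (s : scalar_kind)
    (V : normedModType (scalars R s)) (x y : V) : \bar R := (nrm (x - y))%:E.

Definition filtration (R : realType) d (Omega : measurableType d) (T : R)
    (F : R -> set (set Omega)) : Prop :=
  [/\ forall t : R, 0 <= t <= T -> sigma_algebra setT (F t),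
      forall t : R, 0 <= t <= T -> F t `<=` measurable &
      forall u t : R, 0 <= u -> u <= t -> t <= T -> F u `<=` F t].

(* Degenerate laws are allowed; they are singled out because the library's
   [normal_prob] is not a Dirac mass when its second argument is 0. *)
Definition centred_gaussian (R : realType) d (Omega : measurableType d)
    (P : probability Omega R) (Y : Omega -> R) : Prop :=
  measurable_fun setT Y /\
  exists sigma : R, forall B : set R, measurable B ->
    P (Y @^-1` B) = if sigma == 0 then dirac (0 : R) B
                    else normal_prob 0 sigma B.

(* A complex random variable is Gaussian when its real and imaginary parts are
   jointly Gaussian; circular symmetry is not required. *)
Definition scalar_centred_gaussian (R : realType) (s : scalar_kind) d
    (Omega : measurableType d) (P : probability Omega R)
    (Y : Omega -> scalars R s) : Prop :=
  forall a b : R, centred_gaussian P (fun w => a * sre (Y w) + b * sim (Y w)).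

Definition sigma_generated (R : realType) (s : scalar_kind) Omega (I : Type)
    (Y : I -> Omega -> scalars R s) : set (set Omega) :=
  <<s [set A | exists (i : I) (B : set R), measurable B /\
         (A = (fun w => sre (Y i w)) @^-1` B \/
          A = (fun w => sim (Y i w)) @^-1` B)] >>.

Definition independent_classes (R : realType) d (Omega : measurableType d)
    (P : probability Omega R) (G1 G2 : set (set Omega)) : Prop :=
  forall A B, G1 A -> G2 B -> (P (A `&` B) = P A * P B)%E.

(* Representatives of the elements of L^2(0,T;H); only the values on (0,T)
   enter the norm and the inner product. *)
Definition L2_interval (R : realType) (s : scalar_kind)
    (H : normedModType (scalars R s)) (T : R) : set (R -> H) :=
  [set f | strongly_measurable (@norm_dist R s H) setT
             (measurable : set (set (measurableTypeR R))) f /\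
           (\int[lebesgue_measure]_(t in `]0%R, T[) (nrm (f t) ^+ 2)%:E < +oo)%E].

Definition step (R : realType) (V : zmodType) (t : R) (h : V) : R -> V :=
  fun u => if 0 < u < t then h else 0.

(* [W] acts on representatives, with values in measurable representatives of
   elements of L^2(Omega). The covariance identity gives W f = W g a.s.
   whenever f = g a.e. on (0,T). *)
Definition cylindrical_BM (R : realType) (s : scalar_kind)
    (H : completeNormedModType (scalars R s)) (ip : {dot H for @sconj R s})
    d (Omega : measurableType d) (P : probability Omega R) (T : R)
    (F : R -> set (set Omega))
    (W : (R -> H) -> Omega -> scalars R s) : Prop :=
  [/\ forall f, L2_interval T f -> scalar_centred_gaussian P (W f),
      forall f g, L2_interval T f -> L2_interval T g ->
        scalar_integral P setT (fun w => W f w * sconj (W g w)) =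
        scalar_integral (lebesgue_measure : {measure set (measurableTypeR R) -> \bar R})
          `]0, T[ (fun t => ip (f t) (g t)),
      forall (t : R) (h : H), 0 <= t <= T ->
        ae_strongly_measurable P (@norm_dist R s (scalars R s)^o) setT
          (F t) (W (step t h)) &
      forall u t : R, 0 <= u -> u <= t -> t <= T ->
        independent_classes P (F u)
          (sigma_generated (fun h w => W (step t h) w - W (step u h) w))].

(* A (W_H(t) - W_H(u)) for an operator A, as the pointwise sum of the series
   over an orthonormal basis. *)
Definition op_increment (R : realType) (s : scalar_kind)
    (H X : completeNormedModType (scalars R s)) Omega
    (W : (R -> H) -> Omega -> scalars R s) (J : set nat) (h : nat -> H)
    (A : H -> X) (u t : R) (w : Omega) : X :=
  limn (fun m : nat => \sum_(n < m | (n : nat) \in J)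
          (W (step t (h n)) w - W (step u (h n)) w) *: A (h n)).

(* Main.v *)
Require Import Defs.
From HB Require Import structures.
From mathcomp Require Import all_boot all_order all_algebra.
From mathcomp Require Import sesquilinear complex.
From mathcomp Require Import all_classical all_reals all_analysis.
From mathcomp Require Import measurable_realfun measurable_fun_approximation simple_functions.
From mathcomp Require Import ring lra zify.
Set Implicit Arguments.
Unset Strict Implicit.
Unset Printing Implicit Defensive.
Import Order.TTheory GRing.Theory Num.Theory.
Import numFieldNormedType.Exports.
Local Open Scope classical_set_scope.
Local Open Scope ring_scope.

(* The convolution satisfies M_(j+1) = R (M_j + d_j) with d_j = Q_j Delta W_(j+1)
   and R contractive. As Delta W_(j+1) is independent of F_(t_j), the step d_j may
   be replaced by - d_j without changing its joint law with the past. By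
   (2, D)-smoothness ||M_j|| is dominated by Z_j with Z_0 = 0 and
   Z_(j+1) = eta_j + (Z_j^2 + D^2 ||d_j||^2)^(1/2), where eta_j is the part of
   ||M_j + d_j|| odd in d_j. This Z is a submartingale; the elementary inequality
   for (1 + t)^p + (1 - t)^p and Minkowski's inequality in L^(p/2) bound
   E Z_N^p by (sum_j ||d_j||_p^2)^(p/2), and Doob's inequality bounds the maximum.
   Freezing Q_j, which is also allowed by independence, d_j is a Gaussian sum, so
   the Kahane-Khintchine inequality gives ||d_j||_p <= C (k^(1/2) ||Q_j||_p).
   All this is done for truncations of the series defining d_j, and Fatou's lemma
   gives the limit. The series converges almost surely because an operator in
   gamma(H, X) is approximated by finite rank operators f, for which
   sum_n ||f h_n||^2 < oo. *)

(** Three obstacles shape the development. After a contraction [||M_j||] need not be a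
    submartingale; Z uses norms only as upper bounds and therefore survives the operator, so the
    maximal inequality is applied to Z. Laws of vectors are compared only through the means of cos
    and sin of linear forms, which determine the mean of every nonnegative continuous functional of
    finitely many coordinates; symmetry, rotation invariance and Gaussian comparison all come from
    this one principle. Over the complex field the real and imaginary parts of the increments may be
    correlated with unequal variances, so a sum of increments need not have the law of the real
    Gaussian sum in the gamma-norm: it is only compared with it, at the price of a factor depending
    on p. Moreover, neither the gamma-norm of Q nor the pointwise limit defining the increments is
    assumed measurable, and integrals are compared without this. Every constant that enters B is
    fixed before the scalar field, the spaces and the probability, which makes B depend on p and D
    alone. *)

Section integration.
Local Open Scope ereal_scope.
Context (R : realType).

(** The joint law of (U, V) agrees with the product measure on rectangles, hence everywhere by
    uniqueness of product measures; Tonelli's theorem does the rest. *)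
Lemma independent_integral d1 d2 d (T1 : measurableType d1)
    (T2 : measurableType d2) (Om : measurableType d)
    (mu : {measure set Om -> \bar R})
    (m1 : {sigma_finite_measure set T1 -> \bar R})
    (m2 : {sigma_finite_measure set T2 -> \bar R}) (U : Om -> T1) (V : Om -> T2) :
  measurable_fun setT U -> measurable_fun setT V ->
  (forall A B, measurable A -> measurable B ->
     mu (U @^-1` A `&` V @^-1` B) = m1 A * m2 B) ->
  forall f : T1 * T2 -> \bar R, measurable_fun setT f -> (forall x, 0 <= f x) ->
  \int[mu]_w f (U w, V w) = \int[m1]_x \int[m2]_y f (x, y).
Proof.
move=> mU mV indep f mf f0.
have mUV : measurable_fun setT (fun w => (U w, V w)).
  exact: measurable_fun_pair.
pose m12_ : {measure set (T1 * T2) -> \bar R} :=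
  pushforward mu (fun w => (U w, V w)).
pose m12 := m12_ mUV.
have muE X : measurable X -> (m1 \x m2) X = m12 X.
  move=> mX; apply: (@product_measure_unique _ _ T1 T2 R m1 m2 m12) mX.
  by move=> A B mA mB; rewrite -(indep A B mA mB).
rewrite -fubini_tonelli1//.
rewrite (eq_measure_integral m12); last by move=> A mA _; exact: muE.
by rewrite (ge0_integral_pushforward mUV mu)//= => y _; exact: f0.
Qed.

Import HBNNSimple.

(* The integral of a nonnegative function is the supremum over the measurable
   simple functions below it, measurable or not. *)
Lemma integral_nonmeasurable_le d (T : measurableType d)
    (mu : {measure set T -> \bar R}) (f g : T -> \bar R) :
  (forall x, 0 <= f x) -> (forall x, 0 <= g x) -> measurable_fun setT g ->
  {ae mu, forall x, f x <= g x} -> \int[mu]_x f x <= \int[mu]_x g x.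
Proof.
move=> f0 g0 mg fg; rewrite ge0_integralTE//.
apply: ub_ereal_sup => _ [h /= hf <-].
rewrite -integralT_nnsfun; apply: ae_ge0_le_integral => //.
- by move=> x _; rewrite lee_fin; exact: fun_ge0.
- exact/measurable_EFinP.
- by apply: filterS fg => x fg _; exact: (le_trans (hf x)).
Qed.

(** Here the measurable function is the smaller one, as when a decoupled moment is bounded by a
    power of the gamma-norm of Q. The exceptional null set is removed from the domain of f first, so
    that every simple function below the restricted f lies below g everywhere. *)
Lemma integral_nonmeasurable_ge d (T : measurableType d)
    (mu : {measure set T -> \bar R}) (f g : T -> \bar R) :
  (forall x, 0 <= f x) -> (forall x, 0 <= g x) -> measurable_fun setT f ->
  {ae mu, forall x, f x <= g x} -> \int[mu]_x f x <= \int[mu]_x g x.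
Proof.
move=> f0 g0 mf [N [mN N0 fgN]].
rewrite (ge0_negligible_integral _ _ _ _ N0)// setTD integral_mkcond.
rewrite [leRHS]ge0_integralTE//.
rewrite ge0_integralTE//; last by move=> x; exact: erestrict_ge0.
apply: le_ereal_sup => _ [h /= hf <-]; exists h => // x.
apply: (le_trans (hf x)); rewrite /patch; case: ifPn => [|_]; last exact: g0.
rewrite inE => /= Nx; apply: contrapT => fg; apply: Nx; exact: fgN.
Qed.

Lemma cvg_bounded_integral d (T : measurableType d) (P : probability T R)
    (f_ : nat -> T -> R) (f : T -> R) (C : R) :
  (forall n, measurable_fun setT (f_ n)) ->
  (forall n x, (`|f_ n x| <= C)%R) ->
  (forall x, f_ ^~ x @ \oo --> f x) ->
  \int[P]_x (f_ n x)%:E @[n --> \oo] --> \int[P]_x (f x)%:E.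
Proof.
move=> mf_ fC ff.
have mf : measurable_fun setT f.
  by apply: (measurable_fun_cvg mf_) => x _; exact: ff.
have [] := @dominated_convergence _ _ _ P setT measurableT
  (fun n x => (f_ n x)%:E) (fun x => (f x)%:E) (cst C%:E).
- by move=> n; exact/measurable_EFinP.
- exact/measurable_EFinP.
- by apply/nearW => x; move=> _; apply: cvg_EFin; [exact: nearW | exact: ff].
- exact: finite_measure_integrable_cst.
- by apply/nearW => x; move=> n _; rewrite lee_fin.
- by [].
Qed.

Lemma bounded_integrable d (T : measurableType d) (P : probability T R)
    (f : T -> R) (C : R) :
  measurable_fun setT f -> (forall x, (`|f x| <= C)%R) ->
  P.-integrable setT (EFin \o f).
Proof.
move=> mf fC; apply: (@le_integrable _ _ _ _ _ measurableT _ (cst C%:E)).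
- exact/measurable_EFinP.
- by move=> x _ /=; rewrite lee_fin (le_trans (fC x))// ler_norm.
- exact: finite_measure_integrable_cst.
Qed.

End integration.

(** * Laws determined by trigonometric integrals *)

Section sign_approximation.
Context (R : realType).
Implicit Types x a : R.

(* The iterates converge to the sign on [-1, 1]; being polynomials, they map
   trigonometric polynomials to trigonometric polynomials. *)
Definition sign_step x : R := (3 * x - x ^+ 3) / 2.

Lemma sign_step_le1 x : `|x| <= 1 -> `|sign_step x| <= 1.
Proof.
rewrite !ler_norml /sign_step => /andP[h1 h2]; apply/andP; split.
  rewrite -subr_ge0 [X in _ <= X](_ : _ = (1 + x) ^+ 2 * (2 - x) / 2); last by field.
  by rewrite divr_ge0// mulr_ge0 ?sqr_ge0//; lra.
rewrite -subr_ge0 [X in _ <= X](_ : _ = (1 - x) ^+ 2 * (2 + x) / 2); last by field.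
by rewrite divr_ge0// mulr_ge0 ?sqr_ge0//; lra.
Qed.

Lemma iter_sign_step_le1 n x : `|x| <= 1 -> `|iter n sign_step x| <= 1.
Proof. by move=> x1; elim: n => //= n; exact: sign_step_le1. Qed.

Lemma iter_sign_stepN n x : iter n sign_step (- x) = - iter n sign_step x.
Proof.
by elim: n => //= n ->; rewrite /sign_step; field.
Qed.

(** On (0, 1] the iterates increase, so y >= x throughout, and one step multiplies the distance to 1
    by (2 - y - y^2) / 2 <= 1 - x / 2: the convergence is geometric. *)
Lemma iter_sign_step_lb n x : 0 < x <= 1 ->
  x <= iter n sign_step x <= 1 /\ 1 - iter n sign_step x <= (1 - x / 2) ^+ n.
Proof.
move=> /andP[x0 x1]; elim: n => [|n [/andP[h1 h2] h3]] /=.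
  by rewrite lexx expr0 x1; split => //; lra.
set y := iter n _ _ in h1 h2 h3 *; rewrite /sign_step (exprS (1 - x / 2)); split.
  have y0 : 0 < y by apply: lt_le_trans h1.
  have := sign_step_le1 (_ : `|y| <= 1); rewrite !ler_norml h2 /sign_step => /(_ ltac:(lra)).
  move=> /andP[_ ->]; rewrite andbT; apply: (le_trans h1).
  rewrite -subr_ge0 [X in _ <= X](_ : _ = y * ((1 - y) * (1 + y)) / 2); last by field.
  by rewrite divr_ge0// mulr_ge0// ?(ltW y0)// mulr_ge0//; lra.
have := ler_wpM2l (_ : 0 <= 1 - x / 2) h3; move=> /(_ ltac:(lra)).
apply: le_trans.
have -> : 1 - (3 * y - y ^+ 3) / 2 = (1 - y) * ((2 - y - y ^+ 2) / 2) by field.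
by rewrite mulrC; apply: ler_wpM2r; nra.
Qed.

Lemma cvg_iter_sign_step x : `|x| <= 1 ->
  iter n sign_step x @[n --> \oo] --> Num.sg x.
Proof.
have pos y : 0 < y -> `|y| <= 1 -> iter n sign_step y @[n --> \oo] --> (1 : R).
  move=> y0; rewrite (gtr0_norm y0) => y1.
  apply/cvgrPdist_le => e e0.
  have /cvgrPdist_le/(_ _ e0) : (1 - y / 2) ^+ n @[n --> \oo] --> (0 : R).
    by apply: cvg_expr; rewrite ger0_norm; lra.
  apply: filterS => n; rewrite sub0r normrN => h.
  have [/andP[h1 h2] h3] := iter_sign_step_lb n (introT andP (conj y0 y1)).
  rewrite ger0_norm; last by rewrite subr_ge0.
  by apply: (le_trans h3); apply: le_trans h; rewrite ler_norm.
case: (ltrgt0P x) => [x0 x1|x0 x1|-> _].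
- by rewrite gtr0_sg//; apply: pos; rewrite // gtr0_norm.
- rewrite ltr0_sg//; apply/cvgNP; rewrite opprK.
  have := pos (- x); rewrite oppr_gt0 normrN => /(_ x0 (_ : `|x| <= 1)).
  rewrite ltr0_norm// => /(_ x1) => h.
  by apply: cvg_trans h; apply: near_eq_cvg; apply: nearW => n /=; rewrite iter_sign_stepN.
- rewrite sgr0; apply: cvg_near_cst; apply: nearW => n.
  by elim: n => //= n ->; rewrite /sign_step; ring.
Qed.

(** Once |x - a| < (n + 1) pi, the argument lies in (-pi, pi), where sin has the sign of its
    argument; the sequence is eventually constant. *)
Lemma cvg_sg_sin x a :
  Num.sg (sin ((x - a) / n.+1%:R)) @[n --> \oo] --> Num.sg (x - a).
Proof.
apply: cvg_near_cst.
have [N hN] : exists N : nat, `|x - a| / pi < N%:R.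
  by exists (Num.Def.archi_bound (`|x - a| / pi)); apply: archi_boundP; rewrite divr_ge0// pi_ge0.
have pi0 := pi_gt0 R.
near=> n.
have nN : `|x - a| / n.+1%:R < pi.
  rewrite ltr_pdivrMr// mulrC -ltr_pdivrMr//; apply: (lt_trans hN).
  by rewrite ltr_nat; near: n; exists N.
case: (ltrgt0P (x - a)) nN => [y0|y0|->]; rewrite ?mul0r ?sin0 ?sgr0// => nN.
  rewrite (gtr0_sg y0) gtr0_sg//; apply: sin_gt0_pi.
  by rewrite divr_gt0.
rewrite (ltr0_sg y0) ltr0_sg// -oppr_gt0 -sinN -mulNr; apply: sin_gt0_pi.
by rewrite divr_gt0 ?oppr_gt0.
Unshelve. all: by end_near. Qed.

End sign_approximation.

Section trigonometric_polynomials.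
Context (R : realType) (I : finType).

(** The phase [t] makes sines available without a constructor of their own, and products return to
    the class by the product-to-sum formula ([trig_mul]). *)
Inductive trigpoly : ((I -> R) -> R) -> Prop :=
| trig_cos (c : I -> R) (t : R) : trigpoly (fun v => cos (\sum_i c i * v i + t))
| trig_add G1 G2 : trigpoly G1 -> trigpoly G2 -> trigpoly (fun v => G1 v + G2 v)
| trig_scale (a : R) G : trigpoly G -> trigpoly (fun v => a * G v).

Lemma trig_eq G1 G2 : trigpoly G1 -> G1 =1 G2 -> trigpoly G2.
Proof. by move=> + /funext <-. Qed.

Lemma trig_cst (a : R) : trigpoly (fun=> a).
Proof.
apply: trig_eq (trig_scale a (trig_cos (fun=> 0) 0)) _ => v.
by rewrite big1 ?addr0 ?cos0 ?mulr1// => i _; rewrite mul0r.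
Qed.

Lemma trig_mul G1 G2 : trigpoly G1 -> trigpoly G2 -> trigpoly (fun v => G1 v * G2 v).
Proof.
move=> h1 h2; elim: h1 => [c t|{}G1 G1' _ IH _ IH'|a {}G1 _ IH]; last 2 first.
- by apply: trig_eq (trig_add IH IH') _ => v; rewrite mulrDl.
- by apply: trig_eq (trig_scale a IH) _ => v; rewrite mulrA.
elim: h2 => [c' t'|{}G2 G2' _ IH _ IH'|a {}G2 _ IH]; last 2 first.
- by apply: trig_eq (trig_add IH IH') _ => v; rewrite mulrDr.
- by apply: trig_eq (trig_scale a IH) _ => v; rewrite mulrCA.
apply: trig_eq (trig_add (trig_scale 2^-1 (trig_cos (fun i => c i + c' i) (t + t')))
  (trig_scale 2^-1 (trig_cos (fun i => c i - c' i) (t - t')))) _ => v.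
have -> : \sum_i (c i + c' i) * v i + (t + t') =
    (\sum_i c i * v i + t) + (\sum_i c' i * v i + t').
  by rewrite addrACA -big_split/=; under eq_bigr do rewrite mulrDl.
have -> : \sum_i (c i - c' i) * v i + (t - t') =
    (\sum_i c i * v i + t) - (\sum_i c' i * v i + t').
  rewrite opprD addrACA -sumrB; congr (_ + _).
  by apply: eq_bigr => i _; rewrite mulrBl.
by rewrite cosD cosB; field.
Qed.

Lemma trig_prod (J : Type) (r : seq J) (G : J -> (I -> R) -> R) :
  (forall j, trigpoly (G j)) -> trigpoly (fun v => \prod_(j <- r) G j v).
Proof.
move=> hG; elim: r => [|j r IH].
  by apply: trig_eq (trig_cst 1) _ => v; rewrite big_nil.
by apply: trig_eq (trig_mul (hG j) IH) _ => v; rewrite big_cons.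
Qed.

Lemma trig_iter_sign n G : trigpoly G -> trigpoly (fun v => iter n (@sign_step R) (G v)).
Proof.
move=> hG; elim: n => //= n IH.
apply: trig_eq (trig_add (trig_scale (3 / 2) IH)
  (trig_scale (- 2^-1) (trig_mul IH (trig_mul IH IH)))) _ => v.
by rewrite /sign_step; field.
Qed.

Lemma trig_sin (i : I) (a b : R) : trigpoly (fun v => sin ((v i - a) / b)).
Proof.
apply: trig_eq (trig_cos (fun j => (j == i)%:R / b) (- a / b - pi / 2)) _ => v.
rewrite (bigD1 i)//= big1 ?addr0; last by move=> j /negbTE ->; rewrite !mul0r.
by rewrite eqxx addrA cosBpihalf; congr sin; rewrite mul1r mulrBl mulNr mulrC.
Qed.

(** A polynomial sending the signs -1, 0, 1 to 0, 0, 1: after the sign function it is the indicator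
    of the open half-line, and it preserves trigonometric polynomials. *)
Definition ind_step (u : R) : R := (u ^+ 2 + u) / 2.

Lemma trig_ind_step G : trigpoly G -> trigpoly (fun v => ind_step (G v)).
Proof.
move=> hG; apply: trig_eq (trig_scale 2^-1 (trig_add (trig_mul hG hG) hG)) _ => v.
by rewrite /ind_step; field.
Qed.

Lemma ind_step_sg (u : R) : ind_step (Num.sg u) = (0 < u)%R%:R.
Proof.
rewrite /ind_step; case: (ltrgt0P u) => [u0|u0|->].
- by rewrite gtr0_sg//=; field.
- by rewrite ltr0_sg//=; field.
- by rewrite sgr0/=; field.
Qed.

Lemma ind_step_le1 (u : R) : `|u| <= 1 -> `|ind_step u| <= 1.
Proof.
by rewrite !ler_norml /ind_step => /andP[h1 h2]; apply/andP; split; nra.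
Qed.

Lemma continuous_ind_step : continuous ind_step.
Proof.
by move=> u; rewrite /ind_step; apply: cvgM; [apply: cvgD; [exact: exprn_continuous|]|exact: cvg_cst].
Qed.

End trigonometric_polynomials.

(** * The Cramer-Wold device *)

Section cramer_wold.
Context (R : realType) (I : finType).
Context d (Om : measurableType d) (P : probability Om R).
Context d' (Om' : measurableType d') (P' : probability Om' R).
Variables (V : I -> Om -> R) (V' : I -> Om' -> R).
Hypothesis mV : forall i, measurable_fun setT (V i).
Hypothesis mV' : forall i, measurable_fun setT (V' i).

(** Measurability on both sides and a uniform bound are carried along so that dominated convergence
    passes the equality to pointwise limits. *)
Definition same_mean (G : (I -> R) -> R) : Prop :=
  [/\ measurable_fun setT (fun w => G (V ^~ w)),
      measurable_fun setT (fun w => G (V' ^~ w)),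
      exists C : R, forall v, `|G v| <= C &
      (\int[P]_w (G (V ^~ w))%:E = \int[P']_w (G (V' ^~ w))%:E)%E].

Lemma same_mean_lin (a b : R) G1 G2 : same_mean G1 -> same_mean G2 ->
  same_mean (fun v => a * G1 v + b * G2 v).
Proof.
move=> [m1 m1' [C1 b1] e1] [m2 m2' [C2 b2] e2]; split.
- by apply: measurable_funD; apply: measurable_funM.
- by apply: measurable_funD; apply: measurable_funM.
- exists (`|a| * C1 + `|b| * C2) => v; apply: (le_trans (ler_normD _ _)).
  by rewrite !normrM lerD// ler_wpM2l.
have eD d0 (T0 : measurableType d0) (P0 : probability T0 R) (g1 g2 : T0 -> R) :
    measurable_fun setT g1 -> measurable_fun setT g2 ->
    (forall x, `|g1 x| <= C1) -> (forall x, `|g2 x| <= C2) ->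
    (\int[P0]_w (a * g1 w + b * g2 w)%:E =
     a%:E * \int[P0]_w (g1 w)%:E + b%:E * \int[P0]_w (g2 w)%:E)%E.
  move=> mg1 mg2 bg1 bg2.
  have i1 := bounded_integrable P0 mg1 bg1; have i2 := bounded_integrable P0 mg2 bg2.
  under eq_integral do rewrite EFinD !EFinM.
  by rewrite integralD//= ?integralZl//; apply: integrableZl.
by rewrite !eD// e1 e2.
Qed.

Lemma same_mean_lim (C : R) (G_ : nat -> (I -> R) -> R) G :
  (forall n, same_mean (G_ n)) -> (forall n v, `|G_ n v| <= C) ->
  (forall v, G_ n v @[n --> \oo] --> G v) -> same_mean G.
Proof.
move=> hG bG lG.
have m := fun n => let: And4 h _ _ _ := hG n in h.
have m' := fun n => let: And4 _ h _ _ := hG n in h.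
split.
- by apply: (measurable_fun_cvg m) => w _; exact: lG.
- by apply: (measurable_fun_cvg m') => w _; exact: lG.
- exists C => v; have h : `|G_ n v| @[n --> \oo] --> `|G v| by apply: cvg_norm; exact: lG.
  rewrite -(cvg_lim _ h)//.
  by apply: limr_le; [apply/cvg_ex; eexists; exact: h|exact: nearW].
have l1 := cvg_bounded_integral (P := P) m (fun n w => bG n (V ^~ w)) (fun w => lG (V ^~ w)).
have l2 := cvg_bounded_integral (P := P') m' (fun n w => bG n (V' ^~ w)) (fun w => lG (V' ^~ w)).
rewrite -(cvg_lim _ l1)// -(cvg_lim _ l2)//; congr (limn _).
by apply/funext => n; have [] := hG n.
Qed.

Hypothesis cosVV' : forall c : I -> R,
  (\int[P]_w (cos (\sum_i c i * V i w))%:E = \int[P']_w (cos (\sum_i c i * V' i w))%:E)%E.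
Hypothesis sinVV' : forall c : I -> R,
  (\int[P]_w (sin (\sum_i c i * V i w))%:E = \int[P']_w (sin (\sum_i c i * V' i w))%:E)%E.

Lemma same_mean_trig G : trigpoly G -> same_mean G.
Proof.
have mlin d0 (T0 : measurableType d0) (U : I -> T0 -> R) (c : I -> R) :
    (forall i, measurable_fun setT (U i)) ->
    measurable_fun setT (fun w => \sum_i c i * U i w).
  by move=> mU; apply: measurable_sum => i; apply: measurable_funM.
have cs c : same_mean (fun v => cos (\sum_i c i * v i)).
  split => //.
  - by apply: measurableT_comp; [apply: continuous_measurable_fun; exact: continuous_cos | exact: mlin].
  - by apply: measurableT_comp; [apply: continuous_measurable_fun; exact: continuous_cos | exact: mlin].
  - by exists 1 => v; exact: cos_max.
have sn c : same_mean (fun v => sin (\sum_i c i * v i)).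
  split => //.
  - by apply: measurableT_comp; [apply: continuous_measurable_fun; exact: continuous_sin | exact: mlin].
  - by apply: measurableT_comp; [apply: continuous_measurable_fun; exact: continuous_sin | exact: mlin].
  - by exists 1 => v; exact: sin_max.
elim=> [c t|G1 G2 _ h1 _ h2|a G1 _ h1].
- have := same_mean_lin (cos t) (- sin t) (cs c) (sn c).
  congr same_mean; apply/funext => v; rewrite cosD; ring.
- have := same_mean_lin 1 1 h1 h2.
  by congr same_mean; apply/funext => v; rewrite !mul1r.
- have := same_mean_lin a 0 h1 h1.
  by congr same_mean; apply/funext => v; rewrite mul0r addr0.
Qed.

(* The sign of sin ((v_i - a_i) / n) converges to the sign of v_i - a_i. *)
Lemma same_mean_box (a b : I -> R) :
  same_mean (fun v => \prod_i ((a i < v i)%R%:R - (b i < v i)%R%:R)).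
Proof.
pose y (c : I -> R) N i (v : I -> R) := sin ((v i - c i) / N.+1%:R).
pose f (u1 u2 : R) := ind_step u1 - ind_step u2.
have fle u1 u2 : `|u1| <= 1 -> `|u2| <= 1 -> `|f u1 u2| <= 2.
  move=> h1 h2; apply: (le_trans (ler_normB _ _)).
  by have -> : 2 = 1 + 1 :> R by []; rewrite lerD// ind_step_le1.
have prodle (g : I -> R) : (forall i, `|g i| <= 2) -> `|\prod_i g i| <= 2 ^+ #|I|.
  move=> hg; rewrite normr_prod -prodr_const; apply: ler_prod => i _.
  by rewrite normr_ge0 hg.
have yle c N i v : `|y c N i v| <= 1 by exact: sin_max.
have cprod (u1 u2 : nat -> I -> R) l1 l2 : (forall i, u1 n i @[n --> \oo] --> l1 i) ->
    (forall i, u2 n i @[n --> \oo] --> l2 i) ->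
    \prod_i f (u1 n i) (u2 n i) @[n --> \oo] --> \prod_i f (l1 i) (l2 i).
  move=> h1 h2; apply: cvg_big => [|i _]; first exact: mul_continuous.
  rewrite /f; apply: cvgB; [exact: (cvg_comp _ _ (h1 i) (@continuous_ind_step R (l1 i)))|].
  exact: (cvg_comp _ _ (h2 i) (@continuous_ind_step R (l2 i))).
apply: (@same_mean_lim (2 ^+ #|I|)
  (fun N v => \prod_i f (Num.sg (y a N i v)) (Num.sg (y b N i v)))) => [N|N v|v].
(* For fixed N each sign is itself the limit of its polynomial iterates, for which the product is a
   trigonometric polynomial; so two limits are taken in succession, under the same bound. *)
- apply: (@same_mean_lim (2 ^+ #|I|)
    (fun n v => \prod_i f (iter n (@sign_step R) (y a N i v)) (iter n (@sign_step R) (y b N i v)))).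
  + move=> n; apply: same_mean_trig; apply: trig_prod => i.
    apply: trig_eq (trig_add (trig_ind_step (trig_iter_sign n (trig_sin i (a i) N.+1%:R)))
     (trig_scale (-1) (trig_ind_step (trig_iter_sign n (trig_sin i (b i) N.+1%:R))))) _ => v.
    by rewrite mulN1r.
  + by move=> n v; apply: prodle => i; apply: fle; apply: iter_sign_step_le1.
  + by move=> v; apply: cprod => i; apply: cvg_iter_sign_step.
- by apply: prodle => i; apply: fle; rewrite normr_sg lern1 leq_b1.
- have -> : \prod_i ((a i < v i)%R%:R - (b i < v i)%R%:R) =
      \prod_i f (Num.sg (v i - a i)) (Num.sg (v i - b i)).
    by apply: eq_bigr => i _; rewrite /f !ind_step_sg !subr_gt0.
  by apply: cprod => i; apply: cvg_sg_sin.
Qed.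

Definition pointwise_continuous (J : Type) (F : (J -> R) -> R) : Prop :=
  forall (u : nat -> J -> R) v, (forall i, u n i @[n --> \oo] --> v i) ->
    F (u n) @[n --> \oo] --> F v.

(** F is approximated by step functions on a grid of half-open cells of width 1 / (n + 1) filling
    (-(n + 1), n + 1] in each coordinate, each carrying the value of F at its upper corner. A given
    point is eventually covered, and the corner of its cell converges to it. *)
Lemma same_mean_min F (K : R) : pointwise_continuous F -> (forall v, 0 <= F v) -> 0 <= K ->
  same_mean (fun v => Num.min (F v) K).
Proof.
move=> cF F0 K0.
pose M n := (n.+1 * n.+1 * 2)%N.
pose a n (j : nat) : R := j%:R / n.+1%:R - n.+1%:R.
pose cell n (j : nat) x : R := (a n j < x)%R%:R - (a n j.+1 < x)%R%:R.
have amono n j : a n j <= a n j.+1.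
  by rewrite /a lerD2r ler_wpM2r// ler_nat.
have cell01 n j x : 0 <= cell n j x.
  rewrite /cell subr_ge0 ler_nat; case: (ltP (a n j.+1) x) => // h.
  by rewrite (le_lt_trans (amono n j) h).
pose G n v := \sum_(k : {ffun I -> 'I_(M n)})
  Num.min (F (fun i => a n (k i).+1)) K * \prod_i cell n (k i) (v i).
have sum1 n x : \sum_(j < M n) cell n j x <= 1.
  have -> : \sum_(j < M n) cell n j x = (a n 0%N < x)%R%:R - (a n (M n) < x)%R%:R.
    rewrite -(big_mkord predT (fun j => cell n j x)).
    rewrite (telescope_sumr_eq (fun j => - (a n j < x)%R%:R))//; first by rewrite opprK addrC.
    by move=> j _; rewrite opprK addrC.
  by case: (_ < x); case: (_ < x); rewrite ?subrr ?subr0 ?sub0r//; lra.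
have min0 v : 0 <= Num.min (F v) K by rewrite le_min F0.
have G0 n v : 0 <= G n v.
  by apply: sumr_ge0 => k _; rewrite mulr_ge0// prodr_ge0.
have GK n v : G n v <= K.
  apply: (@le_trans _ _ (\sum_(k : {ffun I -> 'I_(M n)}) K * \prod_i cell n (k i) (v i))).
    by apply: ler_sum => k _; rewrite ler_wpM2r ?prodr_ge0// ge_min lexx orbT.
  (* Summed over all cells, the products of indicators factor into one sum per coordinate, each at
     most 1; this keeps the approximations below K. *)
  rewrite -mulr_sumr -(bigA_distr_bigA (fun i (j : 'I_(M n)) => cell n j (v i))).
  rewrite -[leRHS]mulr1 ler_wpM2l//; rewrite -[leRHS](big1_eq (idx := 1 : R) (op := *%R) (index_enum I) predT).
  by apply: ler_prod => i _; rewrite sum1 sumr_ge0.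
apply: (@same_mean_lim K G) => [n|n v|v].
- rewrite /G; elim: (index_enum _) => [|k r IH].
    have := same_mean_lin 0 0 (same_mean_box (fun=> 0) (fun=> 0)) (same_mean_box (fun=> 0) (fun=> 0)).
    by congr same_mean; apply/funext => v; rewrite big_nil !mul0r addr0.
  have := same_mean_lin (Num.min (F (fun i => a n (k i).+1)) K) 1
    (same_mean_box (fun i => a n (k i)) (fun i => a n (k i).+1)) IH.
  by congr same_mean; apply/funext => v; rewrite big_cons mul1r.
- by rewrite ger0_norm.
have [N hN] : exists N : nat, forall i, `|v i| <= N%:R.
  exists (\max_i Num.Def.archi_bound `|v i|) => i.
  apply: ltW; apply: lt_le_trans (archi_boundP (normr_ge0 _)) _.
  by rewrite ler_nat; apply: leq_bigmax.
(* [c n i] numbers the right end point of the cell containing [v i], so the cell itself has index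
   one less. *)
pose c n i : int := Num.ceil ((v i + n.+1%:R) * n.+1%:R).
pose u n i : R := a n `|c n i|%N.
have hc n i : (N <= n)%N -> [/\ 0 < c n i, (`|c n i| <= M n)%N &
    a n `|c n i|.-1 < v i <= a n `|c n i|%N].
  move=> Nn; have := hN i; rewrite ler_norml => /andP[v1 v2].
  have nN : N%:R < n.+1%:R :> R by rewrite ltr_nat.
  have y0 : 0 < (v i + n.+1%:R) * n.+1%:R by rewrite mulr_gt0//; lra.
  have c0 : 0 < c n i by rewrite /c ceil_gt0.
  have := ceil_itv ((v i + n.+1%:R) * n.+1%:R); rewrite -/(c n i) => /andP[c1 c2].
  have cE : (c n i) = (`|c n i|%N)%:Z by rewrite gez0_abs// ltW.
  have ap : (0 < `|c n i|)%N by rewrite absz_gt0 gt_eqF.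
  split => //.
  - have : (c n i)%:~R < ((M n).+1%:Z)%:~R :> R.
      have -> : ((M n).+1%:Z)%:~R = n.+1%:R * n.+1%:R * 2 + 1 :> R.
        by rewrite /M -addn1 /intmul natrD !natrM.
      have -> : (c n i)%:~R = (c n i - 1)%:~R + 1 :> R by rewrite intrB subrK.
      rewrite ltrD2r; apply: (lt_le_trans c1); nra.
    by rewrite ltr_int cE ltz_nat ltnS.
  - move: c1 c2; rewrite cE intrB -!pmulrn /a => c1 c2; apply/andP; split.
      rewrite ltrBlDr ltr_pdivrMr//; apply: le_lt_trans c1.
      by rewrite -subn1 natrB.
    by rewrite lerBrDr ler_pdivlMr.
have GE n : (N <= n)%N -> G n v = Num.min (F (u n)) K.
  move=> Nn.
  have hk i : (`|c n i|.-1 < M n)%N.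
    by have [h1 h2 _] := hc n i Nn; rewrite prednK// absz_gt0 gt_eqF.
  pose k0 := [ffun i => Ordinal (hk i)].
  have cellE i (j : 'I_(M n)) : cell n j (v i) = (j == k0 i)%:R.
    have [h1 h2 /andP[h3 h4]] := hc n i Nn.
    have ap : (0 < `|c n i|)%N by rewrite absz_gt0 gt_eqF.
    have alt (p q : nat) : (p <= q)%N -> a n p <= a n q.
      by move=> pq; rewrite /a lerD2r ler_wpM2r// ler_nat.
    rewrite /cell -val_eqE ffunE /=; case: (ltngtP j `|c n i|.-1) => [ji|ji|->].
    - rewrite (le_lt_trans (alt _ _ ji) h3) (le_lt_trans _ h3) ?subrr//.
      exact/alt/ltnW.
    - have ji' : (`|c n i| <= j)%N by rewrite -(prednK ap).
      rewrite ltNge (le_trans h4 (alt _ _ ji')) ltNge (le_trans h4 (alt _ _ (leqW ji'))).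
      by rewrite subrr.
    - by rewrite h3 prednK// ltNge h4 subr0.
  rewrite /G (bigD1 k0)//= [X in _ + X]big1 ?addr0; last first.
    move=> k kk0; have [i hi] : exists i, k i != k0 i.
      apply/existsP; apply: contraNT kk0; rewrite negb_exists => /forallP h.
      by apply/eqP/ffunP => i; apply/eqP; have := h i; rewrite negbK.
    by rewrite (bigD1 i)//= cellE (negbTE hi) mul0r mulr0.
  rewrite big1 ?mulr1; last by move=> i _; rewrite cellE eqxx.
  congr (Num.min (F _) K); apply/funext => i; rewrite ffunE/= prednK//.
  by have [h1 _ _] := hc n i Nn; rewrite absz_gt0 gt_eqF.
have uv i : u n i @[n --> \oo] --> v i.
  apply/cvgrPdist_le => e e0; near=> n.
  have Nn : (N <= n)%N by near: n; exists N.
  have [c0 _ /andP[h1 h2]] := hc n i Nn; rewrite -/(u n i) in h2.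
  rewrite distrC ger0_norm ?subr_ge0//.
  apply: (@le_trans _ _ n.+1%:R^-1); last first.
    near: n; have := @cvg_harmonic R; move=> /cvgrPdist_le/(_ _ e0).
    by apply: filterS => n /=; rewrite sub0r normrN ger0_norm.
  have -> : u n i = a n `|c n i|.-1 + n.+1%:R^-1.
    rewrite /u /a; have {1}-> : `|c n i|%N = (`|c n i|.-1).+1.
      by rewrite prednK// absz_gt0 gt_eqF.
    by rewrite -natr1 mulrDl mul1r; ring.
  by rewrite addrAC gerDr subr_le0 ltW.
have minE (x : R) : Num.min x K = (x + K - `|x - K|) / 2.
  by case: (leP x K) => h; [rewrite ler0_norm|rewrite gtr0_norm]; rewrite ?subr_gt0 ?subr_le0//; field.
have : Num.min (F (u n)) K @[n --> \oo] --> Num.min (F v) K.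
  rewrite minE; under eq_fun do rewrite minE.
  apply: cvgM; last exact: cvg_cst.
  apply: cvgB; [apply: cvgD; [exact: cF|exact: cvg_cst]|].
  by apply: cvg_norm; apply: cvgB; [exact: cF|exact: cvg_cst].
apply: cvg_trans; apply: near_eq_cvg; near=> n; rewrite GE//.
by near: n; exists N.
Unshelve. all: by end_near. Qed.

(** The truncations min F n increase to F, so monotone convergence removes the bound of
    [same_mean_min]; the common mean may be infinite. *)
Lemma cramer_wold F : pointwise_continuous F -> (forall v, 0 <= F v) ->
  [/\ measurable_fun setT (fun w => F (V ^~ w)),
      measurable_fun setT (fun w => F (V' ^~ w)) &
      (\int[P]_w (F (V ^~ w))%:E = \int[P']_w (F (V' ^~ w))%:E)%E].
Proof.
move=> cF F0.
have hm n := same_mean_min cF F0 (ler0n R n).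
have m n : measurable_fun setT (fun w => Num.min (F (V ^~ w)) n%:R) by have [] := hm n.
have m' n : measurable_fun setT (fun w => Num.min (F (V' ^~ w)) n%:R) by have [] := hm n.
have lim_min x : (0 : R) <= x -> Num.min x n%:R @[n --> \oo] --> x.
  move=> x0; apply: cvg_near_cst; exists (Num.Def.archi_bound x) => // n /= hn.
  apply/min_idPl; apply: ltW; apply: lt_le_trans (archi_boundP x0) _.
  by rewrite ler_nat.
have mF : measurable_fun setT (fun w => F (V ^~ w)).
  apply: (measurable_fun_cvg m) => w _; exact: lim_min.
have mF' : measurable_fun setT (fun w => F (V' ^~ w)).
  apply: (measurable_fun_cvg m') => w _; exact: lim_min.
split => //.
have lim_int d0 (T0 : measurableType d0) (P0 : probability T0 R) (f : T0 -> R) :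
    measurable_fun setT f -> (forall x, 0 <= f x) ->
    (\int[P0]_x (f x)%:E = limn (fun n => \int[P0]_x (Num.min (f x) n%:R)%:E))%E.
  move=> mf f0; rewrite -monotone_convergence//.
  - apply: eq_integral => x _; apply/esym/cvg_lim => //.
    by apply: cvg_EFin; [exact: nearW|exact: lim_min].
  - by move=> n; apply/measurable_EFinP; apply: measurable_minr.
  - by move=> n x _; rewrite lee_fin le_min f0 /=.
  - move=> x _ n l nl; rewrite lee_fin le_min ge_min lexx/= ge_min.
    by rewrite ler_nat nl orbT.
rewrite !lim_int//; congr (limn _); apply/funext => n.
by have [] := hm n.
Qed.

End cramer_wold.

(** * Normal distributions *)

Section density.
Local Open Scope ereal_scope.
Context (R : realType) d (T : measurableType d).
Variables (mu nu : {measure set T -> \bar R}) (p : T -> R).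
Hypothesis mp : measurable_fun setT p.
Hypothesis p0 : forall x, (0 <= p x)%R.
Hypothesis nuE : forall A, measurable A -> nu A = \int[mu]_(x in A) (p x)%:E.

Import HBNNSimple.

Lemma integral_density_nnsfun (h : {nnsfun T >-> R}) :
  \int[nu]_x (h x)%:E = \int[mu]_x (h x * p x)%:E.
Proof.
rewrite integralT_nnsfun sintegralE.
transitivity (\int[mu]_x (\sum_(r \in range h) (r * \1_(h @^-1` [set r]) x * p x)%:E)).
  rewrite ge0_integral_fsum//; last 2 first.
  - move=> r; apply/measurable_EFinP; apply: measurable_funM => //.
    by apply: measurable_funM => //; apply: measurable_indic.
  - by move=> r x _; rewrite EFinM mule_ge0//; [rewrite EFinM nnfun_muleindic_ge0|rewrite lee_fin].
  apply: eq_fsbigr => r _; rewrite nuE//.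
  (* A negative r has an empty preimage under h; only nonnegative values have to be pulled out of
     the integral. *)
  have [r0|r0] := leP 0%R r; last first.
    rewrite preimage_nnfun0// integral_set0 mule0 integral0_eq// => x _.
    by rewrite indic0 mulr0 mul0r.
  rewrite integral_mkcond -ge0_integralZl_EFin//; last 2 first.
  - by move=> x _; apply: erestrict_ge0 => y _; rewrite lee_fin.
  - apply/(measurable_restrictT _ _).1 => //.
    by apply/measurable_EFinP; exact: measurable_funTS.
  apply: eq_integral => x _; rewrite patchE indicE; case: (x \in _).
    by rewrite mulr1 EFinM.
  by rewrite mulr0 mul0r mule0.
apply: eq_integral => x _; rewrite fsumEFin//; congr EFin.
by rewrite [in RHS]fimfunE !fsbig_finite//= mulr_suml.
Qed.

Lemma ge0_integral_density (f : T -> \bar R) :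
  measurable_fun setT f -> (forall x, 0 <= f x) ->
  \int[nu]_x f x = \int[mu]_x (f x * (p x)%:E).
Proof.
move=> mf f0; pose h := nnsfun_approx measurableT mf.
transitivity (limn (fun n => \int[nu]_x (h n x)%:E)).
  rewrite -monotone_convergence//=.
  - by apply: eq_integral => x _; apply/esym/cvg_lim => //; exact: cvg_nnsfun_approx.
  - by move=> n; exact/measurable_EFinP.
  - by move=> n x _; rewrite lee_fin.
  - by move=> x _ a b ab; rewrite lee_fin; exact/lefP/nd_nnsfun_approx.
under eq_fun do rewrite integral_density_nnsfun.
rewrite -monotone_convergence//=.
- apply: eq_integral => x _; apply/cvg_lim => //.
  under eq_fun do rewrite EFinM.
  apply: cvgeMr => //; exact: cvg_nnsfun_approx.
- by move=> n; apply/measurable_EFinP; exact: measurable_funM.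
- by move=> n x _; rewrite lee_fin mulr_ge0.
- by move=> x _ a b ab; rewrite lee_fin ler_wpM2r//; exact/lefP/nd_nnsfun_approx.
Qed.

Lemma integral_density (f : T -> R) : measurable_fun setT f ->
  \int[nu]_x (f x)%:E = \int[mu]_x (f x * p x)%:E.
Proof.
move=> mf; rewrite integralE [RHS]integralE.
have mf' : measurable_fun setT (EFin \o f) by exact/measurable_EFinP.
rewrite !ge0_integral_density//; [|exact: measurable_funeneg|exact: measurable_funepos].
congr (_ - _); apply: eq_integral => x _.
  rewrite !funeposE EFinM; case: (leP 0 (f x))%R => fx.
    by rewrite !max_l ?mule_ge0 ?lee_fin.
  by rewrite !max_r ?mul0e ?mule_le0_ge0 ?lee_fin ?(ltW fx).
rewrite !funenegE EFinM; case: (leP 0 (f x))%R => fx.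
  by rewrite !max_r ?mul0e ?oppe_le0 ?mule_ge0 ?lee_fin ?oppr_le0.
by rewrite !max_l ?oppe_ge0 ?mule_le0_ge0 ?lee_fin ?oppr_ge0 ?(ltW fx)// mulNe.
Qed.

Lemma integrable_density (f : T -> R) : measurable_fun setT f ->
  nu.-integrable setT (EFin \o f) -> mu.-integrable setT (EFin \o (f \* p)%R).
Proof.
move=> mf /integrableP[_ fi]; apply/integrableP; split.
  by apply/measurable_EFinP; exact: measurable_funM.
move: fi; rewrite ge0_integral_density//; last first.
  by apply: measurableT_comp => //; exact/measurable_EFinP.
congr (_ < _); apply: eq_integral => x _ /=.
by rewrite normrM (ger0_norm (p0 x)).
Qed.

End density.

Section normal.
Context (R : realType) (s : R).
Hypothesis s0 : s != 0.
Let p := normal_pdf 0 s.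
Let N : probability (measurableTypeR R) R := normal_prob 0 s.

Let s2 : 0 < s ^+ 2. Proof. by rewrite exprn_even_gt0. Qed.

Lemma is_derive_normal_pdf (x : R) : is_derive x 1 p (- (x / s ^+ 2) * p x).
Proof.
have pE : p = (fun x => normal_peak s * (expR \o (fun x => - (x ^+ 2) / (s ^+ 2 *+ 2))) x).
  by apply/funext => y; rewrite /p normal_pdfE// /normal_fun subr0.
rewrite pE.
have d1 : is_derive x 1 (fun x : R => - (x ^+ 2) / (s ^+ 2 *+ 2)) (- (x / s ^+ 2)).
  by apply: is_derive_eq; rewrite /= !scaler0 add0r; move: s0; rewrite /GRing.scale/= => ?; field.
have d2 := is_derive1_comp (is_derive_expR _) d1.
have d3 := is_deriveZ (normal_peak s) d2.
by apply: is_derive_eq d3 _; rewrite /= /GRing.scale/=; ring.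
Qed.

Lemma integral_normal (f : R -> R) : measurable_fun setT f ->
  (\int[N]_x (f x)%:E = \int[lebesgue_measure]_x (f x * p x)%:E)%E.
Proof.
apply: (@integral_density R _ (measurableTypeR R) lebesgue_measure N p) => //; first exact: measurable_normal_pdf.
by move=> x; exact: normal_pdf_ge0.
Qed.

(** The density is split as exp (- y) times the exponential of the normal density with standard
    deviation doubled, where y = 3 x^2 / (8 s^2); then y^(n+1) exp (- y) <= (n + 1)!. This yields
    both finite moments and the decay of boundary terms. *)
Lemma normal_moment_bound (n : nat) : exists C : R, 0 <= C /\
  forall x, x ^+ (2 * n.+1) * p x <= C * normal_pdf 0 (2 * s) x.
Proof.
have s20 : 2 * s != 0 by rewrite mulf_neq0.
exists (n.+1`!%:R * (8 * s ^+ 2 / 3) ^+ n.+1 * (normal_peak s / normal_peak (2 * s))).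
split.
  apply: mulr_ge0; last by rewrite divr_ge0 ?normal_peak_ge0.
  by rewrite mulr_ge0// exprn_ge0// divr_ge0// mulr_ge0 ?sqr_ge0.
move=> x; rewrite /p !normal_pdfE// /normal_fun subr0.
have k0 := normal_peak_gt0 s20.
pose y := 3 * x ^+ 2 / (8 * s ^+ 2).
have y0 : 0 <= y by apply: divr_ge0; apply: mulr_ge0 => //; exact: sqr_ge0.
have -> : - x ^+ 2 / (s ^+ 2 *+ 2) = - y - x ^+ 2 / ((2 * s) ^+ 2 *+ 2).
  by rewrite /y; field.
rewrite expRD expRN mulNr.
set e := expR (- (x ^+ 2 / _)).
have e0 : 0 <= e by exact: expR_ge0.
have xE : x ^+ (2 * n.+1) = (8 * s ^+ 2 / 3) ^+ n.+1 * y ^+ n.+1.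
  by rewrite exprM -exprMn; congr (_ ^+ _); rewrite /y; field.
have yle : y ^+ n.+1 * (expR y)^-1 <= (n.+1)`!%:R.
  rewrite ler_pdivrMr ?expR_gt0//.
  have f0 : 0 < (n.+1)`!%:R :> R by rewrite ltr0n fact_gt0.
  rewrite -ler_pdivrMl// mulrC.
  by apply: le_trans (expR_ge1Dxn n y0); rewrite lerDr.
rewrite xE.
have -> : (n.+1)`!%:R * (8 * s ^+ 2 / 3) ^+ n.+1 * (normal_peak s / normal_peak (2 * s)) *
   (normal_peak (2 * s) * e) = (8 * s ^+ 2 / 3) ^+ n.+1 * normal_peak s * e * (n.+1)`!%:R.
  by field; rewrite gt_eqF.
have -> : (8 * s ^+ 2 / 3) ^+ n.+1 * y ^+ n.+1 * (normal_peak s * ((expR y)^-1 * e)) =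
  (8 * s ^+ 2 / 3) ^+ n.+1 * normal_peak s * e * (y ^+ n.+1 * (expR y)^-1) by ring.
apply: ler_wpM2l => //; apply: mulr_ge0 => //; apply: mulr_ge0; last exact: normal_peak_ge0.
by apply: exprn_ge0; apply: divr_ge0 => //; apply: mulr_ge0 => //; exact: sqr_ge0.
Qed.

Lemma normal_moment_integrable (n : nat) :
  N.-integrable setT (EFin \o (fun x : R => `|x| ^+ n)).
Proof.
have even m : (\int[N]_x (x ^+ (2 * m.+1))%:E < +oo)%E.
  have [C [C0 hC]] := normal_moment_bound m.
  rewrite integral_normal; last by exact: measurable_funX.
  apply: (@le_lt_trans _ _ (\int[lebesgue_measure]_x (C%:E * (normal_pdf 0 (2 * s) x)%:E))%E).
    apply: ge0_le_integral => //.
    - by move=> x _; rewrite lee_fin mulr_ge0 ?normal_pdf_ge0// exprM exprn_ge0// sqr_ge0.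
    - apply/measurable_EFinP; apply: measurable_funM; last exact: measurable_normal_pdf.
      exact: measurable_funX.
    - apply/measurable_EFinP; apply: measurable_funM => //; exact: measurable_normal_pdf.
    - by move=> x _; rewrite lee_fin.
  rewrite ge0_integralZl_EFin//.
  - by rewrite integral_normal_pdf mule1 ltry.
  - by move=> x _; rewrite lee_fin normal_pdf_ge0.
  - by apply/measurable_EFinP; exact: measurable_normal_pdf.
have int2 : N.-integrable setT (EFin \o (fun x : R => 1 + x ^+ (2 * n.+1))).
  rewrite (_ : _ \o _ = (fun x => 1%:E + (x ^+ (2 * n.+1))%:E)%E)//.
  apply: integrableD => //; first exact: finite_measure_integrable_cst.
  apply/integrableP; split; first by apply/measurable_EFinP; exact: measurable_funX.
  have ge0 (x : R) : 0 <= x ^+ (2 * n.+1) by rewrite exprM exprn_ge0// sqr_ge0.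
  under eq_integral => x _ do rewrite abse_EFin (ger0_norm (ge0 x)).
  exact: even.
apply: le_integrable int2 => //.
  apply/measurable_EFinP; apply: measurable_funX.
  by apply: continuous_measurable_fun; exact: norm_continuous.
move=> x _ /=; rewrite lee_fin normrX normr_id [leRHS]ger0_norm; last first.
  by rewrite addr_ge0// exprM exprn_ge0// sqr_ge0.
rewrite exprM -(real_normK (num_real x)) -exprM; case: (leP `|x| 1) => x1.
  have h := exprn_ile1 n (normr_ge0 (x : R)) x1.
  by rewrite (le_trans h)// lerDl exprn_ge0.
rewrite (@le_trans _ _ (`|x| ^+ (2 * n.+1)))//; last by rewrite lerDr.
by rewrite ler_weXn2l// ?ltW//; lia.
Qed.

(** The derivative of s^2 H p, because p' = - (x / s^2) p. *)
Let k (H dH : R -> R) x := (s ^+ 2 * dH x - x * H x) * p x.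

(** Stein's identity: the integral of (s^2 H p)' over [-(n + 1), n + 1] is a difference of boundary
    terms that tends to 0, and dominated convergence identifies its limit with the integral over the
    line. *)
Lemma integral_normal_by_parts (H dH : R -> R) (c : R) :
  (forall x : R, is_derive x 1 H (dH x)) -> continuous dH ->
  (forall x, `|H x| <= 1 + `|x|) -> (forall x, `|dH x| <= c) ->
  (\int[N]_x (x * H x)%:E = (s ^+ 2)%:E * \int[N]_x (dH x)%:E)%E.
Proof.
move=> hH cdH bH bdH.
have dp := is_derive_normal_pdf.
have cH : continuous H.
  by move=> x; apply: differentiable_continuous; apply/derivable1_diffP; exact: ex_derive.
have cp : continuous p by exact: continuous_normal_pdf.
have mH : measurable_fun setT H by exact: continuous_measurable_fun.
have mdH : measurable_fun setT dH by exact: continuous_measurable_fun.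
have int1 : N.-integrable setT (EFin \o (fun x : R => x * H x)).
  have /(_ 1%N) i1 := normal_moment_integrable; have /(_ 2%N) i2 := normal_moment_integrable.
  apply: (@le_integrable _ (measurableTypeR R) R N setT measurableT _ (fun x : R => (`|x| ^+ 1)%:E + (`|x| ^+ 2)%:E)%E).
  - by apply/measurable_EFinP; apply: measurable_funM.
  - move=> x _ /=; rewrite lee_fin normrM expr1 expr2 [leRHS]ger0_norm; last first.
      by rewrite addr_ge0// mulr_ge0.
    by rewrite -[X in X + _]mulr1 -mulrDr ler_wpM2l.
  - exact: integrableD.
have int2 : N.-integrable setT (EFin \o dH).
  by apply: (@bounded_integrable R _ (measurableTypeR R) N _ c).
have fin1 : (\int[N]_x (x * H x)%:E)%E \is a fin_num by exact: integrable_fin_num.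
have fin2 : (\int[N]_x (dH x)%:E)%E \is a fin_num by exact: integrable_fin_num.
suff : (\int[N]_x (s ^+ 2 * dH x - x * H x)%:E = 0)%E.
  under eq_integral do rewrite EFinB EFinM.
  rewrite integralB//=; last exact: integrableZl.
  rewrite integralZl// -[X in (X - _)%E]fineK ?fin_numM// -(fineK fin1) -EFinB.
  move=> /(congr1 fine)/eqP; rewrite [fine _]/= subr_eq0 => /eqP <-.
  by rewrite fineK ?fin_numM.
have mk : measurable_fun setT (fun x => s ^+ 2 * dH x - x * H x).
  by apply: measurable_funB; apply: measurable_funM.
rewrite integral_normal//.
have ik : lebesgue_measure.-integrable setT (EFin \o k H dH).
  apply: (@integrable_density R _ (measurableTypeR R) lebesgue_measure N p) => //.
  - exact: measurable_normal_pdf.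
  - by move=> x; exact: normal_pdf_ge0.
  - suff : N.-integrable setT (fun x => (s ^+ 2)%:E * (dH x)%:E - (x * H x)%:E)%E by [].
    by apply: integrableB => //; exact: integrableZl.
pose K x := s ^+ 2 * (H x * p x).
have dK (x : R) : is_derive x 1 K (k H dH x).
  have d1 := is_deriveZ (s ^+ 2) (is_deriveM (hH x) (dp x)).
  by apply: is_derive_eq d1 _; rewrite /k/GRing.scale/=; field.
(* As |H| <= 1 + |x|, a bound on x^2 p makes the boundary terms O(1 / (n + 1)). *)
have [C [C0 hC]] := normal_moment_bound 0%N.
have K0 (n : nat) (x : R) : `|x| = n.+1%:R ->
    `|K x| <= s ^+ 2 * 2 * C * normal_peak (2 * s) * n.+1%:R^-1.
  move=> xn; have n0 : 0 < n.+1%:R :> R by [].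
  have n1 : 1 <= n.+1%:R :> R by rewrite ler1n.
  have -> : s ^+ 2 * 2 * C * normal_peak (2 * s) = s ^+ 2 * (2 * (C * normal_peak (2 * s))).
    by ring.
  rewrite ler_pdivlMr// /K normrM (ger0_norm (ltW s2)) -[leLHS]mulrA ler_wpM2l ?(ltW s2)//.
  rewrite normrM (ger0_norm (normal_pdf_ge0 _ _ _)).
  have h1 := bH x; rewrite xn in h1.
  have h2 := hC x; rewrite -(real_normK (num_real x)) xn in h2.
  have h3 : C * normal_pdf 0 (2 * s) x <= C * normal_peak (2 * s).
    by rewrite ler_wpM2l// normal_pdf_ub// mulf_neq0.
  have p0 : 0 <= p x by exact: normal_pdf_ge0.
  apply: (@le_trans _ _ (2 * (n.+1%:R ^+ (2 * 1) * p x))); last first.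
    by rewrite ler_wpM2l// (le_trans h2).
  rewrite mulrAC mulrA ler_wpM2r// expr2; nra.
have ckx : continuous (k H dH).
  move=> x; rewrite /k; apply: cvgM; last exact: cp.
  apply: cvgB; apply: cvgM; [exact: cvg_cst|exact: cdH|exact: cvg_id|exact: cH].
pose A (n : nat) : set R := `[- n.+1%:R, n.+1%:R]%classic.
have FTC (n : nat) : (\int[lebesgue_measure]_(x in A n) (k H dH x)%:E =
    (K n.+1%:R)%:E - (K (- n.+1%:R)%R)%:E)%E.
  have cK : continuous K.
    by move=> x; apply: differentiable_continuous; apply/derivable1_diffP; exact: ex_derive.
  apply: continuous_FTC2.
  - by rewrite gtrN.
  - by apply: continuous_subspaceT.
  - split; [by move=> x _; exact: ex_derive| |].
    + by apply: cvg_at_right_filter; exact: cK.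
    + by apply: cvg_at_left_filter; exact: cK.
  - by move=> x _; rewrite derive1E; exact: derive_val.
pose f_ (n : nat) x := ((k H dH) \_ (A n)) x.
have [| | | | |_ _ lim1] := @dominated_convergence _ _ _ lebesgue_measure setT measurableT
  (fun n x => (f_ n x)%:E) (EFin \o k H dH) (fun x => `|k H dH x|%:E).
- move=> n; apply/measurable_EFinP; apply/(measurable_restrictT _ _).1; first exact: measurable_itv.
  by apply: measurable_funTS; exact: continuous_measurable_fun.
- by apply/measurable_EFinP; exact: continuous_measurable_fun.
- apply: aeW => x _; apply: cvg_EFin; first exact: nearW.
  apply: cvg_near_cst; exists (Num.Def.archi_bound `|x|) => // n /= hn.
  rewrite /f_ patchE mem_set//= /A/= in_itv/= -ler_norml.
  apply/ltW/(lt_le_trans (archi_boundP (normr_ge0 x))).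
  by rewrite ler_nat (leq_trans hn).
- exact: integrable_norm.
- apply: aeW => x n _; rewrite lee_fin /f_ patchE; case: ifP => // _.
  by rewrite normr0.
have h1 : [sequence (\int[lebesgue_measure]_x (f_ n x)%:E)%E]_n = (fun n : nat => (K n.+1%:R - K (- n.+1%:R))%:E).
  apply/funext => n /=; rewrite EFinB -FTC [RHS]integral_mkcond; apply: eq_integral => x _.
  by rewrite /f_ !patchE; case: ifP.
rewrite h1 in lim1; have lim2 : (fun n : nat => (K n.+1%:R - K (- n.+1%:R))%:E) @ \oo --> 0%:E.
  apply: cvg_EFin; first exact: nearW.
  apply/cvgr0Pnorm_le => e e0; near=> n.
  have -> : (fine \o (fun n : nat => (K n.+1%:R - K (- n.+1%:R))%:E)) n = K n.+1%:R - K (- n.+1%:R) by [].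
  apply: (le_trans (ler_normB _ _)).
  apply: (le_trans (lerD (K0 n _ _) (K0 n _ _))); rewrite ?normrN ?ger0_norm//.
  rewrite -mulrDl; near: n.
  set B := _ + _.
  have : B * n.+1%:R^-1 @[n --> \oo] --> B * 0 by apply: cvgM; [exact: cvg_cst|exact: cvg_harmonic].
  rewrite mulr0 => /cvgr0Pnorm_le/(_ _ e0); apply: filterS => n; apply: le_trans; exact: ler_norm.
by rewrite -(cvg_lim _ lim1)// (cvg_lim _ lim2).
Unshelve. all: by end_near. Qed.

Lemma integral_normal_sqr : (\int[N]_x (x ^+ 2)%:E = (s ^+ 2)%:E)%E.
Proof.
have := @integral_normal_by_parts id (cst 1) 1; rewrite /=.
under eq_integral do rewrite -expr2.
move=> ->//.
- by rewrite integral_cst//= probability_setT mul1e mule1.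
- by move=> x; exact: cvg_cst.
- by move=> x; rewrite lerDr.
- by move=> x; rewrite normr1.
Qed.

(* By parts, F t = E (g (t x)) solves F' = - s^2 t F. *)
Lemma integral_normal_oscillating (g dg : R -> R) (t : R) :
  (forall x : R, is_derive x 1 g (dg x)) -> (forall x : R, is_derive x 1 dg (- g x)) ->
  (forall x, `|g x| <= 1) -> (forall x, `|dg x| <= 1) ->
  \int[N]_x g (t * x) = g 0 * expR (- (s ^+ 2 * t ^+ 2 / 2)).
Proof.
move=> hg hdg bg bdg.
have cont f df : (forall x : R, is_derive x 1 f (df x)) -> continuous (f : R -> R).
  by move=> h x; apply: differentiable_continuous; apply/derivable1_diffP; exact: ex_derive.
have cg := cont _ _ hg; have cdg := cont _ _ hdg.
have dlin (a x : R) : is_derive x 1 ( *%R a) a.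
  have := is_deriveZ a (is_derive_id x 1); move=> h; apply: is_derive_eq h _.
  by rewrite /GRing.scale/= mulr1.
have dcomp f df (a x : R) : (forall x : R, is_derive x 1 f (df x)) ->
    is_derive x 1 (fun y => f (a * y)) (a * df (a * x)).
  move=> h; have := is_derive1_comp (h (a * x)) (dlin a x) => h'.
  by apply: is_derive_eq h' _; rewrite mulrC.
have mcomp (f : R -> R) (a : R) : continuous f -> measurable_fun setT (fun x : R => f (a * x)).
  move=> cf; apply: measurableT_comp; first exact: continuous_measurable_fun.
  exact: measurable_funM.
pose F u := \int[N]_x g (u * x).
have dF (u : R) : is_derive u 1 F (- (s ^+ 2 * u) * F u).
  have uI : `]u - 1, u + 1[%classic u by rewrite /= in_itv/=; apply/andP; split; lra.
  have igN v : N.-integrable setT (EFin \o (fun x : R => g (v * x))).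
    by apply: (@bounded_integrable R _ (measurableTypeR R) N _ 1) => //; exact: mcomp.
  have dgN (v x : R) : `]u - 1, u + 1[%classic v -> setT x -> derivable (fun w : R => g (w * x)) v 1.
    move=> _ _; under eq_fun do rewrite mulrC.
    exact: (ex_derive (is_derive := dcomp g dg x v hg)).
  have d1E (v x : R) : partial1of2 (fun v x : R => g (v * x)) v x = x * dg (v * x).
    rewrite partial1of2E; transitivity ('D_1 (fun w : R => g (x * w)) v).
      by congr ('D_1 _ v); apply/funext => w /=; rewrite mulrC.
    by rewrite (derive_val (is_derive := dcomp g dg x v hg)) (mulrC x v).
  have iG : N.-integrable setT (EFin \o (fun x : R => `|x|)).
    have := normal_moment_integrable 1; by under eq_fun do rewrite /= expr1.
  have ub (v x : R) : `]u - 1, u + 1[%classic v -> setT x ->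
      `|partial1of2 (fun v x : R => g (v * x)) v x| <= `|x|.
    by move=> _ _; rewrite d1E normrM ler_piMr.
  have derF := @derivable_under_integral R _ _ N (fun v x : R => g (v * x)) setT measurableT u
    (u - 1) (u + 1) uI (fun v _ => igN v) dgN (fun x : R => `|x|) (fun x : R => normr_ge0 x) iG ub.
  have := @differentiation_under_integral R _ _ N (fun v x : R => g (v * x)) setT measurableT u
    (u - 1) (u + 1) uI (fun v _ => igN v) dgN (fun x : R => `|x|) (fun x : R => normr_ge0 x) iG ub.
  rewrite derive1E => DF; apply: DeriveDef => //; rewrite /F DF.
  transitivity (fine (\int[N]_x (x * dg (u * x))%:E)).
    by congr fine; apply: eq_integral => x _; rewrite d1E.
  have -> : (\int[N]_x (x * dg (u * x))%:E = (s ^+ 2)%:E * \int[N]_x (u * - g (u * x))%:E)%E.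
    apply: (@integral_normal_by_parts (fun x => dg (u * x)) (fun x => u * - g (u * x)) `|u|).
    - by move=> x; apply: dcomp.
    - move=> x; apply: cvgM; first exact: cvg_cst.
      have hu : u * y @[y --> x] --> u * x by apply: cvgM; [exact: cvg_cst|exact: cvg_id].
      by apply: cvgN; exact: (cvg_comp _ _ hu (cg (u * x))).
    - by move=> x; rewrite (le_trans (bdg _))// lerDl.
    - by move=> x; rewrite normrM normrN ler_piMr.
  under eq_integral do rewrite mulrN -mulNr EFinM.
  rewrite integralZl//; last exact: igN.
  rewrite !fineM//.
  - by rewrite /Rintegral mulrA mulrN.
  - exact: (integrable_fin_num measurableT (igN u)).
  - by rewrite fin_numM//; exact: (integrable_fin_num measurableT (igN u)).
(* The integrating factor of the equation F' = - s^2 u F. *)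
pose G u := F u * expR (s ^+ 2 * u ^+ 2 / 2).
have dG (u : R) : is_derive u 1 G 0.
  have d2 : is_derive u 1 (fun u : R => s ^+ 2 * u ^+ 2 / 2) (s ^+ 2 * u).
    by apply: is_derive_eq; rewrite /= !scaler0 /GRing.scale/=; field.
  have d3 := is_deriveM (dF u) (is_derive1_comp (is_derive_expR _) d2).
  by apply: is_derive_eq d3 _; rewrite /GRing.scale/=; ring.
have : G t = G 0 by exact: is_derive_0_is_cst.
have F0 : F 0 = g 0.
  rewrite /F; under eq_Rintegral do rewrite mul0r.
  have N1 : N setT = 1%E by exact: probability_setT.
  rewrite Rintegral_cst//; transitivity (g 0 * fine (N setT)) => //.
  by rewrite N1 mulr1.
rewrite /G F0 expr0n/= mulr0 mul0r expR0 mulr1 => <-.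
by rewrite -(mulrA (F t)) -expRD subrr expR0 mulr1.
Qed.

Let fin_osc (g : R -> R) (t : R) : continuous g -> (forall x, `|g x| <= 1) ->
  (\int[N]_x (g (t * x))%:E = (\int[N]_x g (t * x))%:E)%E.
Proof.
move=> cg bg; rewrite /Rintegral fineK//; apply: integrable_fin_num => //.
apply: (@bounded_integrable R _ (measurableTypeR R) N _ 1) => //.
apply: measurableT_comp; first exact: continuous_measurable_fun.
exact: measurable_funM.
Qed.

Lemma integral_normal_sin (t : R) : (\int[N]_x (sin (t * x))%:E = 0)%E.
Proof.
rewrite fin_osc; [|exact: continuous_sin|by move=> x; exact: sin_max].
rewrite (@integral_normal_oscillating sin cos) ?sin0 ?mul0r//.
- by move=> x; exact: sin_max.
- by move=> x; exact: cos_max.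
Qed.

Lemma integral_normal_cos (t : R) :
  (\int[N]_x (cos (t * x))%:E = (expR (- (s ^+ 2 * t ^+ 2 / 2)))%:E)%E.
Proof.
rewrite fin_osc; [|exact: continuous_cos|by move=> x; exact: cos_max].
rewrite (@integral_normal_oscillating cos (fun x => - sin x)) ?cos0 ?mul1r//.
- by move=> x; exact: cos_max.
- by move=> x; rewrite normrN; exact: sin_max.
Qed.

End normal.

(** * Scalars and norms *)

Section scalars.
Context (R : realType) (s : scalar_kind).
Local Notation K := (scalars R s).
Implicit Types a b : K.

(** The value 0 over the reals lets identities such as [sre_imag_unitM] and [scalar_decomp] hold for
    both fields, where the imaginary part of a real scalar is 0. *)
Definition imag_unit : K :=
  match s return scalars R s with
  | real_scalars => 0
  | complex_scalars => Complex 0 1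
  end.

Lemma sreD a b : sre (a + b) = sre a + sre b.
Proof. by move: a b; rewrite /sre; case: s => //= -[? ?] [? ?]. Qed.

Lemma simD a b : sim (a + b) = sim a + sim b.
Proof. by move: a b; rewrite /sim; case: s => //= [_ _|[? ?] [? ?]//]; rewrite addr0. Qed.

Lemma sreN a : sre (- a) = - sre a.
Proof. by move: a; rewrite /sre; case: s => //= -[]. Qed.

Lemma simN a : sim (- a) = - sim a.
Proof. by move: a; rewrite /sim; case: s => //= [_|[]//]; rewrite oppr0. Qed.

Lemma sre0 : sre (0 : K) = 0. Proof. by rewrite /sre; case: s. Qed.
Lemma sim0 : sim (0 : K) = 0. Proof. by rewrite /sim; case: s. Qed.

Lemma sreM a b : sre (a * b) = sre a * sre b - sim a * sim b.
Proof.
by move: a b; rewrite /sre /sim; case: s => //= [x y|[? ?] [? ?]//]; rewrite mul0r subr0.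
Qed.

Lemma simM a b : sim (a * b) = sre a * sim b + sim a * sre b.
Proof.
by move: a b; rewrite /sre /sim; case: s => //= [x y|[? ?] [? ?]//]; rewrite mulr0 mul0r addr0.
Qed.

Lemma sre_sconj a : sre (sconj a) = sre a.
Proof. by move: a; rewrite /sre /sconj; case: s => //= -[]. Qed.

Lemma sim_sconj a : sim (sconj a) = - sim a.
Proof. by move: a; rewrite /sim /sconj; case: s => //= [_|[]//]; rewrite oppr0. Qed.

Lemma sre_of_real (x : R) : sre (of_real s x) = x.
Proof. by rewrite /sre /of_real; case: s. Qed.

Lemma sim_of_real (x : R) : sim (of_real s x) = 0.
Proof. by rewrite /sim /of_real; case: s. Qed.

Lemma scalar_ext a b : sre a = sre b -> sim a = sim b -> a = b.
Proof. by move: a b; rewrite /sre /sim; case: s => //= -[? ?] [? ?] /= -> ->. Qed.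

Lemma sre_imag_unitM a : sre (imag_unit * a) = - sim a.
Proof.
by move: a; rewrite /sre /sim /imag_unit; case: s => //= [a|[x y]/=];
  rewrite ?mul0r ?oppr0 ?mul1r ?sub0r.
Qed.

Lemma of_realD (x y : R) : of_real s (x + y) = of_real s x + of_real s y.
Proof. by apply: scalar_ext; rewrite ?sreD ?simD ?sre_of_real ?sim_of_real ?addr0. Qed.

Lemma of_realN (x : R) : of_real s (- x) = - of_real s x.
Proof. by apply: scalar_ext; rewrite ?sreN ?simN ?sre_of_real ?sim_of_real ?oppr0. Qed.

Lemma of_realM (x y : R) : of_real s (x * y) = of_real s x * of_real s y.
Proof.
by apply: scalar_ext; rewrite ?sreM ?simM ?sre_of_real ?sim_of_real;
  rewrite ?mulr0 ?mul0r ?subr0 ?addr0.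
Qed.

Lemma of_real0 : of_real s 0 = 0 :> K. Proof. by rewrite /of_real; case: s. Qed.
Lemma of_real1 : of_real s 1 = 1 :> K. Proof. by rewrite /of_real; case: s. Qed.

Lemma of_real_le (x y : R) : (of_real s x <= of_real s y) = (x <= y).
Proof. by rewrite /of_real; case: s => //; rewrite lecE /= eqxx. Qed.

Lemma of_real_lt (x y : R) : (of_real s x < of_real s y) = (x < y).
Proof. by rewrite /of_real; case: s => //; rewrite ltcE /= eqxx. Qed.

Lemma of_real_sre a : 0 <= a -> of_real s (sre a) = a.
Proof.
move=> a0; apply: scalar_ext; rewrite ?sre_of_real ?sim_of_real//; move: a a0.
by rewrite /sim; case: s => //= a; rewrite lecE => /andP[/eqP] /= ->.
Qed.

Lemma sre_gt0 a : 0 < a -> 0 < sre a.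
Proof. by move=> a0; rewrite -of_real_lt of_real_sre ?of_real0// ltW. Qed.

Lemma nrm_scalarE a : nrm a = Num.sqrt (sre a ^+ 2 + sim a ^+ 2).
Proof.
move: a; rewrite /nrm /sre /sim; case: s => /= [a|a].
  by rewrite expr0n/= addr0 sqrtr_sqr.
by case: a.
Qed.

Lemma nrm_of_real (x : R) : nrm (of_real s x) = `|x|.
Proof. by rewrite nrm_scalarE sre_of_real sim_of_real expr0n addr0 sqrtr_sqr. Qed.

Lemma sqr_nrm_scalar a : nrm a ^+ 2 = sre a ^+ 2 + sim a ^+ 2.
Proof. by rewrite nrm_scalarE sqr_sqrtr// addr_ge0// sqr_ge0. Qed.

Lemma normr_sre_le a : `|sre a| <= nrm a.
Proof. by rewrite nrm_scalarE -sqrtr_sqr ler_wsqrtr// lerDl sqr_ge0. Qed.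

Lemma normr_sim_le a : `|sim a| <= nrm a.
Proof. by rewrite nrm_scalarE -sqrtr_sqr ler_wsqrtr// lerDr sqr_ge0. Qed.

Lemma nrm_scalar_le a : nrm a <= `|sre a| + `|sim a|.
Proof.
rewrite nrm_scalarE -[leRHS]ger0_norm ?addr_ge0// -sqrtr_sqr ler_wsqrtr// sqrrD.
by rewrite !real_normK ?num_real// -addrA addrCA lerDr mulrn_wge0// mulr_ge0.
Qed.

Lemma nrm_imag_unit_le1 : nrm imag_unit <= 1.
Proof.
rewrite nrm_scalarE /sre /sim /imag_unit; case: s => /=.
  by rewrite !expr0n /= addr0 sqrtr0.
by rewrite expr0n/= add0r expr1n sqrtr1.
Qed.

Lemma scalar_decomp a : a = of_real s (sre a) + imag_unit * of_real s (sim a).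
Proof.
apply: scalar_ext; rewrite ?sreD ?simD ?sre_of_real ?sim_of_real.
  by rewrite sre_imag_unitM sim_of_real oppr0 addr0.
rewrite add0r simM sre_of_real sim_of_real mulr0 add0r; move: a.
by rewrite /sim /imag_unit; case: s => /= [|[? ?]]/=; rewrite ?mul0r ?mul1r.
Qed.

Lemma sre_sum (I : Type) (r : seq I) (P : pred I) (f : I -> K) :
  sre (\sum_(i <- r | P i) f i) = \sum_(i <- r | P i) sre (f i).
Proof. exact: (big_morph _ sreD sre0). Qed.

End scalars.

Lemma of_real_nrm_scalar (R : realType) (s : scalar_kind) (a : scalars R s) :
  of_real s (nrm a) = `|a|.
Proof. by rewrite /nrm of_real_sre. Qed.

Section nrm.
Context (R : realType) (s : scalar_kind) (V : normedModType (scalars R s)).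
Implicit Types x y : V.

Lemma of_real_nrm x : of_real s (nrm x) = `|x|.
Proof. by rewrite of_real_sre. Qed.

Lemma nrm_ge0 x : 0 <= nrm x.
Proof. by rewrite -(of_real_le s) of_real_nrm of_real0. Qed.

Lemma nrmD x y : nrm (x + y) <= nrm x + nrm y.
Proof. by rewrite -(of_real_le s) of_realD !of_real_nrm ler_normD. Qed.

Lemma nrmN x : nrm (- x) = nrm x.
Proof. by rewrite /nrm normrN. Qed.

Lemma nrm_distC x y : nrm (x - y) = nrm (y - x).
Proof. by rewrite -nrmN opprB. Qed.

Lemma nrmB x y : nrm (x - y) <= nrm x + nrm y.
Proof. by rewrite -(nrmN y) nrmD. Qed.

Lemma nrm0 : nrm (0 : V) = 0.
Proof. by rewrite /nrm normr0 sre0. Qed.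

Lemma nrm_eq0 x : (nrm x == 0) = (x == 0).
Proof.
rewrite -(normr_eq0 x) -of_real_nrm; apply/eqP/eqP => [->|h]; first by rewrite of_real0.
by rewrite -(sre_of_real s (nrm x)) h sre0.
Qed.

Lemma nrmZ (a : scalars R s) x : nrm (a *: x) = nrm a * nrm x.
Proof.
by rewrite {1}/nrm normrZ -of_real_nrm -of_real_nrm_scalar -of_realM sre_of_real.
Qed.

Lemma ler_nrm_dist x y : `|nrm x - nrm y| <= nrm (x - y).
Proof.
rewrite ler_norml; apply/andP; split.
  by rewrite lerNl opprB lerBlDr nrm_distC; apply: le_trans (nrmD _ _); rewrite subrK.
by rewrite lerBlDr; apply: le_trans (nrmD _ _); rewrite subrK.
Qed.

Lemma cvg_nrmP (u : nat -> V) (l : V) :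
  u n @[n --> \oo] --> l <-> nrm (u n - l) @[n --> \oo] --> (0 : R).
Proof.
split => [/cvgrPdist_lt h|/cvgrPdist_lt h].
  apply/cvgrPdist_lt => e e0; have := h (of_real s e).
  rewrite -[X in X < _](of_real0 R s) of_real_lt => /(_ e0).
  by apply: filterS => n; rewrite -of_real_nrm of_real_lt sub0r normrN ger0_norm ?nrm_ge0// nrm_distC.
apply/cvgrPdist_lt => e e0; have := h (sre e) (sre_gt0 e0).
apply: filterS => n; rewrite sub0r normrN ger0_norm ?nrm_ge0// => hn.
by rewrite -of_real_nrm -(of_real_sre (ltW e0)) of_real_lt nrm_distC.
Qed.

Lemma cvg_nrm (u : nat -> V) (l : V) :
  u n @[n --> \oo] --> l -> nrm (u n) @[n --> \oo] --> nrm l.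
Proof.
move=> /cvg_nrmP h; apply/cvgrPdist_le => e e0.
move/cvgrPdist_le : h => /(_ e e0); apply: filterS => n.
rewrite sub0r normrN ger0_norm ?nrm_ge0//; apply: le_trans.
by rewrite distrC ler_nrm_dist.
Qed.

End nrm.

Section scalar_limits.
Context (R : realType) (s : scalar_kind).
Local Notation K := (scalars R s).

Lemma cvg_scalarP (u : nat -> K) (l : K) : u n @[n --> \oo] --> l <->
  (sre (u n) @[n --> \oo] --> sre l /\ sim (u n) @[n --> \oo] --> sim l).
Proof.
split => [/cvg_nrmP h|[h1 h2]].
  split; apply/cvgrPdist_le => e e0; move/cvgrPdist_le : h => /(_ e e0);
    apply: filterS => n; rewrite sub0r normrN ger0_norm ?nrm_ge0//; apply: le_trans.
    by rewrite -sreN -sreD (le_trans (normr_sre_le _))// nrm_distC.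
  by rewrite -simN -simD (le_trans (normr_sim_le _))// nrm_distC.
apply/cvg_nrmP.
have h0 : `|sre (u n) - sre l| + `|sim (u n) - sim l| @[n --> \oo] --> (0 : R).
  rewrite -(addr0 0); apply: cvgD; [rewrite -(normr0 R) -(subrr (sre l))|
    rewrite -(normr0 R) -(subrr (sim l))]; apply: cvg_norm; apply: cvgB => //; exact: cvg_cst.
apply: (@squeeze_cvgr _ _ _ _ (fun=> 0) _ _ _ _ _ h0); last exact: cvg_cst.
by apply: nearW => n; rewrite nrm_ge0/= (le_trans (nrm_scalar_le _))// sreD simD sreN simN.
Qed.

Lemma cvg_of_real (u : nat -> R) (l : R) : u n @[n --> \oo] --> l ->
  of_real s (u n) @[n --> \oo] --> of_real s l.
Proof.
move=> h; apply/cvg_scalarP; under eq_fun do rewrite sre_of_real.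
under [X in _ /\ (X @ _ --> _)]eq_fun do rewrite sim_of_real.
by rewrite sre_of_real sim_of_real; split => //; exact: cvg_cst.
Qed.

End scalar_limits.

(** * Strong measurability *)

Section strong_measurability.
Context d (T : measurableType d).

Definition simple_fun (V : Type) (f : T -> V) : Prop :=
  finite_set (range f) /\ forall v, measurable (f @^-1` [set v]).

(* X need not be separable, so Borel measurability would not suffice. *)
Definition smeasurable (V : topologicalType) (f : T -> V) : Prop :=
  exists u : nat -> T -> V, (forall n, simple_fun (u n)) /\
    forall x, u n x @[n --> \oo] --> f x.

Lemma simple_fun_comp2 (V1 V2 V3 : Type) (phi : V1 -> V2 -> V3) f g :
  simple_fun f -> simple_fun g -> simple_fun (fun x => phi (f x) (g x)).
Proof.
move=> [ff mf] [fg mg]; have fX := finite_setX ff fg; split.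
  apply: (sub_finite_set _ (finite_image (fun ab => phi ab.1 ab.2) fX)).
  by move=> _ [x _ <-]; exists (f x, g x) => //; split; exists x.
move=> v.
have -> : (fun x => phi (f x) (g x)) @^-1` [set v] =
  \bigcup_(ab in [set ab | (range f `*` range g) ab /\ phi ab.1 ab.2 = v])
    (f @^-1` [set ab.1] `&` g @^-1` [set ab.2]).
  apply/seteqP; split => [x /= h|x [[a b] [/= _ <-] [/= -> ->]]//].
  by exists (f x, g x) => //=; split => //; split; exists x.
apply: fin_bigcup_measurable => [|ab _]; last exact: measurableI.
by apply: sub_finite_set fX => ab [].
Qed.

Lemma simple_fun_cst (V : Type) (v : V) : simple_fun (fun _ : T => v).
Proof.
split; first by apply: (sub_finite_set _ (finite_set1 v)) => _ [x _ <-].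
move=> w; have [->|vw] := pselect (v = w).
  by rewrite (_ : _ @^-1` _ = setT)//; apply/seteqP; split.
by rewrite (_ : _ @^-1` _ = set0)//; apply/seteqP; split.
Qed.

Lemma simple_fun_comp (V1 V2 : Type) (phi : V1 -> V2) f :
  simple_fun f -> simple_fun (fun x => phi (f x)).
Proof.
by move=> hf; apply: (@simple_fun_comp2 _ unit _ (fun v _ => phi v) f (fun=> tt)) => //;
  exact: simple_fun_cst.
Qed.

Lemma smeasurable_comp2 (V1 V2 V3 : topologicalType) (phi : V1 -> V2 -> V3) f g :
  (forall (u : nat -> V1) (v : nat -> V2) a b, u n @[n --> \oo] --> a ->
    v n @[n --> \oo] --> b -> phi (u n) (v n) @[n --> \oo] --> phi a b) ->
  smeasurable f -> smeasurable g -> smeasurable (fun x => phi (f x) (g x)).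
Proof.
move=> cphi [u [hu uf]] [v [hv vg]]; exists (fun n x => phi (u n x) (v n x)).
by split => [n|x]; [exact: simple_fun_comp2|exact: cphi].
Qed.

Lemma smeasurable_cst (V : topologicalType) (v : V) : smeasurable (fun _ : T => v).
Proof. by exists (fun _ _ => v); split => [n|x]; [exact: simple_fun_cst|exact: cvg_cst]. Qed.

Lemma smeasurable_comp (V1 V2 : topologicalType) (phi : V1 -> V2) f :
  (forall (u : nat -> V1) a, u n @[n --> \oo] --> a -> phi (u n) @[n --> \oo] --> phi a) ->
  smeasurable f -> smeasurable (fun x => phi (f x)).
Proof.
move=> cphi [u [hu uf]]; exists (fun n x => phi (u n x)).
by split => [n|x]; [exact: simple_fun_comp|exact: cphi].
Qed.

Import HBSimple.

Lemma smeasurable_realP (R : realType) (f : T -> R) :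
  smeasurable f <-> measurable_fun setT f.
Proof.
split => [[u [hu uf]]|mf].
  apply: (measurable_fun_cvg (h := u)) => [n|x _]; last exact: uf.
  have [fu mu] := hu n; move=> _ B mB; rewrite setTI.
  have -> : u n @^-1` B = \bigcup_(r in range (u n) `&` B) (u n @^-1` [set r]).
    apply/seteqP; split => [x Bx|x [r [_ Br] /= ->]//].
    by exists (u n x) => //; split => //; exists x.
  by apply: fin_bigcup_measurable => [|r _]; [exact: finite_setIl|exact: mu].
have mEf : measurable_fun setT (EFin \o f) by exact/measurable_EFinP.
have [g hg] := approximation_sfun measurableT mEf.
exists (fun n x => g n x); split.
  move=> n; split; first exact: fimfunP.
  by move=> v; rewrite -[X in measurable X]setTI; apply: measurable_funP.
by move=> x; have := hg x I; move/fine_cvgP => [].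
Qed.

End strong_measurability.

Lemma smeasurable_preimage d d' (T : measurableType d) (T' : measurableType d')
    (V : topologicalType) (f : T' -> V) (h : T -> T') :
  measurable_fun setT h -> smeasurable f -> smeasurable (fun x => f (h x)).
Proof.
move=> mh [u [hu uf]]; exists (fun n x => u n (h x)); split => [n|x]; last exact: uf.
have [fu mu] := hu n; split.
  by apply: sub_finite_set fu => _ [x _ <-]; exists (h x).
by move=> v; rewrite -[X in measurable X]setTI; exact: (mh measurableT _ (mu v)).
Qed.

Section strong_measurability_normed.
Context (R : realType) (s : scalar_kind) d (T : measurableType d).
Local Notation K := (scalars R s).

Lemma smeasurable_scalarP (f : T -> K) : smeasurable f <->
  measurable_fun setT (fun x => sre (f x)) /\ measurable_fun setT (fun x => sim (f x)).
Proof.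
split => [hf|[/smeasurable_realP h1 /smeasurable_realP h2]].
  split; apply/smeasurable_realP; apply: smeasurable_comp hf => u a /cvg_scalarP[] //.
have -> : f = fun x => of_real s (sre (f x)) + imag_unit R s * of_real s (sim (f x)).
  by apply/funext => x; rewrite -scalar_decomp.
apply: (smeasurable_comp2 (phi := fun a b => of_real s a + imag_unit R s * of_real s b) _ h1 h2).
move=> u v a b ua vb; apply: cvgD; first exact: cvg_of_real.
by apply: cvgM; [exact: cvg_cst|exact: cvg_of_real].
Qed.

Context (V : normedModType K).

Lemma smeasurable_nrm (f : T -> V) : smeasurable f -> measurable_fun setT (fun x => nrm (f x)).
Proof.
move=> hf; apply/smeasurable_realP; apply: smeasurable_comp hf => u a; exact: cvg_nrm.
Qed.

Lemma smeasurableD (f g : T -> V) :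
  smeasurable f -> smeasurable g -> smeasurable (fun x => f x + g x).
Proof. by apply: smeasurable_comp2 => u v a b ua vb; exact: cvgD. Qed.

Lemma smeasurableN (f : T -> V) : smeasurable f -> smeasurable (fun x => - f x).
Proof. by apply: smeasurable_comp => u a ua; exact: cvgN. Qed.

Lemma smeasurableZ (f : T -> K) (g : T -> V) :
  smeasurable f -> smeasurable g -> smeasurable (fun x => f x *: g x).
Proof. by apply: smeasurable_comp2 => u v a b ua vb; exact: cvgZ. Qed.

Lemma smeasurable_sum (I : Type) (r : seq I) (P : pred I) (f : I -> T -> V) :
  (forall i, P i -> smeasurable (f i)) -> smeasurable (fun x => \sum_(i <- r | P i) f i x).
Proof.
move=> hf; elim: r => [|i r IH].
  by under eq_fun do rewrite big_nil; exact: smeasurable_cst.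
have [Pi|Pi] := boolP (P i); last by under eq_fun do rewrite big_cons (negbTE Pi).
under eq_fun do rewrite big_cons Pi.
by apply: smeasurableD; [exact: hf|exact: IH].
Qed.

End strong_measurability_normed.

(** * Functionals of finitely many coordinates *)

(** Since no convergence is asked of the coordinates from n on, F cannot depend on them
    ([prefix_continuous_eq]). One predicate thus expresses adaptedness, continuity and, through
    [smeasurable_prefix], measurability. *)
Definition prefix_continuous (U V : topologicalType) n (F : (nat -> U) -> V) : Prop :=
  forall (u : nat -> nat -> U) v,
    (forall i, (i < n)%N -> u m i @[m --> \oo] --> v i) ->
    F (u m) @[m --> \oo] --> F v.

Lemma prefix_continuous_eq (R : realType) (U : topologicalType) n
    (F : (nat -> U) -> R) u v :
  prefix_continuous n F -> (forall i, (i < n)%N -> u i = v i) -> F u = F v.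
Proof.
move=> cF uv; have h : F u @[m --> \oo] --> F v.
  by apply: (cF (fun=> u)) => i /uv ->; exact: cvg_cst.
by apply: (cvg_unique _ _ h) => //; exact: cvg_cst.
Qed.

Section cramer_wold_scalar.
Context (R : realType) (s : scalar_kind).
Local Notation K := (scalars R s).

Context d (Om : measurableType d) (P : probability Om R).
Context d' (Om' : measurableType d') (P' : probability Om' R).
Variables (n : nat) (z : nat -> Om -> K) (z' : nat -> Om' -> K).
Hypothesis mz : forall i, (i < n)%N -> smeasurable (z i).
Hypothesis mz' : forall i, (i < n)%N -> smeasurable (z' i).
Hypothesis cosz : forall a : nat -> K,
  (\int[P]_w (cos (sre (\sum_(i < n) a i * z i w)))%:E =
   \int[P']_w (cos (sre (\sum_(i < n) a i * z' i w)))%:E)%E.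
Hypothesis sinz : forall a : nat -> K,
  (\int[P]_w (sin (sre (\sum_(i < n) a i * z i w)))%:E =
   \int[P']_w (sin (sre (\sum_(i < n) a i * z' i w)))%:E)%E.

(** Every real linear form in the real and imaginary parts is the real part of a K-linear form, with
    coefficients c_re - i c_im, so the hypotheses cover all forms that [cramer_wold] asks for. *)
Lemma cramer_wold_scalar (F : (nat -> K) -> R) :
  prefix_continuous n F -> (forall u, 0 <= F u) ->
  [/\ measurable_fun setT (fun w => F (z ^~ w)),
      measurable_fun setT (fun w => F (z' ^~ w)) &
      (\int[P]_w (F (z ^~ w))%:E = \int[P']_w (F (z' ^~ w))%:E)%E].
Proof.
move=> cF F0.
pose coord (a : K) (b : bool) := if b then sim a else sre a.
pose V (i : 'I_n * bool) (w : Om) : R := coord (z i.1 w) i.2.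
pose V' (i : 'I_n * bool) (w : Om') : R := coord (z' i.1 w) i.2.
pose mk (v : 'I_n * bool -> R) (i : nat) : K :=
  if insub i is Some j then of_real s (v (j, false)) + imag_unit R s * of_real s (v (j, true))
  else 0.
pose a (c : 'I_n * bool -> R) (i : nat) : K :=
  if insub i is Some j then of_real s (c (j, false)) - imag_unit R s * of_real s (c (j, true))
  else 0.
have linE (c : 'I_n * bool -> R) (u : nat -> K) :
    \sum_(i : 'I_n * bool) c i * coord (u i.1) i.2 = sre (\sum_(i < n) a c i * u i).
  transitivity (\sum_(p : 'I_n * bool) (fun (i : 'I_n) (b : bool) => c (i, b) * coord (u i) b) p.1 p.2).
    by apply: eq_bigr => -[].
  rewrite sre_sum -(pair_bigA _ (fun (i : 'I_n) (b : bool) => c (i, b) * coord (u i) b))/=.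
  apply: eq_bigr => i _; rewrite /a insubT// => hi.
  rewrite big_bool/= (_ : Sub _ _ = i); last exact/val_inj.
  rewrite mulrBl sreD sreN -mulrA sre_imag_unitM opprK sreM simM.
  by rewrite !sre_of_real !sim_of_real !mul0r subr0 addr0 addrC.
have mV i : measurable_fun setT (V i).
  by case: i => i [] /=; have /smeasurable_scalarP[] := mz (ltn_ord i).
have mV' i : measurable_fun setT (V' i).
  by case: i => i [] /=; have /smeasurable_scalarP[] := mz' (ltn_ord i).
have cosV c : (\int[P]_w (cos (\sum_i c i * V i w))%:E =
    \int[P']_w (cos (\sum_i c i * V' i w))%:E)%E.
  have := cosz (a c); under eq_integral => w _ do rewrite -(linE c (z ^~ w)).
  by move=> ->; apply: eq_integral => w _; rewrite -(linE c (z' ^~ w)).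
have sinV c : (\int[P]_w (sin (\sum_i c i * V i w))%:E =
    \int[P']_w (sin (\sum_i c i * V' i w))%:E)%E.
  have := sinz (a c); under eq_integral => w _ do rewrite -(linE c (z ^~ w)).
  by move=> ->; apply: eq_integral => w _; rewrite -(linE c (z' ^~ w)).
have cG : pointwise_continuous (fun v => F (mk v)).
  move=> u v uv; apply: cF => i ni; rewrite /mk insubT.
  apply: cvgD; first exact: cvg_of_real.
  by apply: cvgM; [exact: cvg_cst|exact: cvg_of_real].
have FE (u : nat -> K) : F (mk (fun i : 'I_n * bool => coord (u i.1) i.2)) = F u.
  apply: (prefix_continuous_eq cF) => i ni; rewrite /mk insubT/=.
  by rewrite -scalar_decomp.
have [m1 m2 e] := cramer_wold mV mV' cosV sinV cG (fun v => F0 (mk v)).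
split.
- by have := m1; congr (measurable_fun _ _); apply/funext => w; rewrite -(FE (z ^~ w)).
- by have := m2; congr (measurable_fun _ _); apply/funext => w; rewrite -(FE (z' ^~ w)).
- under eq_integral do rewrite -FE; rewrite [RHS](_ : _ = \int[P']_w (F (mk (V' ^~ w)))%:E)%E//.
  by apply: eq_integral => w _; rewrite -[in LHS]FE.
Qed.

End cramer_wold_scalar.

Section product_means.
Context (R : realType).
Context d (Om : measurableType d) (P : probability Om R).
Context d' (Om' : measurableType d') (P' : probability Om' R).
Local Open Scope ereal_scope.

Lemma integral_bounded_prod (f : Om -> R) (g : Om' -> R) (C C' : R) :
  measurable_fun setT f -> measurable_fun setT g ->
  (forall x, (`|f x| <= C)%R) -> (forall x, (`|g x| <= C')%R) ->
  \int[P \x P']_w (f w.1 * g w.2)%:E = \int[P]_x (f x)%:E * \int[P']_x (g x)%:E.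
Proof.
move=> mf mg bf bg.
have mfg : measurable_fun setT (fun w : Om * Om' => (f w.1 * g w.2)%R).
  by apply: measurable_funM; apply: measurableT_comp.
have ig := bounded_integrable P' mg bg.
have if_ := bounded_integrable P mf bf.
rewrite -(integral12_prod_meas1 (f := fun w => (f w.1 * g w.2)%:E)).
  under eq_integral => x _.
    rewrite (_ : fubini_F _ _ _ = (f x)%:E * \int[P']_y (g y)%:E).
      over.
    rewrite /fubini_F -integralZl//; apply: eq_integral => y _.
  rewrite -(fineK (integrable_fin_num measurableT ig)).
  by rewrite integralZr.
apply: (@bounded_integrable R _ _ (P \x P')%E _ (C * C')) => // w.
by rewrite normrM ler_pM.
Qed.

(** Multiplicativity of characteristic functions in real terms: as both sine means vanish, the
    addition formulas leave only the product of the cosine means. *)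
Lemma integral_cosD (f : Om -> R) (g : Om' -> R) :
  measurable_fun setT f -> measurable_fun setT g ->
  \int[P]_x (sin (f x))%:E = 0 -> \int[P']_x (sin (g x))%:E = 0 ->
  \int[P \x P']_w (cos (f w.1 + g w.2))%:E =
    \int[P]_x (cos (f x))%:E * \int[P']_x (cos (g x))%:E /\
  \int[P \x P']_w (sin (f w.1 + g w.2))%:E = 0.
Proof.
move=> mf mg f0 g0.
have ms (T : measurableType _) (h : T -> R) : measurable_fun setT h -> measurable_fun setT (sin \o h).
  by move=> mh; apply: measurableT_comp => //; apply: continuous_measurable_fun; exact: continuous_sin.
have mc (T : measurableType _) (h : T -> R) : measurable_fun setT h -> measurable_fun setT (cos \o h).
  by move=> mh; apply: measurableT_comp => //; apply: continuous_measurable_fun; exact: continuous_cos.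
have bs (T : Type) (h : T -> R) x : (`|(sin \o h) x| <= 1)%R by exact: sin_max.
have bc (T : Type) (h : T -> R) x : (`|(cos \o h) x| <= 1)%R by exact: cos_max.
have int1 (u : Om -> R) (v : Om' -> R) : measurable_fun setT u -> measurable_fun setT v ->
    (forall x, (`|u x| <= 1)%R) -> (forall x, (`|v x| <= 1)%R) ->
    (P \x P').-integrable setT (fun w => (u w.1 * v w.2)%:E).
  move=> mu mv bu bv; apply: (@bounded_integrable R _ _ (P \x P')%E _ 1%R).
    by apply: measurable_funM; apply: measurableT_comp.
  by move=> w; rewrite normrM mulr_ile1.
split.
  under eq_integral do rewrite cosD EFinB.
  have i1 := int1 (cos \o f) (cos \o g) (mc _ _ _ mf) (mc _ _ _ mg) (bc _ f) (bc _ g).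
  have i2 := int1 (sin \o f) (sin \o g) (ms _ _ _ mf) (ms _ _ _ mg) (bs _ f) (bs _ g).
  rewrite (integralB measurableT i1 i2).
  rewrite (integral_bounded_prod (mc _ _ _ mf) (mc _ _ _ mg) (bc _ f) (bc _ g)).
  by rewrite (integral_bounded_prod (ms _ _ _ mf) (ms _ _ _ mg) (bs _ f) (bs _ g)) f0 mul0e sube0.
under eq_integral do rewrite sinD EFinD.
have i1 := int1 (sin \o f) (cos \o g) (ms _ _ _ mf) (mc _ _ _ mg) (bs _ f) (bc _ g).
have i2 := int1 (cos \o f) (sin \o g) (mc _ _ _ mf) (ms _ _ _ mg) (bc _ f) (bs _ g).
rewrite (integralD measurableT i1 i2).
rewrite (integral_bounded_prod (ms _ _ _ mf) (mc _ _ _ mg) (bs _ f) (bc _ g)).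
by rewrite (integral_bounded_prod (mc _ _ _ mf) (ms _ _ _ mg) (bc _ f) (bs _ g)) f0 g0 mul0e mule0 adde0.
Qed.

End product_means.

(** * Gaussian sequences *)

Section integral_law.
Context (R : realType) d (Om : measurableType d) (P : probability Om R).
Local Open Scope ereal_scope.

Import HBNNSimple.

(** Extends the factorization from indicators to bounded functions. Simple functions increase to f +
    1 >= 0; the shift is undone by the hypothesis for the whole line, which says that Y has mean
    kappa. *)
Lemma integral_indep_fun (Y V : Om -> R) (kappa : R) :
  measurable_fun setT Y -> measurable_fun setT V -> (forall w, `|Y w| <= 1)%R ->
  (forall B : set R, measurable B ->
     \int[P]_w (Y w * \1_B (V w))%:E = kappa%:E * P (V @^-1` B)) ->
  forall f : R -> R, measurable_fun setT f -> (forall x, `|f x| <= 1)%R ->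
  \int[P]_w (Y w * f (V w))%:E = kappa%:E * \int[P]_w (f (V w))%:E.
Proof.
move=> mY mV bY hB f mf bf.
have mf1 : measurable_fun setT (EFin \o (fun x => f x + 1)%R).
  by apply/measurable_EFinP; apply: measurable_funD.
have f10 x : (0 <= f x + 1)%R by have := bf x; rewrite ler_norml => /andP[? _]; lra.
pose h := nnsfun_approx measurableT mf1.
have hcvg x : h n x @[n --> \oo] --> (f x + 1)%R.
  have : EFin \o h ^~ x @ \oo --> (f x + 1)%:E.
    by apply: (@cvg_nnsfun_approx _ _ _ setT) => // y _; rewrite lee_fin.
  by move/fine_cvgP => [].
have hle n x : (0 <= h n x <= f x + 1)%R.
  apply/andP; split; first exact: fun_ge0.
  rewrite -(cvg_lim _ (hcvg x))//; apply: nondecreasing_cvgn_le.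
    by move=> p q pq; exact/lefP/nd_nnsfun_approx.
  by apply/cvg_ex; eexists; exact: hcvg.
have h2 n x : (`|h n x| <= 2)%R.
  have /andP[h0 h1] := hle n x; rewrite ger0_norm// (le_trans h1)//.
  by have := bf x; rewrite ler_norml => /andP[_ ?]; lra.
have mhV n : measurable_fun setT (fun w => h n (V w)) by exact: measurableT_comp.
have mYh n : measurable_fun setT (fun w => Y w * h n (V w))%R by exact: measurable_funM.
have simple n : \int[P]_w (Y w * h n (V w))%:E = kappa%:E * \int[P]_w (h n (V w))%:E.
  have hE x : h n x = (\sum_(r <- finmap.enum_fset (fset_set (range (h n)))) r * \1_(h n @^-1` [set r]) x)%R.
    by rewrite fimfunE fsbig_finite.
  have mind r : measurable_fun setT (fun w => \1_(h n @^-1` [set r]) (V w) : R).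
    by apply: measurableT_comp => //; apply: measurable_indic.
  have ib r : P.-integrable setT (fun w => (r * \1_(h n @^-1` [set r]) (V w))%:E).
    apply: (bounded_integrable (C := `|r|%R) P).
      exact: measurable_funM.
    by move=> w; rewrite normrM ler_piMr// indicE; case: (_ \in _); rewrite ?normr0 ?normr1.
  have iYb r : P.-integrable setT (fun w => (Y w * (r * \1_(h n @^-1` [set r]) (V w)))%:E).
    apply: (bounded_integrable (C := `|r|%R) P).
      by apply: measurable_funM => //; exact: measurable_funM.
    move=> w; rewrite normrM -[leRHS]mul1r ler_pM// normrM ler_piMr// indicE.
    by case: (_ \in _); rewrite ?normr0 ?normr1.
  under eq_integral do rewrite hE mulr_sumr -sumEFin.
  rewrite integral_sum//; under [in RHS]eq_integral do rewrite hE -sumEFin.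
  rewrite integral_sum// ge0_sume_distrr; last first.
    by move=> r _; rewrite integral_ge0// => w _; rewrite EFinM nnfun_muleindic_ge0.
  apply: eq_bigr => r _.
  have i1 : P.-integrable setT (fun w => (\1_(h n @^-1` [set r]) (V w))%:E).
    apply: (bounded_integrable (C := 1%R) P) => // w; rewrite indicE.
    by case: (_ \in _); rewrite ?normr0 ?normr1.
  have i2 : P.-integrable setT (fun w => (Y w * \1_(h n @^-1` [set r]) (V w))%:E).
    apply: (bounded_integrable (C := 1%R) P); first exact: measurable_funM.
    move=> w; rewrite normrM mulr_ile1// indicE.
    by case: (_ \in _); rewrite ?normr0 ?normr1.
  under eq_integral do rewrite mulrCA EFinM.
  under [in RHS]eq_integral do rewrite EFinM.
  rewrite !integralZl// hB// muleCA; congr (_ * (_ * _)).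
  rewrite (_ : (fun w => _) = (fun w => (\1_(V @^-1` (h n @^-1` [set r])) w)%:E))//.
  rewrite integral_indic ?setIT// -[X in measurable X]setTI; exact: mV.
have l1 : \int[P]_w (Y w * h n (V w))%:E @[n --> \oo] --> \int[P]_w (Y w * (f (V w) + 1))%:E.
  apply: (cvg_bounded_integral (C := 2%R)) => // [n w|w].
    by rewrite normrM -[leRHS]mul1r ler_pM.
  by apply: cvgM; [exact: cvg_cst|exact: hcvg].
have l2 : \int[P]_w (h n (V w))%:E @[n --> \oo] --> \int[P]_w (f (V w) + 1)%:E.
  by apply: (cvg_bounded_integral (C := 2%R)) => // w; exact: hcvg.
have mfV : measurable_fun setT (fun w => f (V w)) by exact: measurableT_comp.
have ifV : P.-integrable setT (fun w => (f (V w))%:E).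
  exact: (bounded_integrable (C := 1%R) P).
have iYf : P.-integrable setT (fun w => (Y w * f (V w))%:E).
  apply: (bounded_integrable (C := 1%R) P); first exact: measurable_funM.
  by move=> w; rewrite normrM mulr_ile1.
have iY : P.-integrable setT (EFin \o Y) by exact: (bounded_integrable (C := 1%R) P).
have e1 : \int[P]_w (Y w * (f (V w) + 1))%:E = kappa%:E * \int[P]_w (f (V w) + 1)%:E.
  rewrite -(cvg_lim _ l1)//; under eq_fun do rewrite simple.
  by apply/cvg_lim => //; apply: cvgeZl.
move: e1; under eq_integral do rewrite mulrDr mulr1 EFinD.
rewrite integralD//; under [in RHS]eq_integral do rewrite EFinD.
rewrite integralD//; last exact: finite_measure_integrable_cst.
have -> : \int[P]_x (Y x)%:E = kappa%:E.
  have := hB setT measurableT; rewrite preimage_setT probability_setT mule1 => <-.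
  by apply: eq_integral => w _; rewrite indicT mulr1.
have -> : \int[P]_x 1 = 1 :> \bar R.
  by transitivity (1 * P setT); [exact: integral_cst|rewrite probability_setT mule1].
rewrite muleDr ?fin_num_adde_defl// mule1 => /(f_equal (fun x => x - kappa%:E)).
by rewrite !addeK.
Qed.

Lemma integral_law (Y : Om -> R) (m : probability (measurableTypeR R) R) (f : R -> R) :
  measurable_fun setT Y -> (forall B : set R, measurable B -> P (Y @^-1` B) = m B) ->
  measurable_fun setT f -> (forall x, 0 <= f x)%R ->
  \int[P]_w (f (Y w))%:E = \int[m]_x (f x)%:E.
Proof.
move=> mY h mf f0.
have mgi : measurable_fun setT (Y : Om -> measurableTypeR R).
  by move=> mT B mB; exact: (mY mT B mB).
pose m1_ : {measure set (measurableTypeR R) -> \bar R} := pushforward P (Y : Om -> measurableTypeR R).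
pose m1 := m1_ mgi.
have -> : \int[P]_w (f (Y w))%:E = \int[m1]_x (f x)%:E.
  rewrite (ge0_integral_pushforward mgi P (D := setT) (f := EFin \o f))//.
    exact/measurable_EFinP.
  by move=> x _; rewrite lee_fin.
by apply: eq_measure_integral => A mA _; exact: h.
Qed.

Lemma integral_law_bounded (Y : Om -> R) (m : probability (measurableTypeR R) R) (f : R -> R) :
  measurable_fun setT Y -> (forall B : set R, measurable B -> P (Y @^-1` B) = m B) ->
  measurable_fun setT f -> (forall x, `|f x| <= 1)%R ->
  \int[P]_w (f (Y w))%:E = \int[m]_x (f x)%:E.
Proof.
move=> mY h mf bf.
have f10 x : (0 <= f x + 1)%R by have := bf x; rewrite ler_norml => /andP[? _]; lra.
have mf1 : measurable_fun setT (fun x => f x + 1)%R by exact: measurable_funD.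
have mfY : measurable_fun setT (fun w => f (Y w)) by exact: measurableT_comp.
have int1 d' (T' : measurableType d') (Q : probability T' R) (u : T' -> R) :
    measurable_fun setT u -> (forall x, `|u x| <= 1)%R ->
    \int[Q]_x (u x + 1)%:E = \int[Q]_x (u x)%:E + 1.
  move=> mu bu; under eq_integral do rewrite EFinD.
  rewrite integralD//.
  - congr (_ + _); transitivity (1 * Q setT); [exact: integral_cst|].
    by rewrite probability_setT mule1.
  - exact: (@bounded_integrable R _ _ Q u 1%R).
  - exact: finite_measure_integrable_cst.
have := integral_law mY h mf1 f10.
rewrite (int1 _ _ P _ mfY)// (int1 _ (measurableTypeR R) m _ mf)// => /(f_equal (fun x => x - 1)).
by rewrite !addeK.
Qed.

End integral_law.

Section gaussian_law.
Context (R : realType) d (Om : measurableType d) (P : probability Om R).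
Local Open Scope ereal_scope.

(** v is the variance. The list gathers what is later used of a Gaussian law, so that the degenerate
    case is treated only once. *)
Lemma gaussian_char (Y : Om -> R) : centred_gaussian P Y ->
  exists v : R, [/\ (0 <= v)%R,
    forall t, \int[P]_w (cos (t * Y w))%:E = (expR (- (v * t ^+ 2 / 2)))%:E,
    forall t, \int[P]_w (sin (t * Y w))%:E = 0,
    \int[P]_w (Y w ^+ 2)%:E = v%:E &
    forall n, P.-integrable setT (fun w => (`|Y w| ^+ n)%:E)].
Proof.
move=> [mY [sigma hY]].
have mct t : measurable_fun setT (fun x : R => cos (t * x)).
  by apply: measurableT_comp; [apply: continuous_measurable_fun; exact: continuous_cos|exact: measurable_funM].
have mst t : measurable_fun setT (fun x : R => sin (t * x)).
  by apply: measurableT_comp; [apply: continuous_measurable_fun; exact: continuous_sin|exact: measurable_funM].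
have mpow n : measurable_fun setT (fun x : R => `|x| ^+ n)%R.
  by apply: measurable_funX; exact: normr_measurable.
have msqr : measurable_fun setT (fun x : R => x ^+ 2)%R by exact: measurable_funX.
have intY (m : probability (measurableTypeR R) R) n :
    (forall B : set R, measurable B -> P (Y @^-1` B) = m B) ->
    \int[m]_x (`|x| ^+ n)%:E < +oo -> P.-integrable setT (fun w => (`|Y w| ^+ n)%:E).
  move=> hm fin; apply/integrableP; split.
    by apply/measurable_EFinP; apply: measurable_funX; exact: measurableT_comp.
  under eq_integral do rewrite abse_EFin ger0_norm ?exprn_ge0//.
  rewrite (integral_law mY hm (f := fun x => `|x| ^+ n)%R)// => x; exact: exprn_ge0.
have [s0|s0] := eqVneq sigma 0%R.
  pose m : probability (measurableTypeR R) R := \d_(0%R : measurableTypeR R).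
  have hm (B : set R) : measurable B -> P (Y @^-1` B) = m B by move=> /hY; rewrite s0 eqxx.
  have dir (f : R -> R) : measurable_fun setT f -> \int[m]_x (f x)%:E = (f 0%R)%:E.
    move=> mf; rewrite integral_dirac ?diracT ?mul1e//; exact/measurable_EFinP.
  exists 0%R; split => // [t|t||n].
  - rewrite (integral_law_bounded mY hm (mct t)) ?dir// => [|x]; last exact: cos_max.
    by rewrite mulr0 cos0 mul0r mul0r oppr0 expR0.
  - rewrite (integral_law_bounded mY hm (mst t)) ?dir// => [|x]; last exact: sin_max.
    by rewrite mulr0 sin0.
  - by rewrite (integral_law mY hm msqr) ?dir ?expr0n// => x; exact: sqr_ge0.
  - by apply: (intY m) => //; rewrite dir// ltry.
pose m : probability (measurableTypeR R) R := normal_prob 0%R sigma.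
have hm (B : set R) : measurable B -> P (Y @^-1` B) = m B by move=> /hY; rewrite (negbTE s0).
exists (sigma ^+ 2)%R; split => [|t|t||n].
- exact: sqr_ge0.
- rewrite (integral_law_bounded mY hm (mct t)) ?integral_normal_cos// => x; exact: cos_max.
- rewrite (integral_law_bounded mY hm (mst t)) ?integral_normal_sin// => x; exact: sin_max.
- by rewrite (integral_law mY hm msqr) ?integral_normal_sqr// => x; exact: sqr_ge0.
- apply: (intY m) => //; have /integrableP[_] := normal_moment_integrable s0 n.
  by apply: le_lt_trans; under [leRHS]eq_integral do rewrite /= ger0_norm ?exprn_ge0//.
Qed.

End gaussian_law.

Section iid_gaussian.
Context (R : realType) d (Om : measurableType d) (P : probability Om R).
Variable g : nat -> {RV P >-> R}.
Hypothesis hg : iid_std_gaussian g.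
Local Open Scope ereal_scope.

Let mg i : measurable_fun setT (g i : Om -> R) := measurable_funP (g i).

Let mcos (f : Om -> R) : measurable_fun setT f -> measurable_fun setT (fun w => cos (f w)).
Proof.
by move=> mf; apply: measurableT_comp => //; apply: continuous_measurable_fun; exact: continuous_cos.
Qed.

Let msin (f : Om -> R) : measurable_fun setT f -> measurable_fun setT (fun w => sin (f w)).
Proof.
by move=> mf; apply: measurableT_comp => //; apply: continuous_measurable_fun; exact: continuous_sin.
Qed.

Let mlin (c : nat -> R) n : measurable_fun setT (fun w => \sum_(i < n) c i * g i w)%R.
Proof. by apply: measurable_sum => i; apply: measurable_funM. Qed.

Let ind (n k : nat) (B : nat -> set R) (w : Om) : R :=
  (\prod_(i < k) \1_(B i) (g (n + i)%N w))%R.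

Let mind n k (B : nat -> set R) : (forall i, measurable (B i)) ->
  measurable_fun setT (ind n k B).
Proof.
by move=> mB; apply: measurable_prod => i _; apply: measurableT_comp => //; exact: measurable_indic.
Qed.

Let ind_le1 n k B w : (`|ind n k B w| <= 1)%R.
Proof.
rewrite /ind; elim: (index_enum _) => [|i r IH]; rewrite ?big_nil ?normr1//.
rewrite big_cons normrM mulr_ile1// indicE.
by case: (_ \in _); rewrite ?normr0 ?normr1.
Qed.

Lemma iid_gaussian_centred i : centred_gaussian P (g i).
Proof.
split => //; exists 1%R => B mB; rewrite oner_eq0; exact: (hg.1 i B mB).
Qed.

Lemma std_gaussian_cos i t : \int[P]_w (cos (t * g i w))%:E = (expR (- (t ^+ 2 / 2)))%:E.
Proof.
have hm (B : set R) : measurable B -> P (g i @^-1` B) = normal_prob 0 1 B by exact: hg.1.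
rewrite (@integral_law_bounded _ _ _ P (g i) (normal_prob 0%R 1%R) (fun x => cos (t * x)))//.
- by rewrite integral_normal_cos ?oner_eq0// expr1n mul1r.
- by apply: measurableT_comp; [apply: continuous_measurable_fun; exact: continuous_cos|exact: measurable_funM].
- by move=> x; exact: cos_max.
Qed.

Lemma std_gaussian_sin i t : \int[P]_w (sin (t * g i w))%:E = 0.
Proof. by have [v [_ _ ->]] := gaussian_char (iid_gaussian_centred i). Qed.

(** Independence is given for events only. The statement therefore carries k further events beyond
    the first n variables: the induction hypothesis with k + 1 events contains an arbitrary event
    for the n-th variable, which [integral_indep_fun] trades for cos and sin of that variable. *)
Let iid_trig (c : nat -> R) n : forall k (B : nat -> set R), (forall i, measurable (B i)) ->
  let q := fine (\prod_(i < k) P (g (n + i)%N @^-1` B i)) in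
  \int[P]_w (cos (\sum_(i < n) c i * g i w) * ind n k B w)%:E =
    (expR (- ((\sum_(i < n) c i ^+ 2) / 2)) * q)%:E /\
  \int[P]_w (sin (\sum_(i < n) c i * g i w) * ind n k B w)%:E = 0.
Proof.
elim: n => [|n IH] k B mB q.
  split; last first.
    by under eq_integral do rewrite big_ord0 sin0 mul0r; rewrite integral0.
  rewrite big_ord0 mul0r oppr0 expR0 mul1r /q -(hg.2 k B mB).
  have mE : measurable (\big[setI/setT]_(i < k) (g i @^-1` B i)).
    by apply: bigsetI_measurable => i _; rewrite -[X in measurable X]setTI; exact: mg.
  rewrite fineK ?fin_num_measure// -[in RHS](setIT (\big[setI/setT]_(i < k) _)) -integral_indic//.
  apply: eq_integral => w _; rewrite big_ord0 cos0 mul1r /ind.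
  congr (_%:E); elim/big_rec2 : _ => [|i x A _ ->]; first by rewrite indicT.
  by rewrite indicI.
pose y (f : R -> R) w := (f (\sum_(i < n) c i * g i w) * ind n.+1 k B w)%R.
pose q' := fine (\prod_(i < k) P (g (n.+1 + i)%N @^-1` B i)).
(* The events of the induction hypothesis: C for the variable of index n, then the given ones
   shifted by one. *)
pose A (C : set R) i := if i is j.+1 then B j else C.
have mA C : measurable C -> forall i, measurable (A C i) by move=> mC [|i]; [exact: mC|exact: mB].
have indE C w : ind n k.+1 (A C) w = (ind n.+1 k B w * \1_C (g n w))%R.
  rewrite /ind big_ord_recl/= addn0 mulrC; congr (_ * _)%R.
  by apply: eq_bigr => i _; rewrite /= addnS addSn.
have prodE C : \prod_(i < k.+1) P (g (n + i)%N @^-1` A C i) = P (g n @^-1` C) * q'%:E.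
  rewrite big_ord_recl/= addn0; congr (_ * _).
  rewrite fineK; last first.
    apply: (@big_ind _ (fun x : \bar R => x \is a fin_num)) => [//|x z|i _]; first exact: fin_numM.
    by rewrite fin_num_measure// -[X in measurable X]setTI; exact: mg.
  by apply: eq_bigr => i _; rewrite addnS addSn.
have finC C : measurable C -> P (g n @^-1` C) \is a fin_num.
  by move=> mC; rewrite fin_num_measure// -[X in measurable X]setTI; exact: mg.
pose E := expR (- ((\sum_(i < n) c i ^+ 2) / 2)).
have qE C : measurable C ->
    fine (\prod_(i < k.+1) P (g (n + i)%N @^-1` A C i)) = (fine (P (g n @^-1` C)) * q')%R.
  by move=> mC; rewrite prodE -(fineK (finC C mC)).
have hcos C : measurable C -> \int[P]_w (y cos w * \1_C (g n w))%:E = (E * q')%:E * P (g n @^-1` C).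
  move=> mC; have [+ _] := IH k.+1 (A C) (mA C mC).
  rewrite qE// -(fineK (finC C mC)) /= => h.
  rewrite -EFinM mulrAC -mulrA -h; apply: eq_integral => w _.
  by rewrite /y indE mulrA.
have hsin C : measurable C -> \int[P]_w (y sin w * \1_C (g n w))%:E = 0%:E * P (g n @^-1` C).
  move=> mC; have [_ h] := IH k.+1 (A C) (mA C mC).
  by rewrite mul0e -h; apply: eq_integral => w _; rewrite /y indE mulrA.
have my f : (forall u : Om -> R, measurable_fun setT u -> measurable_fun setT (fun w => f (u w))) ->
    measurable_fun setT (y f).
  by move=> mf; apply: measurable_funM; [exact: mf|exact: mind].
have by_ f : (forall x, `|f x| <= 1)%R -> forall w, (`|y f w| <= 1)%R.
  by move=> bf w; rewrite normrM mulr_ile1.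
have mct : measurable_fun setT (fun x : R => cos (c n * x)).
  by apply: measurableT_comp; [apply: continuous_measurable_fun; exact: continuous_cos|exact: measurable_funM].
have mst : measurable_fun setT (fun x : R => sin (c n * x)).
  by apply: measurableT_comp; [apply: continuous_measurable_fun; exact: continuous_sin|exact: measurable_funM].
have bc x : (`|cos (c n * x)| <= 1)%R by exact: cos_max.
have bs x : (`|sin (c n * x)| <= 1)%R by exact: sin_max.
have bc0 x : (`|cos x : R| <= 1)%R by exact: cos_max.
have bs0 x : (`|sin x : R| <= 1)%R by exact: sin_max.
have ycc := integral_indep_fun (my _ mcos) (mg n) (by_ _ bc0) hcos mct bc.
have ycs := integral_indep_fun (my _ mcos) (mg n) (by_ _ bc0) hcos mst bs.
have ysc := integral_indep_fun (my _ msin) (mg n) (by_ _ bs0) hsin mct bc.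
have yss := integral_indep_fun (my _ msin) (mg n) (by_ _ bs0) hsin mst bs.
rewrite std_gaussian_cos in ycc ysc; rewrite std_gaussian_sin in ycs yss.
have iy (f h : R -> R) : (forall u : Om -> R, measurable_fun setT u -> measurable_fun setT (fun w => f (u w))) ->
    (forall x, `|f x| <= 1)%R -> measurable_fun setT h -> (forall x, `|h x| <= 1)%R ->
    P.-integrable setT (fun w => (y f w * h (g n w))%:E).
  move=> mf bf mh bh; apply: (bounded_integrable (C := 1%R) P).
    by apply: measurable_funM; [exact: my|exact: measurableT_comp].
  by move=> w; rewrite normrM mulr_ile1// by_.
rewrite -/q' in q *.
split.
  under eq_integral do rewrite big_ord_recr/= cosD mulrBl (mulrAC _ _ (ind _ _ _ _))
     (mulrAC (sin _) _ (ind _ _ _ _)) EFinB.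
  rewrite (integralB measurableT (iy _ _ mcos bc0 mct bc) (iy _ _ msin bs0 mst bs)).
  rewrite ycc yss mul0e sube0 -EFinM; congr (_%:E).
  by rewrite /E big_ord_recr/= mulrAC -expRD mulrDl opprD.
under eq_integral do rewrite big_ord_recr/= sinD mulrDl (mulrAC _ _ (ind _ _ _ _))
   (mulrAC (cos _) _ (ind _ _ _ _)) EFinD.
rewrite (integralD measurableT (iy _ _ msin bs0 mct bc) (iy _ _ mcos bc0 mst bs)).
by rewrite ysc ycs mul0e mule0 adde0.
Qed.

Lemma iid_gaussian_cos (c : nat -> R) n :
  \int[P]_w (cos (\sum_(i < n) c i * g i w))%:E = (expR (- ((\sum_(i < n) c i ^+ 2) / 2)))%:E.
Proof.
have [+ _] := iid_trig c n 0 (fun=> measurableT); rewrite big_ord0 mulr1 => <-.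
by apply: eq_integral => w _; rewrite /ind big_ord0 mulr1.
Qed.

Lemma iid_gaussian_sin (c : nat -> R) n :
  \int[P]_w (sin (\sum_(i < n) c i * g i w))%:E = 0.
Proof.
have [_ <-] := iid_trig c n 0 (fun=> measurableT).
by apply: eq_integral => w _; rewrite /ind big_ord0 mulr1.
Qed.

End iid_gaussian.

(** * Martingale inequalities without conditional expectations *)

Section scalar_inequalities.
Context (R : realType).
Implicit Types (p a b x y z t : R).

Lemma powRB1 p a : 1 <= p -> 0 <= a -> a * a `^ (p - 1) = a `^ p.
Proof. by move=> p1 a0; rewrite -[X in X * _]powRr1// -powRD addrC ?subrK// gt_eqF//; lra. Qed.

(** The sides agree if z <= a. Otherwise the claim is 2 z a^(p-1) <= a^p + z^p, which follows from
    (z - a)^2 >= 0 and, by p >= 2, from a^(p-2) <= z^(p-2). *)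
Lemma powR_max_step p a z : 2 <= p -> 0 <= a -> 0 <= z ->
  Num.max a z `^ p + 2 * (a `^ (p - 1) * z) <= a `^ p + 2 * (Num.max a z `^ (p - 1) * z).
Proof.
move=> p2 a0 z0; have p1 : 1 <= p by lra.
have [za|az] := leP z a; first by [].
rewrite -!(mulrC z) powRB1//.
suff h : 2 * (z * a `^ (p - 1)) <= a `^ p + z `^ p by lra.
have hz : z `^ (p - 1) = z * z `^ (p - 2).
  by rewrite (_ : p - 2 = (p - 1) - 1) ?powRB1//; lra.
have ha : a `^ (p - 1) = a * a `^ (p - 2).
  by rewrite (_ : p - 2 = (p - 1) - 1) ?powRB1//; lra.
rewrite -(powRB1 p1 a0) -(powRB1 p1 z0) hz ha.
have h1 : a `^ (p - 2) <= z `^ (p - 2) by apply: ge0_ler_powR; rewrite ?nnegrE//; lra.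
have := powR_ge0 a (p - 2).
set u := a `^ _ in h1 *; set v := z `^ _ in h1 *; move=> u0.
have : 0 <= u * (z - a) ^+ 2 by rewrite mulr_ge0// sqr_ge0.
have : u * z ^+ 2 <= v * z ^+ 2 by rewrite ler_wpM2r// sqr_ge0.
rewrite !expr2; lra.
Qed.

(** A case distinction at a = 4 z replaces Young's inequality; the factor 1/2 on a^p is what can be
    absorbed at the end of the maximal inequality. *)
Lemma powR_young p a z : 1 <= p -> 0 <= a -> 0 <= z ->
  2 * (a `^ (p - 1) * z) <= 2^-1 * a `^ p + 2 * 4 `^ (p - 1) * z `^ p.
Proof.
move=> p1 a0 z0; rewrite -(powRB1 p1 a0).
have u0 := powR_ge0 a (p - 1); have v0 := powR_ge0 z p; have w0 := powR_ge0 (4 : R) (p - 1).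
have [h|h] := leP (4 * z) a.
  have : a `^ (p - 1) * (4 * z) <= a `^ (p - 1) * a by rewrite ler_wpM2l.
  have : 0 <= 4 `^ (p - 1) * z `^ p by rewrite mulr_ge0.
  lra.
have : a `^ (p - 1) * z <= (4 * z) `^ (p - 1) * z.
  by rewrite ler_wpM2r// ge0_ler_powR// ?nnegrE ?mulr_ge0//; lra.
rewrite powRM// -mulrA (mulrC (z `^ _)) (powRB1 p1 z0).
have : 0 <= a * a `^ (p - 1) by rewrite mulr_ge0.
lra.
Qed.

Lemma expr1D_le (n : nat) t : `|t| <= 1 -> (1 + t) ^+ n <= 1 + n%:R * t + 4 ^+ n * t ^+ 2.
Proof.
rewrite ler_norml => /andP[t1 t2]; elim: n => [|n IH].
  by rewrite !expr0 mul0r addr0 mul1r lerDl sqr_ge0.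
rewrite exprSr; have t3 : 0 <= 1 + t by lra.
apply: (le_trans (ler_wpM2r t3 IH)).
have h0 : (n%:R : R) <= 4 ^+ n.
  by rewrite -natrX ler_nat; apply: ltnW; apply: ltn_expl.
have h1 : 0 <= t ^+ 2 by exact: sqr_ge0.
have h2 : (0 : R) <= 4 ^+ n by rewrite exprn_ge0.
have -> : n.+1%:R = n%:R + 1 :> R by rewrite -natr1.
have -> : 4 ^+ n.+1 = 4 ^+ n * 4 :> R by rewrite exprSr.
move: (4 ^+ n : R) h0 h2 => c h0 h2; move: (n%:R : R) h0 => m h0.
rewrite -subr_ge0 (_ : _ - _ = t ^+ 2 * (c * (2 - t) + (c - m))); last by ring.
by rewrite mulr_ge0// addr_ge0 ?subr_ge0// mulr_ge0//; lra.
Qed.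

Lemma midpoint_powR (r u v : R) : 1 <= r -> 0 <= u -> 0 <= v ->
  ((u + v) / 2) `^ r <= (u `^ r + v `^ r) / 2.
Proof.
move=> r1 u0 v0; have h2 : (1 - 2^-1 : R) = 2^-1 by lra.
rewrite !mulrDl !(mulrC _ 2^-1) -[X in _ + X * v]h2 -[X in _ + X * v `^ r]h2.
by apply: (convex_powR r1 (Itv01 _ _)) => //=;
  rewrite ?inE/= ?in_itv/= ?u0 ?v0// ?invr_ge0// invf_le1 ?ler1n.
Qed.

Lemma two_point_expr (n : nat) t : `|t| <= 1 ->
  ((1 + t) ^+ n + (1 - t) ^+ n) / 2 <= 1 + 4 ^+ n * t ^+ 2.
Proof.
move=> t1; have t1' : `|- t| <= 1 by rewrite normrN.
have := expr1D_le n t1; have := expr1D_le n t1'; rewrite sqrrN; lra.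
Qed.

(** By homogeneity s = 1 and eta = t. Convexity raises the exponent p to an integer n >= p, where
    the binomial bound gives 1 + 4^n t^2; going back costs the exponent p / n <= p / 2, harmless
    because n >= 2 and the base is at least 1. *)
Lemma two_point_powR p : 2 <= p -> exists2 C, 0 <= C & forall s eta, `|eta| <= s ->
  (s + eta) `^ p + (s - eta) `^ p <= 2 * (s ^+ 2 + C * eta ^+ 2) `^ (p / 2).
Proof.
move=> p2; have p0 : 0 < p by lra.
have [n pn n2] : exists2 n, p <= n%:R & (2 <= n)%N.
  exists (2 + Num.bound p)%N => //; apply: ltW.
  by rewrite (lt_le_trans (archi_boundP (ltW p0)))// ler_nat leq_addl.
exists (4 ^+ n); first by rewrite exprn_ge0.
move=> s eta hs; have s0 : 0 <= s by exact: le_trans hs.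
have [s00|s00] := eqVneq s 0.
  have e0 : eta = 0 by apply/normr0_eq0/le_anti; rewrite normr_ge0 -s00 hs.
  by rewrite e0 s00 addr0 subr0 expr0n/= mulr0 addr0 !powR0 ?gt_eqF ?addr0 ?mulr0//; lra.
have sp : 0 < s by rewrite lt_neqAle eq_sym s00.
pose t := eta / s; have et : eta = s * t by rewrite /t mulrC divfK.
have t1 : `|t| <= 1 by rewrite /t normrM normfV (ger0_norm s0) ler_pdivrMr ?mul1r.
have [t2 t3] : 0 <= 1 + t /\ 0 <= 1 - t by move: t1; rewrite ler_norml => /andP[]; split; lra.
rewrite et (_ : s + s * t = s * (1 + t)); last by ring.
rewrite (_ : s - s * t = s * (1 - t)); last by ring.
rewrite (_ : _ + _ * _ ^+ 2 = s ^+ 2 * (1 + 4 ^+ n * t ^+ 2)); last by ring.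
have c0 : 0 <= 4 ^+ n * t ^+ 2 by rewrite mulr_ge0 ?sqr_ge0// exprn_ge0.
rewrite (powRM _ s0 t2) (powRM _ s0 t3) (powRM _ (sqr_ge0 s) (addr_ge0 ler01 c0)).
have -> : (s ^+ 2) `^ (p / 2) = s `^ p.
  by rewrite -(powR_mulrn 2 s0) -powRrM mulrC divfK.
rewrite -mulrDr mulrCA ler_wpM2l ?powR_ge0//.
set u := (1 + t) `^ p; set v := (1 - t) `^ p.
have u0 : 0 <= u by exact: powR_ge0.
have v0 : 0 <= v by exact: powR_ge0.
pose r := n%:R / p; have r1 : 1 <= r by rewrite /r ler_pdivlMr ?mul1r.
have avg := midpoint_powR r1 u0 v0.
have ur : u `^ r = (1 + t) ^+ n by rewrite /u -powRrM /r mulrC divfK ?gt_eqF// powR_mulrn.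
have vr : v `^ r = (1 - t) ^+ n by rewrite /v -powRrM /r mulrC divfK ?gt_eqF// powR_mulrn.
have avg2 : (u `^ r + v `^ r) / 2 <= 1 + 4 ^+ n * t ^+ 2.
  by rewrite ur vr; exact: two_point_expr.
have avg3 : (u + v) / 2 <= (1 + 4 ^+ n * t ^+ 2) `^ r^-1.
  have uv0 : 0 <= (u + v) / 2 by rewrite divr_ge0 ?addr_ge0.
  have r0 : 0 < r by exact: lt_le_trans r1.
  have -> : (u + v) / 2 = (((u + v) / 2) `^ r) `^ r^-1.
    by rewrite -powRrM (mulfV (lt0r_neq0 r0)) (powRr1 uv0).
  apply: ge0_ler_powR; rewrite ?nnegrE ?powR_ge0 ?invr_ge0 ?(ltW r0)//.
    by rewrite addr_ge0.
  exact: (le_trans avg avg2).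
have avg4 : (1 + 4 ^+ n * t ^+ 2) `^ r^-1 <= (1 + 4 ^+ n * t ^+ 2) `^ (p / 2).
  apply: ler_powR; first by rewrite lerDl.
  rewrite /r invfM invrK mulrC ler_pM2l// ler_pV2 ?inE ?unitfE ?ltr0n ?pnatr_eq0//; last first.
  by rewrite -lt0n andbb (leq_trans _ n2).
  by rewrite ler_nat.
by have := le_trans avg3 avg4; rewrite ler_pdivrMr// mulrC.
Qed.

End scalar_inequalities.

Section prefix_measurability.
Context d (T : measurableType d).

(** Coordinates from n on are frozen at [point], so each approximation is a function of finitely
    many simple functions and hence simple. *)
Lemma smeasurable_prefix (U : ptopologicalType) (V : topologicalType) n
    (F : (nat -> U) -> V) (D : nat -> T -> U) :
  prefix_continuous n F -> (forall i, (i < n)%N -> smeasurable (D i)) ->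
  smeasurable (fun w => F (D ^~ w)).
Proof.
move=> cF mD.
have /choice[u hu] : forall i, exists u : nat -> T -> U, (i < n)%N ->
    (forall m, simple_fun (u m)) /\ forall x, u m x @[m --> \oo] --> D i x.
  move=> i; case: (ltnP i n) => [/mD[u hu]|_]; first by exists u.
  by exists (fun _ _ => point).
pose cut k m w i := if (i < k)%N then u i m w else point.
exists (fun m w => F (cut n m w)); split => [m|w]; last first.
  by apply: cF => i ni; rewrite /cut ni; exact: (hu i ni).2.
apply: (simple_fun_comp F).
have : (n <= n)%N by []; elim: {-2}n => [_|k IH kn].
  rewrite (_ : cut 0%N m = fun _ _ => point); first exact: simple_fun_cst.
  by apply/funext => w; apply/funext.
rewrite (_ : cut k.+1 m = fun w => (fun (f : nat -> U) (v : U) i => if i == k then v else f i) (cut k m w) (u k m w)).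
  apply: (simple_fun_comp2 (fun (f : nat -> U) (v : U) i => if i == k then v else f i)).
    by apply: IH; exact: ltnW.
  exact: (hu k kn).1.
apply/funext => w; apply/funext => i; rewrite /cut ltnS leq_eqVlt.
by case: eqP => [->|].
Qed.

End prefix_measurability.

Section means.
Context (R : realType) d (Om : measurableType d) (mu : {measure set Om -> \bar R}).
Implicit Types f g : Om -> R.
Local Open Scope ereal_scope.

Lemma mean_ge0 f : (forall w, 0 <= f w)%R -> 0 <= \int[mu]_w (f w)%:E.
Proof. by move=> f0; apply: integral_ge0 => w _; rewrite lee_fin. Qed.

Lemma mean_le f g : measurable_fun setT f -> measurable_fun setT g ->
  (forall w, 0 <= f w)%R -> (forall w, f w <= g w)%R ->
  \int[mu]_w (f w)%:E <= \int[mu]_w (g w)%:E.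
Proof.
move=> mf mg f0 fg; apply: ge0_le_integral => //.
- by move=> w _; rewrite lee_fin.
- exact/measurable_EFinP.
- exact/measurable_EFinP.
- by move=> w _; rewrite lee_fin.
Qed.

Lemma meanD f g : measurable_fun setT f -> measurable_fun setT g ->
  (forall w, 0 <= f w)%R -> (forall w, 0 <= g w)%R ->
  \int[mu]_w (f w + g w)%:E = \int[mu]_w (f w)%:E + \int[mu]_w (g w)%:E.
Proof.
move=> mf mg f0 g0; under eq_integral do rewrite EFinD.
rewrite ge0_integralD//; do ?[by move=> w _; rewrite lee_fin|exact/measurable_EFinP].
Qed.

Lemma meanZ (c : R) f : measurable_fun setT f -> (forall w, 0 <= f w)%R -> (0 <= c)%R ->
  \int[mu]_w (c * f w)%:E = c%:E * \int[mu]_w (f w)%:E.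
Proof.
move=> mf f0 c0; under eq_integral do rewrite EFinM.
rewrite ge0_integralZl//; [exact/measurable_EFinP|by move=> w _; rewrite lee_fin].
Qed.

Lemma mean_fin f : (forall w, 0 <= f w)%R -> \int[mu]_w (f w)%:E < +oo ->
  exists2 c : R, (0 <= c)%R & \int[mu]_w (f w)%:E = c%:E.
Proof.
move=> f0 foo; have := mean_ge0 f0; move: foo.
by case: (\int[mu]_w _) => [c|//|//]; rewrite lee_fin => _ c0; exists c.
Qed.

End means.

Lemma cvg_sumr (K : numFieldType) (V : normedModType K) (I : Type) (r : seq I)
    (F : nat -> I -> V) (L : I -> V) :
  (forall i, F n i @[n --> \oo] --> L i) ->
  \sum_(i <- r) F n i @[n --> \oo] --> \sum_(i <- r) L i.
Proof.
move=> hF; elim: r => [|i r IH].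
  by rewrite big_nil; under eq_fun do rewrite big_nil; exact: cvg_cst.
by rewrite big_cons; under eq_fun do rewrite big_cons; exact: cvgD.
Qed.

Lemma bigmax_ordS (R : realType) (F : nat -> R) n :
  \big[Num.max/0]_(i < n.+1) F i = Num.max (\big[Num.max/0]_(i < n) F i) (F n).
Proof.
apply/le_anti/andP; split.
  apply: bigmax_le => [|i _]; first by rewrite le_max bigmax_ge_id.
  have := ltn_ord i; rewrite ltnS leq_eqVlt => /predU1P[->|ni]; first by rewrite le_max lexx orbT.
  by rewrite le_max (le_bigmax _ (fun j : 'I_n => F j) (Ordinal ni)).
rewrite ge_max (le_bigmax _ (fun j : 'I_n.+1 => F j) ord_max) andbT.
exact: (le_bigmax_ord xpredT F (leqnSn n)).
Qed.

Lemma cvg_powR (R : realType) (p : R) (u : nat -> R) (a : R) : 0 < p ->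
  (forall n, 0 <= u n) -> u n @[n --> \oo] --> a -> u n `^ p @[n --> \oo] --> a `^ p.
Proof.
move=> p0 u0 ua.
have a0 : 0 <= a.
  by rewrite -(cvg_lim _ ua)//; apply: limr_ge; [apply/cvg_ex; exists a|exact: nearW].
have [a00|an0] := eqVneq a 0; last first.
  have ap : 0 < a by rewrite lt_neqAle eq_sym an0.
  have h0 : p * ln (u n) @[n --> \oo] --> p * ln a.
    apply: cvgM; first exact: cvg_cst.
    exact: (cvg_comp _ _ ua (continuous_ln ap)).
  have h := cvg_comp _ _ h0 (@continuous_expR R (p * ln a)).
  rewrite [X in _ --> X](_ : _ = expR (p * ln a)); last by rewrite /powR gt_eqF.
  apply: cvg_trans h; apply: near_eq_cvg.
  move/cvgrPdist_lt : ua => /(_ a ap); apply: filterS => n.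
  rewrite ltr_norml => /andP[_ h]; rewrite /powR gt_eqF//; lra.
rewrite a00 powR0 ?gt_eqF//; apply/cvgrPdist_lt => e e0.
have e1 : 0 < e `^ p^-1 by exact: powR_gt0.
move/cvgrPdist_lt : ua => /(_ _ e1); apply: filterS => n.
rewrite a00 !sub0r !normrN !ger0_norm ?powR_ge0// => h.
rewrite -[ltRHS](powRr1 (ltW e0)) -(mulVf (lt0r_neq0 p0)) powRrM.
by apply: gt0_ltr_powR; rewrite ?nnegrE ?powR_ge0.
Qed.

(** * Doob's maximal inequality for symmetric steps *)

Section doob.
Context (R : realType) d (Om : measurableType d) (P : probability Om R) (U : ptopologicalType).
Variables (D : nat -> Om -> U) (opp : U -> U).
Local Open Scope ereal_scope.

Definition flip j (u : nat -> U) : nat -> U := fun i => if i == j then opp (u i) else u i.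

(* Stands for the symmetry of the j-th step conditionally on the earlier ones. *)
Definition symmetric_steps N :=
  (forall i, (i < N)%N -> smeasurable (D i)) /\
  forall j, (j < N)%N -> forall F : (nat -> U) -> R, prefix_continuous j.+1 F ->
    (forall u, 0 <= F u)%R ->
    \int[P]_w (F (D ^~ w))%:E = \int[P]_w (F (flip j (D ^~ w)))%:E.

Hypothesis copp : forall (u : nat -> U) a, u n @[n --> \oo] --> a -> opp (u n) @[n --> \oo] --> opp a.

Lemma prefix_continuous_flip (V : topologicalType) n j (F : (nat -> U) -> V) :
  prefix_continuous n F -> prefix_continuous n (fun u => F (flip j u)).
Proof.
move=> cF u v uv; apply: cF => i ni; rewrite /flip; case: eqP => _; last exact: uv.
by apply: copp; exact: uv.
Qed.

Lemma prefix_continuous_le (W V : topologicalType) n m (F : (nat -> W) -> V) :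
  (n <= m)%N -> prefix_continuous n F -> prefix_continuous m F.
Proof. by move=> nm cF u v uv; apply: cF => i ni; apply: uv; exact: leq_trans nm. Qed.

(** This is the substitute for conditioning on the past: after averaging with the flipped step,
    whatever is odd in that step cancels pointwise under the integral. *)
Lemma symmetric_steps_avg N j (F : (nat -> U) -> R) : symmetric_steps N -> (j < N)%N ->
  prefix_continuous j.+1 F -> (forall u, 0 <= F u)%R ->
  \int[P]_w (F (D ^~ w))%:E = \int[P]_w ((F (D ^~ w) + F (flip j (D ^~ w))) / 2)%:E.
Proof.
move=> [mD sD] jN cF F0.
have mF n (G : (nat -> U) -> R) : (n <= N)%N -> prefix_continuous n G ->
    measurable_fun setT (fun w => G (D ^~ w)).
  move=> nN cG; apply/smeasurable_realP; apply: (smeasurable_prefix cG) => i ni.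
  by apply: mD; exact: leq_trans nN.
have m1 : measurable_fun setT (fun w => F (D ^~ w)) by exact: (mF j.+1).
have m2 : measurable_fun setT (fun w => F (flip j (D ^~ w))).
  by apply: (mF j.+1 (fun u => F (flip j u))) => //; exact: prefix_continuous_flip.
have m1' := (measurable_EFinP _ _).2 m1; have m2' := (measurable_EFinP _ _).2 m2.
under [RHS]eq_integral do rewrite EFinM EFinD muleC.
rewrite ge0_integralZl ?lee_fin//; last 2 first.
- by apply: emeasurable_funD.
- by move=> w _; rewrite lee_fin addr_ge0.
rewrite ge0_integralD//; last 2 first.
- by move=> w _; rewrite lee_fin.
- by move=> w _; rewrite lee_fin.
rewrite -(sD j jN F cF F0).
have I0 : 0 <= \int[P]_w (F (D ^~ w))%:E by apply: integral_ge0 => w _; rewrite lee_fin.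
move: I0; case: (\int[P]_w _) => [x|_|]//.
  by rewrite lee_fin => x0; rewrite -EFinD -EFinM; congr (_%:E); lra.
by rewrite addye// gt0_muley// lte_fin.
Qed.

Lemma prefix_continuous_max n (F G : (nat -> U) -> R) :
  prefix_continuous n F -> prefix_continuous n G -> prefix_continuous n (fun u => Num.max (F u) (G u)).
Proof.
move=> cF cG u v uv.
rewrite maxr_absE; under eq_fun do rewrite maxr_absE.
have h1 := cF u v uv; have h2 := cG u v uv.
have h3 : (F (u m) - G (u m))%R @[m --> \oo] --> (F v - G v)%R by apply: cvgB.
by apply: cvgM; [apply: cvgD; [exact: cvgD|exact: cvg_norm]|exact: cvg_cst].
Qed.

Lemma prefix_continuous_bigmax n k (F : nat -> (nat -> U) -> R) :
  (forall j, (j < k)%N -> prefix_continuous n (F j)) ->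
  prefix_continuous n (fun u => \big[Num.max/0%R]_(j < k) F j u).
Proof.
elim: k => [|k IH] cF.
  by move=> u v uv; rewrite big_ord0; under eq_fun do rewrite big_ord0; exact: cvg_cst.
rewrite (_ : (fun u => _) =
  fun u => Num.max (\big[Num.max/0%R]_(j < k) F j u) (F k u)); last first.
  by apply/funext => u; rewrite (bigmax_ordS (F ^~ u)).
by apply: prefix_continuous_max; [apply: IH => j jk; apply: cF; exact: ltnW|exact: cF].
Qed.

Lemma prefix_continuousM n (F G : (nat -> U) -> R) :
  prefix_continuous n F -> prefix_continuous n G -> prefix_continuous n (fun u => F u * G u)%R.
Proof. by move=> cF cG u v uv; apply: cvgM; [exact: cF|exact: cG]. Qed.

Lemma prefix_continuous_powR n (F : (nat -> U) -> R) p : (0 < p)%R -> (forall u, 0 <= F u)%R ->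
  prefix_continuous n F -> prefix_continuous n (fun u => F u `^ p)%R.
Proof. by move=> p0 F0 cF u v uv; apply: cvg_powR => //; exact: cF. Qed.

Lemma measurable_prefix N n (F : (nat -> U) -> R) : symmetric_steps N -> (n <= N)%N ->
  prefix_continuous n F -> measurable_fun setT (fun w => F (D ^~ w)).
Proof.
move=> [mD _] nN cF; apply/smeasurable_realP; apply: (smeasurable_prefix cF) => i ni.
by apply: mD; exact: leq_trans nN.
Qed.

Section doob_maximal.
Variables (z : nat -> (nat -> U) -> R) (p : R) (N : nat).
Hypothesis p2 : (2 <= p)%R.
Hypothesis symD : symmetric_steps N.
Hypothesis z0 : forall j u, (0 <= z j u)%R.
Hypothesis cz : forall j, prefix_continuous j (z j).
Hypothesis submart : forall j u, (j < N)%N -> (2 * z j u <= z j.+1 u + z j.+1 (flip j u))%R.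
Hypothesis finz : forall j, (j <= N)%N -> \int[P]_w (z j (D ^~ w) `^ p)%:E < +oo.

Let a j u : R := \big[Num.max/0%R]_(i < j.+1) z i u.

Let aS j u : a j.+1 u = Num.max (a j u) (z j.+1 u).
Proof. by rewrite /a (bigmax_ordS (z ^~ u)). Qed.

Let a0E u : a 0 u = z 0 u.
Proof. by rewrite /a (bigmax_ordS (z ^~ u)) big_ord0; apply/max_idPr. Qed.

Let a_ge0 j u : (0 <= a j u)%R. Proof. exact: bigmax_ge_id. Qed.

Let ca j : prefix_continuous j (a j).
Proof.
elim: j => [|j IH].
  rewrite (_ : a 0 = z 0); first exact: cz.
  by apply/funext => u; exact: a0E.
rewrite (_ : a j.+1 = fun u => Num.max (a j u) (z j.+1 u)); last by apply/funext => u; exact: aS.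
apply: prefix_continuous_max; last exact: cz.
by apply: prefix_continuous_le IH.
Qed.

Let p0 : (0 < p)%R. Proof. by rewrite (lt_le_trans _ p2). Qed.
Let p10 : (0 < p - 1)%R. Proof. by move: p2; lra. Qed.
Let p1 : (1 <= p)%R. Proof. by move: p2; lra. Qed.

Let c1 j : prefix_continuous j (fun u => a j u `^ p)%R.
Proof. exact: prefix_continuous_powR. Qed.
Let c2 j : prefix_continuous j (fun u => z j u `^ p)%R.
Proof. exact: prefix_continuous_powR. Qed.
Let c3 j : prefix_continuous j (fun u => a j u `^ (p - 1) * z j u)%R.
Proof. by apply: prefix_continuousM => //; exact: prefix_continuous_powR. Qed.
Let c4 j : prefix_continuous j.+1 (fun u => a j u `^ (p - 1) * z j.+1 u)%R.
Proof.
apply: prefix_continuousM => //; apply: prefix_continuous_powR => //.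
by apply: prefix_continuous_le (ca (j := j)).
Qed.

Let I (F : (nat -> U) -> R) := \int[P]_w (F (D ^~ w))%:E.
Local Notation meas jN c := (measurable_prefix symD jN c).

Let fina j : (j <= N)%N -> I (fun u => a j u `^ p)%R < +oo.
Proof.
elim: j => [|j IH] jN.
  rewrite /I (_ : a 0 = z 0); first exact: finz.
  by apply/funext => u; exact: a0E.
have m1 := meas (ltnW jN) (c1 (j := j)); have m2 := meas jN (c2 (j := j.+1)).
apply: (@le_lt_trans _ _ (I (fun u => a j u `^ p)%R + I (fun u => z j.+1 u `^ p)%R)).
  rewrite /I -meanD//; last 2 first.
  - by move=> w; exact: powR_ge0.
  - by move=> w; exact: powR_ge0.
  apply: mean_le.
  - exact: (meas jN (c1 (j := j.+1))).
  - exact: measurable_funD.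
  - by move=> w; exact: powR_ge0.
  - move=> w; rewrite aS; case: (leP (a j _)) => _; [rewrite lerDr|rewrite lerDl]; exact: powR_ge0.
by rewrite lte_add_pinfty ?finz ?IH// ltnW.
Qed.

(** Finiteness of all mixed moments allows the telescoped inequalities to be rearranged as
    inequalities between real numbers; only j = i and j = i + 1 occur. *)
Let finaz i j : (i <= j)%N -> (j <= N)%N -> (j <= i.+1)%N ->
  I (fun u => a i u `^ (p - 1) * z j u)%R < +oo.
Proof.
move=> ij jN ji.
have m1 := meas (leq_trans ij jN) (c1 (j := i)); have m2 := meas jN (c2 (j := j)).
apply: (@le_lt_trans _ _ (I (fun u => a i u `^ p)%R + (2 * 4 `^ (p - 1))%:E * I (fun u => z j u `^ p)%R)).
  rewrite /I -meanZ//; last by move=> w; exact: powR_ge0.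
  rewrite -meanD//; last 3 first.
  - exact: measurable_funM.
  - by move=> w; exact: powR_ge0.
  - by move=> w; rewrite mulr_ge0// powR_ge0.
  apply: mean_le.
  - apply: (measurable_prefix (F := fun u => (a i u `^ (p - 1) * z j u)%R) symD jN); move: ij ji; rewrite leq_eqVlt => /predU1P[<- _|ij ji]; first exact: c3.
    have -> : j = i.+1 by apply/eqP; rewrite eqn_leq ij ji.
    exact: c4.
  - by apply: measurable_funD => //; exact: measurable_funM.
  - by move=> w; rewrite mulr_ge0// powR_ge0.
  - move=> w; have := powR_young p1 (a_ge0 i (D ^~ w)) (z0 j (D ^~ w)).
    have := powR_ge0 (a i (D ^~ w)) p.
    have : (0 <= a i (D ^~ w) `^ (p - 1) * z j (D ^~ w))%R by rewrite mulr_ge0// powR_ge0.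
    lra.
apply: lte_add_pinfty; first by apply: fina; exact: leq_trans jN.
rewrite lte_mul_pinfty ?lee_fin//; exact: finz.
Qed.

(** The running maximum [a j] ignores the step of index j, hence is unchanged by its flip, and the
    submartingale inequality can be multiplied by a_j^(p-1). *)
Let increment j : (j < N)%N ->
  I (fun u => a j u `^ (p - 1) * z j u)%R <= I (fun u => a j u `^ (p - 1) * z j.+1 u)%R.
Proof.
move=> jN; pose F u := (a j u `^ (p - 1) * z j.+1 u)%R.
have F0 u : (0 <= F u)%R by rewrite mulr_ge0// powR_ge0.
have cF : prefix_continuous j.+1 F by exact: c4.
rewrite [leRHS](symmetric_steps_avg symD jN cF F0).
have mF := meas jN cF.
have mF' := meas jN (prefix_continuous_flip (j := j) cF).
apply: mean_le.
- exact: (meas (ltnW jN) (c3 (j := j))).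
- by apply: measurable_funM => //; apply: measurable_funD.
- by move=> w; rewrite mulr_ge0// powR_ge0.
- move=> w; rewrite /F (_ : a j (flip j _) = a j (D ^~ w)); last first.
    by apply: (prefix_continuous_eq (ca (j := j))) => i ij; rewrite /flip ltn_eqF.
  rewrite -mulrDr -mulrA ler_wpM2l ?powR_ge0// ler_pdivlMr// mulrC; exact: submart.
Qed.

(* [powR_max_step], applied to the running maximum a and telescoped, is a
   pathwise form of Doob's inequality; the submartingale property only enters
   through E (a_j^(p-1) z_(j+1)) >= E (a_j^(p-1) z_j). *)
Lemma doob_maximal : \int[P]_w ((\big[Num.max/0%R]_(j < N.+1) z j (D ^~ w)) `^ p)%:E <=
  (4 * 4 `^ (p - 1))%:E * \int[P]_w (z N (D ^~ w) `^ p)%:E.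
Proof.
have pow0 j u : (0 <= a j u `^ (p - 1) * z j u)%R by rewrite mulr_ge0// powR_ge0.
have main j : (j <= N)%N -> I (fun u => a j u `^ p)%R <= 2%:E * I (fun u => a j u `^ (p - 1) * z j u)%R.
  elim: j => [|j IH] jN.
    rewrite /I -meanZ//; last exact: (meas jN (c3 (j := 0%N))).
    apply: mean_le.
    - exact: (meas jN (c1 (j := 0%N))).
    - by apply: measurable_funM => //; exact: (meas jN (c3 (j := 0%N))).
    - by move=> w; exact: powR_ge0.
    - move=> w; rewrite -a0E; have := powR_ge0 (a 0 (D ^~ w)) p.
      by have := powRB1 p1 (a_ge0 0 (D ^~ w)); lra.
  have jN' := ltnW jN.
  have {}IH := IH jN'.
  have inc := increment jN.
  have [u _ uE] : exists2 c, (0 <= c)%R & I (fun u => a j u `^ p)%R = c%:E.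
    by apply: mean_fin; [move=> w; exact: powR_ge0|exact: fina].
  have [u' _ u'E] : exists2 c, (0 <= c)%R & I (fun u => a j.+1 u `^ p)%R = c%:E.
    by apply: mean_fin; [move=> w; exact: powR_ge0|exact: fina].
  have [v _ vE] : exists2 c, (0 <= c)%R & I (fun u => a j u `^ (p - 1) * z j u)%R = c%:E.
    by apply: mean_fin; [move=> w; exact: pow0|exact: finaz].
  have [v' _ v'E] : exists2 c, (0 <= c)%R & I (fun u => a j.+1 u `^ (p - 1) * z j.+1 u)%R = c%:E.
    by apply: mean_fin; [move=> w; exact: pow0|exact: finaz].
  have [y _ yE] : exists2 c, (0 <= c)%R & I (fun u => a j u `^ (p - 1) * z j.+1 u)%R = c%:E.
    by apply: mean_fin; [move=> w; rewrite mulr_ge0// powR_ge0|exact: finaz].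
  have step : I (fun u => a j.+1 u `^ p)%R + 2%:E * I (fun u => a j u `^ (p - 1) * z j.+1 u)%R <=
      I (fun u => a j u `^ p)%R + 2%:E * I (fun u => a j.+1 u `^ (p - 1) * z j.+1 u)%R.
    have m1 := meas jN' (c1 (j := j)); have m2 := meas jN (c1 (j := j.+1)).
    have m3 := meas jN (c3 (j := j.+1)); have m4 := meas jN (c4 (j := j)).
    have q0 w : (0 <= a j (D ^~ w) `^ (p - 1) * z j.+1 (D ^~ w))%R by rewrite mulr_ge0// powR_ge0.
    rewrite /I -!meanZ// -!meanD//;
      do ?[by move=> w; exact: powR_ge0|exact: measurable_funM|by move=> w; rewrite mulr_ge0].
    apply: mean_le; do ?[by apply: measurable_funD => //; exact: measurable_funM].
      by move=> w; rewrite addr_ge0 ?powR_ge0// mulr_ge0.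
    by move=> w; rewrite aS; exact: powR_max_step.
  move: IH inc step; rewrite uE u'E vE v'E yE -!EFinM -!EFinD !lee_fin; lra.
have [u _ uE] : exists2 c, (0 <= c)%R & I (fun u => a N u `^ p)%R = c%:E.
  by apply: mean_fin; [move=> w; exact: powR_ge0|exact: fina].
have [v _ vE] : exists2 c, (0 <= c)%R & I (fun u => z N u `^ p)%R = c%:E.
  by apply: mean_fin; [move=> w; exact: powR_ge0|exact: finz].
have m1 := meas (leqnn N) (c1 (j := N)); have m2 := meas (leqnn N) (c2 (j := N)).
(* Young's inequality turns the bound into A <= A / 2 + 2 * 4^(p-1) E z_N^p with A finite, whence
   the constant 4 * 4^(p-1). *)
have h2 : 2%:E * I (fun u => a N u `^ (p - 1) * z N u)%R <=
    (2^-1)%:E * I (fun u => a N u `^ p)%R + (2 * 4 `^ (p - 1))%:E * I (fun u => z N u `^ p)%R.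
  have m3 := meas (leqnn N) (c3 (j := N)).
  rewrite /I -!meanZ//; do ?[by move=> w; exact: powR_ge0].
  rewrite -!meanD//;
      do ?[exact: measurable_funM|by move=> w; rewrite mulr_ge0// powR_ge0].
  apply: mean_le.
  - exact: measurable_funM.
  - by apply: measurable_funD; exact: measurable_funM.
  - by move=> w; rewrite mulr_ge0.
  - by move=> w; exact: powR_young.
have := le_trans (main N (leqnn N)) h2.
rewrite uE vE; change (u%:E <= (2^-1)%:E * u%:E + (2 * 4 `^ (p - 1))%:E * v%:E ->
  I (fun u => a N u `^ p)%R <= (4 * 4 `^ (p - 1))%:E * I (fun u => z N u `^ p)%R); rewrite uE vE.
rewrite -!EFinM -!EFinD !lee_fin; lra.
Qed.

End doob_maximal.

End doob.

Section minkowski_means.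
Context (R : realType) d (Om : measurableType d) (P : probability Om R).
Local Open Scope ereal_scope.

Lemma Lnorm_le (q : R) (f : Om -> R) (a : R) : (0 < q)%R -> (forall w, 0 <= f w)%R -> (0 <= a)%R ->
  (Lnorm P q%:E (EFin \o f) <= a%:E) = (\int[P]_w (f w `^ q)%:E <= (a `^ q)%:E).
Proof.
move=> q0 f0 a0; rewrite unlock /Lnorm.
have -> : \int[P]_x (`|(EFin \o f) x| `^ q) = \int[P]_w (f w `^ q)%:E.
  by apply: eq_integral => w _; rewrite /= ger0_norm// poweR_EFin.
have I0 : 0 <= \int[P]_w (f w `^ q)%:E by apply: mean_ge0 => w; exact: powR_ge0.
move: I0; case: (\int[P]_w _) => [x|_|//]; last first.
  by rewrite poweRyr ?leye_eq// gt_eqF// invr_gt0.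
rewrite lee_fin => x0; rewrite poweR_EFin !lee_fin; apply/idP/idP => h.
  rewrite -[leLHS](powRr1 x0) -(mulVf (lt0r_neq0 q0)) powRrM.
  by apply: ge0_ler_powR; rewrite ?nnegrE ?powR_ge0// ltW.
rewrite -[leRHS](powRr1 a0) -(mulfV (lt0r_neq0 q0)) powRrM.
by apply: ge0_ler_powR; rewrite ?nnegrE ?powR_ge0// invr_ge0 ltW.
Qed.

Lemma mean_powRD (q : R) (f g : Om -> R) (a b : R) : (1 <= q)%R ->
  measurable_fun setT f -> measurable_fun setT g ->
  (forall w, 0 <= f w)%R -> (forall w, 0 <= g w)%R -> (0 <= a)%R -> (0 <= b)%R ->
  \int[P]_w (f w `^ q)%:E <= (a `^ q)%:E -> \int[P]_w (g w `^ q)%:E <= (b `^ q)%:E ->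
  \int[P]_w ((f w + g w) `^ q)%:E <= ((a + b) `^ q)%:E.
Proof.
move=> q1 mf mg f0 g0 a0 b0; have q0 : (0 < q)%R by exact: lt_le_trans q1.
rewrite -!Lnorm_le// ?addr_ge0//; last by move=> w; rewrite addr_ge0.
move=> hf hg; rewrite EFinD; apply: le_trans (leeD hf hg).
exact: minkowski_EFin.
Qed.

End minkowski_means.

(** * A real submartingale above the norms of the convolution *)

Section smooth_norm_process.
Context (R : realType) (s : scalar_kind) (X : completeNormedModType (scalars R s)).
Variables (D : R) (A : {additive X -> X}).
Hypothesis D1 : 1 <= D.
Hypothesis hX : smooth2 X D.
Hypothesis hA : forall x, nrm (A x) <= nrm x.

Fixpoint transported (u : nat -> X) j : X :=
  if j is i.+1 then A (transported u i + u i) else 0.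

(* ||M + u|| splits into a part odd in u, kept as it is, and an even part, at
   most (||M||^2 + D^2 ||u||^2)^(1/2) by smoothness. The odd part has mean zero
   when u is symmetric given the past. *)
Fixpoint majorant (u : nat -> X) j : R :=
  if j is i.+1 then
    (nrm (transported u i + u i) - nrm (transported u i - u i)) / 2 +
    Num.sqrt (majorant u i ^+ 2 + D ^+ 2 * nrm (u i) ^+ 2)
  else 0.

Let eta (u : nat -> X) i := (nrm (transported u i + u i) - nrm (transported u i - u i)) / 2.
Let root (u : nat -> X) i := Num.sqrt (majorant u i ^+ 2 + D ^+ 2 * nrm (u i) ^+ 2).

Let root_sqr u i : root u i ^+ 2 = majorant u i ^+ 2 + D ^+ 2 * nrm (u i) ^+ 2.
Proof. by rewrite /root sqr_sqrtr// addr_ge0 ?sqr_ge0// mulr_ge0// sqr_ge0. Qed.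

Let eta_le u i : `|eta u i| <= nrm (u i).
Proof.
rewrite /eta normrM (ger0_norm (_ : 0 <= 2^-1))// ler_pdivrMr//.
apply: (le_trans (ler_nrm_dist _ _)).
rewrite opprB (addrC (u i) (- _)) addrACA subrr add0r; apply: (le_trans (nrmD _ _)).
by rewrite mulr2n mulrDr mulr1.
Qed.

(** D >= 1 enters here, through ||u_i|| <= D ||u_i||; the bound is the condition |eta| <= s under
    which the two-point inequality applies. *)
Let eta_le_root u i : `|eta u i| <= root u i.
Proof.
apply: (le_trans (eta_le u i)); rewrite -(ger0_norm (nrm_ge0 (u i))) -sqrtr_sqr /root ler_wsqrtr//.
apply: (@le_trans _ _ (D ^+ 2 * nrm (u i) ^+ 2)); last by rewrite lerDr sqr_ge0.
by rewrite ler_peMl ?sqr_ge0// exprn_ege1.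
Qed.

(** With a and b the norms of M + u and M - u, a is the sum of (a - b) / 2 and (a + b) / 2, and ((a
    + b) / 2)^2 <= (a^2 + b^2) / 2 <= ||M||^2 + D^2 ||u||^2 by smoothness. The operator only shrinks
    the left-hand side. *)
Lemma nrm_transported_le u j : nrm (transported u j) <= majorant u j.
Proof.
elim: j => [|i IH] /=; first by rewrite nrm0.
apply: (le_trans (hA _)); rewrite -/(eta u i) -/(root u i) /eta.
set a := nrm (_ + _); set b := nrm (transported u i - u i).
have ab : (a + b) / 2 <= root u i.
  rewrite -(ler_pXn2r (_ : (0 < 2)%N)) ?nnegrE ?sqrtr_ge0 ?divr_ge0 ?addr_ge0 ?nrm_ge0//.
  rewrite root_sqr.
  have h1 := hX (transported u i) (u i); rewrite -/a -/b in h1.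
  have h2 : nrm (transported u i) ^+ 2 <= majorant u i ^+ 2.
    by rewrite ler_pXn2r ?nnegrE ?nrm_ge0// (le_trans _ IH)// nrm_ge0.
  have h3 : 0 <= (a - b) ^+ 2 by exact: sqr_ge0.
  move: h1 h2 h3; rewrite sqrrB !exprMn sqrrD exprVn (_ : 2 ^+ 2 = 4 :> R); last by ring.
  move: (nrm _) (nrm _) (majorant _ _) a b => x y m a b; lra.
by move: ab; lra.
Qed.

Lemma majorant_ge0 u j : 0 <= majorant u j.
Proof. by apply: le_trans (nrm_transported_le u j); exact: nrm_ge0. Qed.

Lemma eq_transported u v j : (forall i, (i < j)%N -> u i = v i) -> transported u j = transported v j.
Proof. by elim: j => //= j IH uv; rewrite IH ?uv// => i ij; rewrite uv// ltnW. Qed.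

Lemma eq_majorant u v j : (forall i, (i < j)%N -> u i = v i) -> majorant u j = majorant v j.
Proof.
elim: j => //= j IH uv; rewrite IH ?(@eq_transported u v) ?uv// => i ij; rewrite uv// ltnW//.
Qed.

Let cvgA (v : nat -> X) a : v n @[n --> \oo] --> a -> A (v n) @[n --> \oo] --> A a.
Proof.
move=> /cvg_nrmP h; apply/cvg_nrmP; apply: (@squeeze_cvgr _ _ _ _ (fun=> 0) _ _ _ _ _ h); last exact: cvg_cst.
by apply: nearW => n; rewrite nrm_ge0 -raddfB hA.
Qed.

Lemma transported_continuous j : prefix_continuous j (transported ^~ j).
Proof.
elim: j => [|j IH] u v uv /=; first exact: cvg_cst.
apply: cvgA; apply: cvgD; last exact: uv.
by apply: IH => i ij; apply: uv; exact: ltnW.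
Qed.

Lemma majorant_continuous j : prefix_continuous j (majorant ^~ j).
Proof.
elim: j => [|j IH] u v uv /=; first exact: cvg_cst.
have uvj i : (i < j)%N -> u m i @[m --> \oo] --> v i by move=> ij; apply: uv; exact: ltnW.
have h1 := @transported_continuous j u v uvj; have h2 := IH u v uvj; have h3 := uv j (ltnSn j).
apply: cvgD.
  apply: cvgM; last exact: cvg_cst.
  by apply: cvgB; apply: cvg_nrm; [apply: cvgD|apply: cvgB].
have h4 := cvg_nrm h3.
have h5 : majorant (u m) j ^+ 2 + D ^+ 2 * nrm (u m j) ^+ 2 @[m --> \oo] --> majorant v j ^+ 2 + D ^+ 2 * nrm (v j) ^+ 2.
  rewrite !expr2; under eq_fun do rewrite !expr2.
  by apply: cvgD; [exact: cvgM|apply: cvgM; [exact: cvg_cst|exact: cvgM]].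
exact: (cvg_comp _ _ h5 (@sqrt_continuous R _)).
Qed.

Lemma majorant_flip u j : majorant (flip (@GRing.opp X) j u) j.+1 = root u j - eta u j.
Proof.
rewrite /= /flip eqxx nrmN (@eq_transported _ u j); last by move=> i ij; rewrite ltn_eqF.
rewrite (@eq_majorant _ u j); last by move=> i ij; rewrite ltn_eqF.
rewrite opprK addrC /root /eta; congr (_ + _).
by rewrite -mulNr opprB.
Qed.

Lemma majorant_submartingale u j : 2 * majorant u j <= majorant u j.+1 + majorant (flip (@GRing.opp X) j u) j.+1.
Proof.
rewrite majorant_flip /= -/(eta u j) -/(root u j).
suff : majorant u j <= root u j by lra.
rewrite -[leLHS](ger0_norm (majorant_ge0 u j)) -sqrtr_sqr /root ler_wsqrtr//.
by rewrite lerDl mulr_ge0 ?sqr_ge0.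
Qed.

(** The two-point inequality with s equal to the root; as |eta| <= ||u_j||, its term C eta^2 joins
    D^2 ||u_j||^2. *)
Lemma majorant_step (p C : R) u j : 2 <= p -> 0 <= C ->
  (forall s eta, `|eta| <= s -> (s + eta) `^ p + (s - eta) `^ p <= 2 * (s ^+ 2 + C * eta ^+ 2) `^ (p / 2)) ->
  (majorant u j.+1 `^ p + majorant (flip (@GRing.opp X) j u) j.+1 `^ p) / 2 <=
  (majorant u j ^+ 2 + (D ^+ 2 + C) * nrm (u j) ^+ 2) `^ (p / 2).
Proof.
move=> p2 C0 hC; rewrite majorant_flip /= -/(eta u j) -/(root u j) addrC [eta u j + _]addrC addrC.
rewrite ler_pdivrMr// mulrC; apply: (le_trans (hC _ _ (eta_le_root u j))).
rewrite ler_wpM2l// ge0_ler_powR//.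
- lra.
- by rewrite nnegrE addr_ge0 ?sqr_ge0// mulr_ge0// sqr_ge0.
- by rewrite nnegrE addr_ge0 ?sqr_ge0// mulr_ge0 ?addr_ge0 ?sqr_ge0.
rewrite root_sqr mulrDl addrA lerD2l ler_wpM2l//.
rewrite -(real_normK (num_real (eta u j))).
by rewrite ler_pXn2r ?nnegrE ?nrm_ge0 ?eta_le.
Qed.

End smooth_norm_process.

Section burkholder.
Context (R : realType).
Local Open Scope ereal_scope.

(** The constant precedes the scalar field, the space, the operator and the steps. Real bounds b_j
    stand in for the L^p norms of the steps, so no finiteness has to be discussed. *)
Lemma burkholder (p D : R) : (2 <= p)%R -> (1 <= D)%R -> exists2 C : R, (0 <= C)%R &
  forall (s : scalar_kind) (X : completeNormedModType (scalars R s)) (A : {additive X -> X})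
    d (Om : measurableType d) (P : probability Om R) (S : nat -> Om -> X) (N : nat) (b : nat -> R),
  smooth2 X D -> (forall x, nrm (A x) <= nrm x)%R ->
  symmetric_steps P S (@GRing.opp X) N ->
  (forall j, 0 <= b j)%R ->
  (forall j, (j < N)%N -> \int[P]_w (nrm (S j w) `^ p)%:E <= (b j `^ p)%:E) ->
  \int[P]_w ((\big[Num.max/0%R]_(j < N.+1) nrm (transported A (S ^~ w) j)) `^ p)%:E <=
    (C * (\sum_(j < N) b j ^+ 2) `^ (p / 2))%:E.
Proof.
move=> p2 D1; have [C C0 hC] := two_point_powR p2.
pose C1 : R := (D ^+ 2 + C)%R.
have C10 : (0 <= C1)%R by rewrite addr_ge0 ?sqr_ge0.
exists (4 * 4 `^ (p - 1) * C1 `^ (p / 2))%R; first by rewrite !mulr_ge0 ?powR_ge0.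
move=> s X A d Om P S N b hX hA symS b0 hb.
have p0 : (0 < p)%R by exact: lt_le_trans p2.
have q1 : (1 <= p / 2)%R by rewrite ler_pdivlMr// mul1r.
have copp (u : nat -> X) a : u n @[n --> \oo] --> a -> (- u n)%R @[n --> \oo] --> (- a)%R.
  by move=> h; apply: cvgN.
pose z j (u : nat -> X) := majorant D A u j.
have z0 j u : (0 <= z j u)%R by exact: majorant_ge0.
have cz j : prefix_continuous j (z j) by exact: majorant_continuous.
have mz j : (j <= N)%N -> measurable_fun setT (fun w => z j (S ^~ w)).
  by move=> jN; exact: (measurable_prefix symS jN (cz j)).
have mS j : (j < N)%N -> measurable_fun setT (fun w => nrm (S j w)).
  by move=> jN; apply: smeasurable_nrm; exact: symS.1.
have sqrp (x : R) : (0 <= x)%R -> ((x ^+ 2) `^ (p / 2) = x `^ p)%R.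
  by move=> x0; rewrite -(powR_mulrn 2 x0) -powRrM mulrC divfK.
(* The recursion for Z_j^2 in L^(p/2): averaging over the flip gives the pointwise bound of
   [majorant_step], and Minkowski's inequality with exponent p / 2 >= 1 adds at most C1 b_j^2 per
   step. *)
have bound j : (j <= N)%N ->
    \int[P]_w (z j (S ^~ w) `^ p)%:E <= ((C1 * \sum_(i < j) b i ^+ 2) `^ (p / 2))%:E.
  elim: j => [|j IH] jN.
    rewrite big_ord0 mulr0; under eq_integral do rewrite /z /= powR0 ?gt_eqF//.
    by rewrite integral0 lee_fin powR_ge0.
  have cF : prefix_continuous j.+1 (fun u => z j.+1 u `^ p)%R by exact: prefix_continuous_powR.
  rewrite (symmetric_steps_avg copp symS jN cF) => [|u]; last exact: powR_ge0.
  have q0 : (0 < p / 2)%R by exact: lt_le_trans q1.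
  apply: (@le_trans _ _ (\int[P]_w ((z j (S ^~ w) ^+ 2 + C1 * nrm (S j w) ^+ 2) `^ (p / 2))%:E)).
    have mF := measurable_prefix symS jN cF.
    have mF' := measurable_prefix symS jN (prefix_continuous_flip copp (j := j) cF).
    apply: mean_le.
    - by apply: measurable_funM => //; exact: measurable_funD.
    - apply: (measurableT_comp (measurable_powR _)); apply: measurable_funD.
        by apply: measurable_funX; apply: mz; exact: ltnW.
      by apply: measurable_funM => //; apply: measurable_funX; exact: mS.
    - by move=> w; rewrite divr_ge0// addr_ge0 ?powR_ge0.
    - by move=> w; exact: majorant_step.
  rewrite big_ord_recr/= mulrDr; apply: mean_powRD => //.
  - by apply: measurable_funX; apply: mz; exact: ltnW.
  - by apply: measurable_funM => //; apply: measurable_funX; exact: mS.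
  - by move=> w; exact: sqr_ge0.
  - by move=> w; rewrite mulr_ge0// sqr_ge0.
  - by rewrite mulr_ge0// sumr_ge0// => i _; exact: sqr_ge0.
  - by rewrite mulr_ge0// sqr_ge0.
  - by under eq_integral do rewrite sqrp//; exact: IH (ltnW jN).
  - under eq_integral do rewrite powRM ?sqr_ge0// sqrp ?nrm_ge0//.
    rewrite meanZ ?powR_ge0//; last 2 first.
    + by apply: (measurableT_comp (measurable_powR _)); exact: mS.
    + by move=> w; exact: powR_ge0.
    by rewrite powRM ?sqr_ge0// sqrp// EFinM lee_wpmul2l ?lee_fin ?powR_ge0 ?hb.
apply: (@le_trans _ _ (\int[P]_w ((\big[Num.max/0%R]_(j < N.+1) z j (S ^~ w)) `^ p)%:E)).
  have cmax (F : nat -> (nat -> X) -> R) : (forall j, prefix_continuous j (F j)) ->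
      measurable_fun setT (fun w => (\big[Num.max/0%R]_(j < N.+1) F j (S ^~ w)) `^ p)%R.
    move=> cF; apply: (measurableT_comp (measurable_powR _)).
    apply: (measurable_prefix (F := fun u => \big[Num.max/0%R]_(j < N.+1) F j u) symS (leqnn N)).
    by apply: prefix_continuous_bigmax => j jN; apply: prefix_continuous_le (cF j).
  apply: mean_le.
  - apply: (cmax (fun j u => nrm (transported A u j))) => j u v uv; apply: cvg_nrm.
    exact: transported_continuous.
  - exact: cmax.
  - by move=> w; exact: powR_ge0.
  - move=> w; apply: ge0_ler_powR; rewrite ?nnegrE ?bigmax_ge_id ?(ltW p0)//.
    by apply: le_bigmax2 => j _; exact: nrm_transported_le.
apply: (le_trans (doob_maximal copp p2 symS z0 cz _ _)).
- by move=> j u _; exact: majorant_submartingale.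
- by move=> j jN; apply: (le_lt_trans (bound j jN)); rewrite ltry.
rewrite -!mulrA EFinM.
apply: (le_trans (lee_wpmul2l _ (bound N (leqnn N)))); first by rewrite lee_fin mulr_ge0// powR_ge0.
by rewrite -EFinM lee_fin powRM ?sumr_ge0// ?mulrA// => i _; exact: sqr_ge0.
Qed.

End burkholder.

Lemma mean_cst (R : realType) d (Om : measurableType d) (P : probability Om R) (c : R) :
  (\int[P]_w c%:E = c%:E)%E.
Proof.
transitivity (c%:E * P setT)%E; first exact: integral_cst.
by rewrite probability_setT mule1.
Qed.

Section marginals.
Context (R : realType).
Context d (Om : measurableType d) (P : probability Om R).
Context d' (Om' : measurableType d') (P' : probability Om' R).
Local Open Scope ereal_scope.

Lemma integral_prod_fst (f : Om -> R) : measurable_fun setT f -> (forall w, 0 <= f w)%R ->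
  \int[P \x P']_w (f w.1)%:E = \int[P]_w (f w)%:E.
Proof.
move=> mf f0.
rewrite (@fubini_tonelli1 _ _ _ _ _ P P' (fun w => (f w.1)%:E)); last 2 first.
- by apply/measurable_EFinP; exact: measurableT_comp.
- by move=> w; rewrite lee_fin.
apply: eq_integral => w _; rewrite /fubini_F/=.
transitivity ((f w)%:E * P' setT); first exact: integral_cst.
by rewrite probability_setT mule1.
Qed.

Lemma integral_prod_snd (f : Om' -> R) : measurable_fun setT f -> (forall w, 0 <= f w)%R ->
  \int[P \x P']_w (f w.2)%:E = \int[P']_w (f w)%:E.
Proof.
move=> mf f0.
rewrite (@fubini_tonelli2 _ _ _ _ _ P P' (fun w => (f w.2)%:E)); last 2 first.
- by apply/measurable_EFinP; exact: measurableT_comp.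
- by move=> w; rewrite lee_fin.
apply: eq_integral => w _; rewrite /fubini_G/=.
transitivity ((f w)%:E * P setT); first exact: integral_cst.
by rewrite probability_setT mule1.
Qed.

End marginals.

(** * Gaussian sums in normed spaces *)

Section gaussian_families.
Context (R : realType) (s : scalar_kind).
Local Notation K := (scalars R s).
Local Open Scope ereal_scope.

(* Real and imaginary parts may be correlated with unequal variances; only the
   total variance of each linear combination is prescribed. *)
Definition gaussian_family d (Om : measurableType d) (P : probability Om R)
    (n : nat) (q : nat -> R) (z : nat -> Om -> K) : Prop :=
  (forall i, (i < n)%N -> smeasurable (z i)) /\
  forall a : nat -> K, exists s1 s2 : R,
    [/\ (s1 + s2 = \sum_(i < n) q i * nrm (a i : K) ^+ 2)%R,
        \int[P]_w (cos (sre (\sum_(i < n) a i * z i w)))%:E = (expR (- (s1 / 2)))%:E,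
        \int[P]_w (sin (sre (\sum_(i < n) a i * z i w)))%:E = 0,
        \int[P]_w (cos (sim (\sum_(i < n) a i * z i w)))%:E = (expR (- (s2 / 2)))%:E &
        \int[P]_w (sin (sim (\sum_(i < n) a i * z i w)))%:E = 0].

Context dG (OmG : measurableType dG) (PG : probability OmG R) (g : nat -> {RV PG >-> R}).
Hypothesis hg : iid_std_gaussian g.
Context d (Om : measurableType d) (P : probability Om R).

Lemma smeasurable_of_real dT (T : measurableType dT) (f : T -> R) :
  measurable_fun setT f -> smeasurable (fun w => of_real s (f w)).
Proof.
by move=> /smeasurable_realP; apply: smeasurable_comp => u a; exact: cvg_of_real.
Qed.

Lemma gaussian_family_opp n q (z : nat -> Om -> K) (F : (nat -> K) -> R) :
  gaussian_family P n q z -> prefix_continuous n F -> (forall u, 0 <= F u)%R ->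
  \int[P]_w (F (z ^~ w))%:E = \int[P]_w (F (fun i => - z i w)%R)%:E.
Proof.
move=> [mz hz] cF F0.
have sumN (a : nat -> K) w : sre (\sum_(i < n) a i * (- z i w))%R = (- sre (\sum_(i < n) a i * z i w))%R.
  by rewrite -sreN -sumrN; congr sre; apply: eq_bigr => i _; rewrite mulrN.
have [] // := @cramer_wold_scalar R s _ Om P _ Om P n z (fun i w => - z i w)%R mz _ _ _ F cF F0.
- by move=> i ni; apply: smeasurableN; exact: mz.
- by move=> a; under [RHS]eq_integral do rewrite sumN cosN.
- move=> a; have [s1 [s2 [_ _ h _ _]]] := hz a.
  have [t1 [t2 [_ _ h' _ _]]] := hz (fun i => - a i)%R.
  rewrite h -h'; apply: eq_integral => w _; congr (_%:E); congr (sin (sre _)).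
  by apply: eq_bigr => i _; rewrite mulrN mulNr.
Qed.

(* For an independent copy z' of z, the law of z + i z' is circular, hence that
   of sqrt q (g + i g'), and z is the mean of z + i z' and z - i z'. *)
Section comparison.
Variables (n : nat) (q : nat -> R) (z : nat -> Om -> K).
Hypothesis q0 : forall i, (0 <= q i)%R.
Hypothesis hz : gaussian_family P n q z.
Variable N : (nat -> K) -> R.
Hypothesis cN : prefix_continuous n N.
Hypothesis N0 : forall u, (0 <= N u)%R.
Hypothesis ND : forall u v, (N (fun i => u i + v i) <= N u + N v)%R.
Hypothesis NZ : forall (a : K) u, (N (fun i => a * u i) <= nrm a * N u)%R.

Local Notation J := (imag_unit R s).
Let y (b : bool) (i : nat) (w : Om * Om) : K := (z i w.1 + (-1) ^+ b * (J * z i w.2))%R.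
Let v (i : nat) (w : OmG * OmG) : K :=
  (of_real s (Num.sqrt (q i)) * (of_real s (g i w.1) + J * of_real s (g i w.2)))%R.

Let my b i : (i < n)%N -> smeasurable (y b i).
Proof.
move=> ni; have mzi := hz.1 i ni; apply: (smeasurable_comp2 (phi := fun a b : K => (a + b)%R)).
- by move=> u u' a a' ua ua'; exact: cvgD.
- exact: (smeasurable_preimage measurable_fst mzi).
- apply: (smeasurable_comp (phi := fun a : K => (-1) ^+ b * (J * a))%R).
    by move=> u a ua; apply: cvgM; [exact: cvg_cst|apply: cvgM => //; exact: cvg_cst].
  exact: (smeasurable_preimage measurable_snd mzi).
Qed.

Let mv i : smeasurable (v i).
Proof.
apply: (smeasurable_comp2 (phi := fun a b : R => of_real s (Num.sqrt (q i)) * (of_real s a + J * of_real s b))%R).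
- move=> u u' a a' ua ua'; apply: cvgM; first exact: cvg_cst.
  by apply: cvgD; [exact: cvg_of_real|apply: cvgM; [exact: cvg_cst|exact: cvg_of_real]].
- by apply/smeasurable_realP; exact: measurableT_comp.
- by apply/smeasurable_realP; exact: measurableT_comp.
Qed.

Let E := fun a : nat -> K => (expR (- ((\sum_(i < n) q i * nrm (a i : K) ^+ 2) / 2)))%:E.

(** The real part of the linear form is Re Y(w_1) plus or minus Im Y(w_2). By independence the two
    variances add up to the prescribed total, so the unknown s1 and s2 disappear separately. *)
Let char_y b (a : nat -> K) :
  \int[P \x P]_w (cos (sre (\sum_(i < n) a i * y b i w)))%:E = E a /\
  \int[P \x P]_w (sin (sre (\sum_(i < n) a i * y b i w)))%:E = 0.
Proof.
pose Y (w : Om) := (\sum_(i < n) a i * z i w)%R.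
have mY : smeasurable Y.
  have := @smeasurable_sum _ _ _ _ (K^o : normedModType K) 'I_n (index_enum _) xpredT
    (fun i w => a i * z i w)%R; apply => i _.
  by apply: (@smeasurableZ _ _ _ _ (K^o : normedModType K)); [exact: smeasurable_cst|exact: hz.1].
have /smeasurable_scalarP[m1 m2] := mY.
have [s1 [s2 [e c1 t1 c2 t2]]] := hz.2 a.
pose sg : R := (- (-1) ^+ b)%R.
have mf2 : measurable_fun setT (fun w => sg * sim (Y w))%R by exact: measurable_funM.
have yE w : (sre (\sum_(i < n) a i * y b i w) = sre (Y w.1) + sg * sim (Y w.2))%R.
  rewrite /Y -[X in _ = (_ + X)%R]/(sg * sim _)%R.
  have -> : (\sum_(i < n) a i * y b i w = (\sum_(i < n) a i * z i w.1) +
      (-1) ^+ b * (J * \sum_(i < n) a i * z i w.2))%R.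
    rewrite !mulr_sumr -big_split/=; apply: eq_bigr => i _; rewrite /y mulrDr; congr (_ + _)%R.
    by rewrite mulrCA (mulrCA _ J).
  rewrite sreD; congr (_ + _)%R; rewrite /sg; case: (b).
    by rewrite !expr1 mulN1r sreN sre_imag_unitM !opprK mul1r.
  by rewrite !expr0 mul1r sre_imag_unitM mulN1r.
have c2' : \int[P]_w (cos (sg * sim (Y w)))%:E = (expR (- (s2 / 2)))%:E.
  rewrite -c2 /sg; case: (b) => /=.
    by apply: eq_integral => w _; rewrite expr1 opprK mul1r.
  by apply: eq_integral => w _; rewrite expr0 mulN1r cosN.
have t2' : \int[P]_w (sin (sg * sim (Y w)))%:E = 0.
  rewrite /sg; case: (b) => /=.
    by rewrite -[RHS]t2; apply: eq_integral => w _; rewrite expr1 opprK mul1r.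
  have [r1 [r2 [_ _ _ _ t3]]] := hz.2 (fun i => - a i)%R.
  rewrite -[RHS]t3; apply: eq_integral => w _; rewrite expr0 mulN1r -simN; congr (sin (sim _))%:E.
  by rewrite /Y -sumrN; apply: eq_bigr => i _; rewrite mulNr.
have [h1 h2] := integral_cosD m1 mf2 t1 t2'.
split; last by under eq_integral do rewrite yE.
under eq_integral do rewrite yE.
by rewrite h1 c1 c2' -EFinM -expRD -opprD -mulrDl e.
Qed.

Let char_v (a : nat -> K) :
  \int[PG \x PG]_w (cos (sre (\sum_(i < n) a i * v i w)))%:E = E a /\
  \int[PG \x PG]_w (sin (sre (\sum_(i < n) a i * v i w)))%:E = 0.
Proof.
pose c1 i : R := (sre (a i) * Num.sqrt (q i))%R.
pose c2 i : R := (- (sim (a i) * Num.sqrt (q i)))%R.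
have mlin (c : nat -> R) : measurable_fun setT (fun w => \sum_(i < n) c i * g i w)%R.
  by apply: measurable_sum => i; apply: measurable_funM => //; exact: measurable_funP.
have vE w : (sre (\sum_(i < n) a i * v i w) =
    (\sum_(i < n) c1 i * g i w.1) + (\sum_(i < n) c2 i * g i w.2))%R.
  rewrite sre_sum -big_split/=; apply: eq_bigr => i _; rewrite /v mulrCA sreM sre_of_real sim_of_real mul0r subr0.
  rewrite mulrDr sreD mulrCA sre_imag_unitM sreM simM !sre_of_real !sim_of_real /c1 /c2; ring.
have [h1 h2] := integral_cosD (mlin c1) (mlin c2) (iid_gaussian_sin hg c1 n) (iid_gaussian_sin hg c2 n).
split; last by under eq_integral do rewrite vE.
under eq_integral do rewrite vE.
rewrite h1 !iid_gaussian_cos// -EFinM -expRD -opprD -mulrDl /E -big_split/=.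
congr (expR (- (_ / 2)))%:E; apply: eq_bigr => i _.
by rewrite sqr_nrm_scalar /c1 /c2 sqrrN !exprMn sqr_sqrtr// mulrDr mulrC (mulrC _ (q i)).
Qed.

(** Origin of 4 * 2^p: z is the mean of the two combinations [y false] and [y true], with the same
    mean of N^p as v, which gives a factor 2; v is a sum of two terms whose values of N are bounded
    by those of independent copies of the real Gaussian vector, which gives 2^p * 2. *)
Lemma gaussian_comparison (p : R) : (1 <= p)%R ->
  \int[P]_w (N (z ^~ w) `^ p)%:E <=
  (4 * 2 `^ p)%:E * \int[PG]_w (N (fun i => of_real s (Num.sqrt (q i)) * of_real s (g i w))%R `^ p)%:E.
Proof.
move=> p1; have p0 : (0 < p)%R by exact: lt_le_trans p1.
pose F u := (N u `^ p)%R.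
have cF : prefix_continuous n F by exact: prefix_continuous_powR.
have F0 u : (0 <= F u)%R by exact: powR_ge0.
have cw b : [/\ measurable_fun setT (fun w => F (y b ^~ w)), measurable_fun setT (fun w => F (v ^~ w)) &
    \int[P \x P]_w (F (y b ^~ w))%:E = \int[PG \x PG]_w (F (v ^~ w))%:E].
  apply: (cramer_wold_scalar (my b) (fun i _ => mv i)) => // a.
  - by rewrite (char_y b a).1 (char_v a).1.
  - by rewrite (char_y b a).2 (char_v a).2.
have mz : measurable_fun setT (fun w => F (z ^~ w)).
  by apply/smeasurable_realP; apply: (smeasurable_prefix cF) => i ni; exact: hz.1.
pose G w := F (fun i => of_real s (Num.sqrt (q i)) * of_real s (g i w))%R.
have mG : measurable_fun setT G.
  apply/smeasurable_realP; apply: (smeasurable_prefix (D := fun i w => of_real s (Num.sqrt (q i)) * of_real s (g i w))%R cF) => i ni.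
  apply: (smeasurable_comp (phi := fun a : K => of_real s (Num.sqrt (q i)) * a)%R).
    by move=> u a ua; apply: cvgM => //; exact: cvg_cst.
  by apply: smeasurable_of_real; exact: measurable_funP.
have [my0 mv' e0] := cw false; have [my1 _ e1] := cw true.
rewrite -(@integral_prod_fst _ _ _ P _ _ P (fun w => F (z ^~ w)) mz)//.
apply: (@le_trans _ _ (\int[P \x P]_w (F (y false ^~ w) + F (y true ^~ w))%:E)).
  apply: mean_le => //; [exact: (measurableT_comp mz)|exact: measurable_funD|].
  move=> w; have half : (N (z ^~ w.1) <= Num.max (N (y false ^~ w)) (N (y true ^~ w)))%R.
    have zE : z ^~ w.1 = fun i => (of_real s 2^-1 * (y false i w + y true i w))%R.
      apply/funext => i; rewrite /y expr0 expr1 mul1r mulN1r addrACA subrr addr0 mulrDr -mulrDl -of_realD.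
      by rewrite (_ : 2^-1 + 2^-1 = 1 :> R)%R ?of_real1 ?mul1r//; lra.
    rewrite zE; apply: (le_trans (NZ _ _)); rewrite nrm_of_real ger0_norm//.
    rewrite ler_pdivrMl//; apply: (le_trans (ND _ _)).
    by rewrite mulr_natl mulr2n lerD// le_max lexx ?orbT.
  apply: (@le_trans _ _ (Num.max (N (y false ^~ w)) (N (y true ^~ w)) `^ p)%R).
    by apply: ge0_ler_powR; rewrite ?nnegrE ?(ltW p0)// le_max N0.
  by rewrite /F; case: (leP (N (y false ^~ w))) => _; rewrite ?lerDl ?lerDr powR_ge0.
rewrite meanD// e0 e1.
have hv : \int[PG \x PG]_w (F (v ^~ w))%:E <= (2 `^ p)%:E * (\int[PG]_w (G w)%:E + \int[PG]_w (G w)%:E).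
  have m1 : measurable_fun setT (fun w : OmG * OmG => G w.1) by exact: (measurableT_comp mG).
  have m2 : measurable_fun setT (fun w : OmG * OmG => G w.2) by exact: (measurableT_comp mG).
  have G0 w : (0 <= G w)%R by exact: powR_ge0.
  rewrite -{1}(integral_prod_fst PG PG mG G0) -(integral_prod_snd PG PG mG G0) -meanD// -meanZ ?powR_ge0//; last 2 first.
  - exact: measurable_funD.
  - by move=> w; rewrite addr_ge0.
  apply: mean_le => // [|w]; first by apply: measurable_funM => //; exact: measurable_funD.
  pose u1 := fun i => (of_real s (Num.sqrt (q i)) * of_real s (g i w.1))%R.
  pose u2 := fun i => (of_real s (Num.sqrt (q i)) * of_real s (g i w.2))%R.
  have vle : (N (v ^~ w) <= 2 * Num.max (N u1) (N u2))%R.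
    rewrite (_ : v ^~ w = fun i => (u1 i + J * u2 i)%R); last first.
      by apply/funext => i; rewrite /v /u1 /u2 mulrDr (mulrCA J).
    apply: (le_trans (ND _ _)); rewrite mulr_natl mulr2n lerD ?le_max ?lexx//.
    apply/orP; right; apply: (le_trans (NZ _ _)).
    by rewrite ler_piMl// nrm_imag_unit_le1.
  apply: (@le_trans _ _ ((2 * Num.max (N u1) (N u2)) `^ p)%R).
    by apply: ge0_ler_powR; rewrite ?nnegrE ?(ltW p0)// mulr_ge0// le_max N0.
  rewrite powRM//; last by rewrite le_max N0.
  rewrite ler_wpM2l ?powR_ge0// /G /F -/u1 -/u2.
  by case: (leP (N u1)) => _; rewrite ?lerDl ?lerDr powR_ge0.
apply: (le_trans (leeD hv hv)).
have : 0 <= \int[PG]_w (G w)%:E by apply: mean_ge0 => w; exact: powR_ge0.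
rewrite -/(\int[PG]_w (G w)%:E); case: (\int[PG]_w (G w)%:E) => [x|_|//].
  by rewrite lee_fin => x0; rewrite -!EFinD -!EFinM -?EFinD lee_fin; lra.
by rewrite [leRHS]gt0_muley ?leey// lte_fin mulr_gt0// powR_gt0.
Qed.

End comparison.
End gaussian_families.

Section kahane_pointwise.
Context (R : realType).

(* For independent copies X, Y of a Gaussian sum, take a = ||X||, b = ||Y|| and
   u0, u1 the norms of (X + Y) / sqrt 2 and (X - Y) / sqrt 2, which have the same
   law: the terms with factor 3 / 4 are then absorbed on the left. *)
Lemma kahane_pointwise (r : nat) (u0 u1 a b : R) : (0 < r)%N ->
  0 <= u0 -> 0 <= u1 -> 0 <= a -> 0 <= b ->
  u0 ^+ 2 <= (a + b) ^+ 2 / 2 -> u1 ^+ 2 <= (a + b) ^+ 2 / 2 ->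
  u0 ^+ (2 * r) + u1 ^+ (2 * r) <=
    3 / 4 * (a ^+ (2 * r) + b ^+ (2 * r)) + 10 ^+ r * (a ^+ r * b ^+ r) + u0 ^+ r * u1 ^+ r.
Proof.
move=> r0 u00 u10 a0 b0 h0 h1.
have key (x y : R) : 0 <= x -> 0 <= y -> y <= x ->
    ((x + y) ^+ 2 / 2) ^+ r <= 3 / 4 * (x ^+ (2 * r) + y ^+ (2 * r)) + 10 ^+ r * (x ^+ r * y ^+ r).
  move=> x0 y0 yx.
  have T0 : 0 <= (x + y) ^+ 2 / 2 by rewrite divr_ge0 ?sqr_ge0.
  have P1 : 0 <= y ^+ (2 * r) by rewrite exprn_ge0.
  have P2 : 0 <= x ^+ (2 * r) by rewrite exprn_ge0.
  have P3 : 0 <= 10 ^+ r * (x ^+ r * y ^+ r) by rewrite !mulr_ge0 ?exprn_ge0.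
  (* For y <= x / 5 one has (x + y)^2 / 2 <= (18 / 25) x^2 <= (3 / 4) x^2; otherwise x and y are
     comparable and the mixed term 10 x y suffices. *)
  have [h|h] := leP (5 * y) x.
    have h2 : (x + y) ^+ 2 / 2 <= 3 / 4 * x ^+ 2.
      have : 0 <= (x - 5 * y) * (x + y) by rewrite mulr_ge0 ?subr_ge0// addr_ge0.
      have : 0 <= (x - 5 * y) * x by rewrite mulr_ge0 ?subr_ge0.
      have : 0 <= y * y by rewrite mulr_ge0.
      rewrite sqrrD !expr2 mulr2n; nra.
    apply: (@le_trans _ _ (3 / 4 * x ^+ (2 * r))); last by lra.
    apply: (@le_trans _ _ ((3 / 4 * x ^+ 2) ^+ r)).
      by rewrite lerXn2r ?nnegrE// mulr_ge0 ?sqr_ge0.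
    rewrite exprMn -exprM ler_wpM2r//.
    by rewrite -{2}(expr1 (3 / 4)) ler_wiXn2l//; lra.
  apply: (@le_trans _ _ ((10 * (x * y)) ^+ r)).
    rewrite lerXn2r ?nnegrE// ?mulr_ge0//.
    have : 0 <= (x - y) * x by rewrite mulr_ge0 ?subr_ge0.
    have : 0 <= (x - y) * y by rewrite mulr_ge0 ?subr_ge0.
    have : 0 <= (5 * y - x) * x by rewrite mulr_ge0 ?subr_ge0// ltW.
    rewrite sqrrD !expr2 mulr2n; nra.
  by rewrite !exprMn; lra.
have {}key : ((a + b) ^+ 2 / 2) ^+ r <= 3 / 4 * (a ^+ (2 * r) + b ^+ (2 * r)) + 10 ^+ r * (a ^+ r * b ^+ r).
  have [ab|ab] := leP b a; first exact: key.
  rewrite addrC (addrC (a ^+ _)) (mulrC (a ^+ r)); apply: key => //; exact: ltW.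
set T := (a + b) ^+ 2 / 2 in h0 h1 key.
have T0 : 0 <= T by apply: le_trans h0; exact: sqr_ge0.
have Te u : u ^+ 2 <= T -> u ^+ (2 * r) <= T ^+ r.
  by move=> uT; rewrite exprM lerXn2r ?nnegrE ?sqr_ge0.
(* The power of the smaller of u0 and u1 is bounded by their product, that of the larger by T. *)
have [h|h] := leP u0 u1.
  have : u0 ^+ (2 * r) <= u0 ^+ r * u1 ^+ r.
    by rewrite mul2n -addnn exprD ler_wpM2l ?exprn_ge0// lerXn2r ?nnegrE.
  by have := Te u1 h1; lra.
have : u1 ^+ (2 * r) <= u0 ^+ r * u1 ^+ r.
  by rewrite mul2n -addnn exprD ler_wpM2r ?exprn_ge0// lerXn2r ?nnegrE// ltW.
by have := Te u0 h0; lra.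
Qed.

Lemma exprD_le_max (m : nat) (a b : R) : 0 <= a -> 0 <= b ->
  (a + b) ^+ m <= 2 ^+ m * (a ^+ m + b ^+ m).
Proof.
move=> a0 b0; apply: (@le_trans _ _ ((2 * Num.max a b) ^+ m)).
  rewrite lerXn2r ?nnegrE ?addr_ge0 ?mulr_ge0 ?le_max ?a0//.
  by rewrite mulr_natl mulr2n lerD// le_max lexx ?orbT.
rewrite exprMn ler_wpM2l ?exprn_ge0//.
by case: (leP a b) => _; rewrite ?lerDl ?lerDr exprn_ge0.
Qed.

End kahane_pointwise.

Section gaussian_sums.
Context (R : realType) (s : scalar_kind).
Local Notation K := (scalars R s).
Context (X : completeNormedModType K).
Context d (Om : measurableType d) (P : probability Om R) (g : nat -> {RV P >-> R}).
Hypothesis hg : iid_std_gaussian g.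
Variable x : nat -> X.
Local Open Scope ereal_scope.

Definition gsum n (w : Om) : X := (\sum_(i < n) of_real s (g i w) *: x i)%R.

Let mg i : measurable_fun setT (g i : Om -> R) := measurable_funP (g i).

(** Flipping one step changes the sign of one coefficient, and only the squares of the coefficients
    enter [iid_gaussian_cos]. *)
Lemma iid_symmetric_steps N :
  symmetric_steps P (fun i w => of_real s (g i w) *: x i)%R (@GRing.opp X) N.
Proof.
split=> [i _|j jN F cF F0].
  by apply: smeasurableZ; [exact: smeasurable_of_real|exact: smeasurable_cst].
pose G (u : nat -> K) := F (fun i => u i *: x i)%R.
have cG : prefix_continuous j.+1 G.
  by move=> u v uv; apply: cF => i ij; apply: cvgZ; [exact: uv|exact: cvg_cst].
pose z i w : K := of_real s (g i w).
pose sg i : R := if i == j then (-1)%R else 1%R.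
pose z' i w : K := of_real s (sg i * g i w)%R.
have lin (e a : nat -> R) (b : nat -> K) w : (forall i, a i = sre (b i) * e i)%R ->
   (sre (\sum_(i < j.+1) b i * of_real s (e i * g i w)) = \sum_(i < j.+1) a i * g i w)%R.
  move=> ab; rewrite sre_sum; apply: eq_bigr => i _.
  by rewrite sreM sre_of_real sim_of_real mulr0 subr0 ab mulrA.
have zE (b : nat -> K) w : (sre (\sum_(i < j.+1) b i * z i w) = \sum_(i < j.+1) sre (b i) * g i w)%R.
  rewrite -(lin (fun=> 1%R) (fun i => sre (b i)) b); last by move=> i; rewrite mulr1.
  by congr sre; apply: eq_bigr => i _; rewrite mul1r.
have z'E (b : nat -> K) w : (sre (\sum_(i < j.+1) b i * z' i w) = \sum_(i < j.+1) (sre (b i) * sg i) * g i w)%R.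
  by apply: (lin sg (fun i => sre (b i) * sg i)%R b).
have cosE (a : nat -> K) : \int[P]_w (cos (sre (\sum_(i < j.+1) a i * z i w)))%:E =
    \int[P]_w (cos (sre (\sum_(i < j.+1) a i * z' i w)))%:E.
  under eq_integral do rewrite zE; under [RHS]eq_integral do rewrite z'E.
  rewrite (iid_gaussian_cos hg (fun i => sre (a i))) (iid_gaussian_cos hg (fun i => sre (a i) * sg i)%R).
  congr (expR (- (_ / 2)))%:E; apply: eq_bigr => i _; rewrite exprMn /sg.
  by case: eqP => _; rewrite ?sqrrN expr1n mulr1.
have sinE (a : nat -> K) : \int[P]_w (sin (sre (\sum_(i < j.+1) a i * z i w)))%:E =
    \int[P]_w (sin (sre (\sum_(i < j.+1) a i * z' i w)))%:E.
  under eq_integral do rewrite zE; under [RHS]eq_integral do rewrite z'E.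
  by rewrite (iid_gaussian_sin hg (fun i => sre (a i))) (iid_gaussian_sin hg (fun i => sre (a i) * sg i)%R).
have [_ _ h] := @cramer_wold_scalar R s _ Om P _ Om P j.+1 z z'
  (fun i _ => smeasurable_of_real s (mg i))
  (fun i _ => smeasurable_of_real s (measurable_funM (measurable_cst _) (mg i)))
  cosE sinE G cG (fun u => F0 _).
rewrite [LHS](_ : _ = \int[P]_w (G (z ^~ w))%:E)// h.
apply: eq_integral => w _; congr (F _)%:E; apply/funext => i; rewrite /flip /z' /sg.
by case: eqP => _; rewrite ?mul1r// mulN1r of_realN scaleNr.
Qed.

Lemma measurable_gsum n : measurable_fun setT (fun w => nrm (gsum n w)).
Proof.
apply: smeasurable_nrm; apply: smeasurable_sum => i _.
by apply: smeasurableZ; [exact: smeasurable_of_real|exact: smeasurable_cst].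
Qed.

Lemma gsum_moment n m : \int[P]_w (nrm (gsum n w) ^+ m)%:E < +oo.
Proof.
elim: n => [|n IH].
  under eq_integral do rewrite /gsum big_ord0 nrm0.
  by rewrite mean_cst ltry.
have mS := measurable_gsum n.
have mgn : measurable_fun setT (fun w => `|g n w| ^+ m)%R.
  by apply: measurable_funX; exact: measurableT_comp.
have [v [_ _ _ _ /(_ m) /integrableP[_ gfin]]] := gaussian_char (iid_gaussian_centred hg n).
apply: (@le_lt_trans _ _ ((2 ^+ m)%:E * (\int[P]_w (nrm (gsum n w) ^+ m)%:E +
    (nrm (x n) ^+ m)%:E * \int[P]_w (`|g n w| ^+ m)%:E))).
  rewrite -meanZ//; last by rewrite exprn_ge0// nrm_ge0.
  rewrite -meanD//; last 4 first.
  - exact: measurable_funX.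
  - exact: measurable_funM.
  - by move=> w; rewrite exprn_ge0// nrm_ge0.
  - by move=> w; rewrite mulr_ge0 ?exprn_ge0// nrm_ge0.
  have mm : measurable_fun setT (fun w => nrm (gsum n w) ^+ m + nrm (x n) ^+ m * `|g n w| ^+ m)%R.
    by apply: measurable_funD; [exact: measurable_funX|exact: measurable_funM].
  rewrite -meanZ ?exprn_ge0//; last first.
    by move=> w; rewrite addr_ge0 ?mulr_ge0 ?exprn_ge0// nrm_ge0.
  apply: mean_le.
  - by apply: measurable_funX; exact: measurable_gsum.
  - exact: measurable_funM.
  - by move=> w; rewrite exprn_ge0// nrm_ge0.
  move=> w; rewrite /gsum big_ord_recr/=.
  apply: (@le_trans _ _ ((nrm (gsum n w) + nrm (x n) * `|g n w|) ^+ m)%R).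
    rewrite lerXn2r ?nnegrE ?nrm_ge0 ?addr_ge0 ?mulr_ge0 ?nrm_ge0//.
    by apply: (le_trans (nrmD _ _)); rewrite nrmZ nrm_of_real mulrC.
  by rewrite -exprMn exprD_le_max ?mulr_ge0 ?nrm_ge0.
rewrite lte_mul_pinfty ?lee_fin ?exprn_ge0//; apply: lte_add_pinfty => //.
rewrite lte_mul_pinfty ?lee_fin ?exprn_ge0 ?nrm_ge0//.
by apply: le_lt_trans gfin; under [leRHS]eq_integral do rewrite /= ger0_norm ?exprn_ge0//.
Qed.

(** Twice a partial sum is the sum of the next one and its flip, so the norms form a submartingale
    by the triangle inequality; 16 is the Doob constant 4 * 4^(2-1). *)
Lemma gsum_maximal n :
  \int[P]_w ((\big[Num.max/0%R]_(j < n.+1) nrm (gsum j w)) `^ 2)%:E <=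
  16%:E * \int[P]_w (nrm (gsum n w) ^+ 2)%:E.
Proof.
have copp (u : nat -> X) a : u n @[n --> \oo] --> a -> (- u n)%R @[n --> \oo] --> (- a)%R.
  by move=> h; apply: cvgN.
pose z j (u : nat -> X) := nrm (\sum_(i < j) u i)%R.
have sumcvg j u (v : nat -> X) : (forall i, (i < j)%N -> u m i @[m --> \oo] --> v i) ->
    (\sum_(i < j) u m i)%R @[m --> \oo] --> (\sum_(i < j) v i)%R.
  elim: j => [|j IH] uv.
    by rewrite big_ord0; under eq_fun do rewrite big_ord0; exact: cvg_cst.
  rewrite big_ord_recr; under eq_fun do rewrite big_ord_recr/=.
  by apply: cvgD; [apply: IH => i ij; apply: uv; exact: ltnW|exact: uv].
have sqE (y : R) : (0 <= y)%R -> (y `^ 2 = y ^+ 2)%R by move=> y0; rewrite -powR_mulrn.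
have := @doob_maximal R _ Om P X (fun i w => of_real s (g i w) *: x i)%R (@GRing.opp X) copp z 2 n
  (lexx _) (iid_symmetric_steps n) (fun j u => nrm_ge0 _) (fun j u v uv => cvg_nrm (sumcvg j u v uv)).
rewrite /z => h; apply: (le_trans (h _ _)).
- move=> j u jn; rewrite !big_ord_recr/=.
  have -> : (\sum_(i < j) flip (@GRing.opp X) j u i = \sum_(i < j) u i)%R.
    by apply: eq_bigr => i _; rewrite /flip ltn_eqF.
  rewrite /flip eqxx; set a := (\sum_(i < j) u i)%R.
  apply: le_trans (nrmD _ _); rewrite addrACA subrr addr0 -mulr2n -(scaler_nat 2 a) nrmZ.
  have -> : 2%:R = of_real s 2 :> K by rewrite -[2%R]/(1 + 1)%R of_realD of_real1.
  by rewrite nrm_of_real ger0_norm.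
- move=> j jn; under eq_integral do rewrite sqE ?nrm_ge0//.
  exact: gsum_moment.
- under eq_integral do rewrite sqE ?nrm_ge0//.
  rewrite (_ : 4 * 4 `^ (2 - 1) = 16)%R//.
  by rewrite (_ : 2 - 1 = 1)%R ?powRr1//; lra.
Qed.

End gaussian_sums.

(** * The Kahane-Khintchine inequality for Gaussian sums *)

Section kahane_khintchine.
Context (R : realType) (s : scalar_kind).
Local Notation K := (scalars R s).
Context (X : completeNormedModType K).
Context d (Om : measurableType d) (P : probability Om R) (g : nat -> {RV P >-> R}).
Hypothesis hg : iid_std_gaussian g.
Variables (x : nat -> X) (n : nat).
Local Open Scope ereal_scope.

Let S (w : Om) := nrm (gsum g x n w).
Let mS : measurable_fun setT S := measurable_gsum g x n.
Let S0 w : (0 <= S w)%R. Proof. exact: nrm_ge0. Qed.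

Let sgn (b : bool) : R := if b then (-1)%R else 1%R.
Let h : R := (Num.sqrt 2)^-1%R.
(** Coefficients of (X + Y) / sqrt 2 and (X - Y) / sqrt 2, the boolean selecting the sign; V' lists
    those of X and Y themselves. *)
Let V (i : 'I_n * bool) (w : Om * Om) : R := (h * (g i.1 w.1 + sgn i.2 * g i.1 w.2))%R.
Let V' (i : 'I_n * bool) (w : Om * Om) : R := if i.2 then g i.1 w.2 else g i.1 w.1.

Let h2 : (h ^+ 2 = 2^-1)%R.
Proof. by rewrite /h exprVn sqr_sqrtr. Qed.

Let ext (c : 'I_n -> R) (k : nat) : R := if insub k is Some i then c i else 0%R.
Let extE c (i : 'I_n) : ext c i = c i.
Proof. by rewrite /ext valK. Qed.

Let mlin (c : 'I_n -> R) : measurable_fun setT (fun w => \sum_(i < n) c i * g i w)%R.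
Proof. by apply: measurable_sum => i; apply: measurable_funM => //; exact: measurable_funP. Qed.

Let lin_cos (c : 'I_n -> R) : \int[P]_w (cos (\sum_(i < n) c i * g i w))%:E =
  (expR (- ((\sum_(i < n) c i ^+ 2) / 2)))%:E.
Proof.
have := iid_gaussian_cos hg (ext c) n; under [X in _ = (expR (- (X / 2)))%:E]eq_bigr do rewrite extE.
by move=> <-; apply: eq_integral => w _; congr (cos _)%:E; apply: eq_bigr => i _; rewrite extE.
Qed.

Let lin_sin (c : 'I_n -> R) : \int[P]_w (sin (\sum_(i < n) c i * g i w))%:E = 0.
Proof.
rewrite -[RHS](iid_gaussian_sin hg (ext c) n).
by apply: eq_integral => w _; congr (sin _)%:E; apply: eq_bigr => i _; rewrite extE.
Qed.

Let lin2 (c1 c2 : 'I_n -> R) :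
  \int[P \x P]_w (cos (\sum_(i < n) c1 i * g i w.1 + \sum_(i < n) c2 i * g i w.2))%:E =
    (expR (- ((\sum_(i < n) (c1 i ^+ 2 + c2 i ^+ 2)) / 2)))%:E /\
  \int[P \x P]_w (sin (\sum_(i < n) c1 i * g i w.1 + \sum_(i < n) c2 i * g i w.2))%:E = 0.
Proof.
have [-> ->] := integral_cosD (mlin c1) (mlin c2) (lin_sin c1) (lin_sin c2).
by rewrite !lin_cos -EFinM -expRD -opprD -mulrDl big_split.
Qed.

Let sumE (c : 'I_n * bool -> R) (v : 'I_n * bool -> R) :
  (\sum_i c i * v i = \sum_(i < n) (c (i, false) * v (i, false) + c (i, true) * v (i, true)))%R.
Proof.
transitivity (\sum_(p : 'I_n * bool) (fun (i : 'I_n) (b : bool) => c (i, b) * v (i, b)) p.1 p.2)%R.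
  by apply: eq_bigr => -[].
rewrite -(pair_bigA _ (fun (i : 'I_n) (b : bool) => c (i, b) * v (i, b))%R)/=.
by apply: eq_bigr => i _; rewrite big_bool/= addrC.
Qed.

(** The passage from V' to V is an orthogonal transformation of two independent copies, so the sums
    of squared coefficients, and with them all trigonometric means, are unchanged. *)
Let rotation (F : ('I_n * bool -> R) -> R) : pointwise_continuous F -> (forall v, 0 <= F v)%R ->
  [/\ measurable_fun setT (fun w => F (V ^~ w)), measurable_fun setT (fun w => F (V' ^~ w)) &
      \int[P \x P]_w (F (V ^~ w))%:E = \int[P \x P]_w (F (V' ^~ w))%:E].
Proof.
have mg1 i : measurable_fun setT (fun w : Om * Om => g i w.1).
  by apply: measurableT_comp.
have mg2 i : measurable_fun setT (fun w : Om * Om => g i w.2).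
  by apply: measurableT_comp.
have VE c w : (\sum_i c i * V i w = \sum_(i < n) (h * (c (i, false) + c (i, true))) * g i w.1 +
    \sum_(i < n) (h * (c (i, false) - c (i, true))) * g i w.2)%R.
  by rewrite sumE -big_split/=; apply: eq_bigr => i _; rewrite /V /sgn/=; ring.
have V'E c w : (\sum_i c i * V' i w = \sum_(i < n) c (i, false) * g i w.1 +
    \sum_(i < n) c (i, true) * g i w.2)%R.
  by rewrite sumE -big_split/=.
have same c : (\sum_(i < n) ((h * (c (i, false) + c (i, true))) ^+ 2 + (h * (c (i, false) - c (i, true))) ^+ 2) =
   \sum_(i < n) (c (i, false) ^+ 2 + c (i, true) ^+ 2))%R.
  by apply: eq_bigr => i _; rewrite !exprMn h2; field.
apply: cramer_wold.
- by move=> i; apply: measurable_funM => //; apply: measurable_funD => //; exact: measurable_funM.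
- by case=> i []; [exact: mg2|exact: mg1].
- move=> c; under eq_integral do rewrite VE; under [RHS]eq_integral do rewrite V'E.
  by rewrite (lin2 _ _).1 (lin2 (fun i => c (i, false)) (fun i => c (i, true))).1 same.
- move=> c; under eq_integral do rewrite VE; under [RHS]eq_integral do rewrite V'E.
  by rewrite (lin2 _ _).2 (lin2 (fun i => c (i, false)) (fun i => c (i, true))).2.
Qed.

Let T (b : bool) (v : 'I_n * bool -> R) := nrm (\sum_(i < n) of_real s (v (i, b)) *: x i)%R.
Let T0 b v : (0 <= T b v)%R. Proof. exact: nrm_ge0. Qed.

Let cT b : pointwise_continuous (T b).
Proof.
move=> u v uv; apply: cvg_nrm.
apply: cvg_sumr => i; apply: cvgZ; [apply: cvg_of_real; exact: uv|exact: cvg_cst].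
Qed.

Let cTX b k : pointwise_continuous (fun v => T b v ^+ k)%R.
Proof.
elim: k => [|k IH] u v uv; first by rewrite expr0; exact: cvg_cst.
by rewrite exprS; under eq_fun do rewrite exprS; apply: cvgM; [exact: cT|exact: IH].
Qed.

Let TV' b w : T b (V' ^~ w) = S (if b then w.2 else w.1).
Proof. by rewrite /T /S /gsum /V'; case: b. Qed.

Let TV b w : (T b (V ^~ w) ^+ 2 <= (S w.1 + S w.2) ^+ 2 / 2)%R.
Proof.
have -> : T b (V ^~ w) = (h * nrm (gsum g x n w.1 + of_real s (sgn b) *: gsum g x n w.2))%R.
  rewrite /T /V /gsum scaler_sumr -big_split/= -[in RHS](ger0_norm (_ : 0 <= h)%R); last first.
    by rewrite /h invr_ge0 sqrtr_ge0.
  rewrite -(nrm_of_real s) -nrmZ scaler_sumr; congr nrm; apply: eq_bigr => i _.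
  by rewrite scalerA -scalerDl scalerA -of_realM -of_realD -of_realM.
rewrite exprMn h2 mulrC ler_wpM2r// lerXn2r ?nnegrE ?nrm_ge0 ?addr_ge0//.
apply: (le_trans (nrmD _ _)); rewrite lerD2l nrmZ nrm_of_real /sgn.
by case: b; rewrite ?normrN normr1 mul1r.
Qed.

(** Let A and B be the moments of orders 2r and r. Integrating [kahane_pointwise] gives 2 A <= (3 /
    2) A + (10^r + 1) B^2, since both mixed terms have mean B^2, the second by rotation. A is finite
    by [gsum_moment], so its multiple can be absorbed. *)
Lemma gsum_doubling (r : nat) : (0 < r)%N ->
  \int[P]_w (S w ^+ (2 * r))%:E <= (2 * (1 + 10 ^+ r))%:E * (\int[P]_w (S w ^+ r)%:E) ^+ 2.
Proof.
move=> r0.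
have [A _ AE] := mean_fin (fun w => exprn_ge0 (2 * r) (S0 w)) (gsum_moment hg x n (2 * r)).
have [B B0 BE] := mean_fin (fun w => exprn_ge0 r (S0 w)) (gsum_moment hg x n r).
have mSX k : measurable_fun setT (fun w => S w ^+ k)%R by exact: measurable_funX.
have SX0 k w : (0 <= S w ^+ k)%R by exact: exprn_ge0.
have m1 k : measurable_fun setT (fun w : Om * Om => S w.1 ^+ k)%R by exact: (measurableT_comp (mSX k)).
have m2 k : measurable_fun setT (fun w : Om * Om => S w.2 ^+ k)%R by exact: (measurableT_comp (mSX k)).
have prodB : \int[P \x P]_w (S w.1 ^+ r * S w.2 ^+ r)%:E = (B ^+ 2)%:E.
  rewrite (@fubini_tonelli1 _ _ _ _ _ P P (fun w => (S w.1 ^+ r * S w.2 ^+ r)%:E)); last 2 first.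
  - by apply/measurable_EFinP; exact: measurable_funM.
  - by move=> w; rewrite lee_fin mulr_ge0.
  under eq_integral => w _.
    rewrite (_ : fubini_F _ _ _ = (B * S w ^+ r)%:E); last first.
      by rewrite /fubini_F/= meanZ// BE -EFinM mulrC.
    over.
  by rewrite meanZ// BE -EFinM expr2.
have [mA0 _ eA0] := rotation (@cTX false (2 * r)) (fun v => exprn_ge0 _ (T0 false v)).
have [mA1 _ eA1] := rotation (@cTX true (2 * r)) (fun v => exprn_ge0 _ (T0 true v)).
have cP : pointwise_continuous (fun v => T false v ^+ r * T true v ^+ r)%R.
  by move=> u v uv; apply: cvgM; exact: cTX.
have [mP _ eP] := rotation cP (fun v => mulr_ge0 (exprn_ge0 _ (T0 false v)) (exprn_ge0 _ (T0 true v))).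
have eA0' : \int[P \x P]_w (T false (V ^~ w) ^+ (2 * r))%:E = A%:E.
  rewrite eA0 -AE -(integral_prod_fst P P (mSX (2 * r)%N) (SX0 _)).
  by apply: eq_integral => w _; rewrite TV'.
have eA1' : \int[P \x P]_w (T true (V ^~ w) ^+ (2 * r))%:E = A%:E.
  rewrite eA1 -AE -(integral_prod_snd P P (mSX (2 * r)%N) (SX0 _)).
  by apply: eq_integral => w _; rewrite TV'.
have eP' : \int[P \x P]_w (T false (V ^~ w) ^+ r * T true (V ^~ w) ^+ r)%:E = (B ^+ 2)%:E.
  by rewrite eP -prodB; apply: eq_integral => w _; rewrite !TV'.
have main : \int[P \x P]_w (T false (V ^~ w) ^+ (2 * r) + T true (V ^~ w) ^+ (2 * r))%:E <=
   \int[P \x P]_w (3 / 4 * (S w.1 ^+ (2 * r) + S w.2 ^+ (2 * r)) + 10 ^+ r * (S w.1 ^+ r * S w.2 ^+ r)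
     + T false (V ^~ w) ^+ r * T true (V ^~ w) ^+ r)%:E.
  apply: mean_le.
  - exact: measurable_funD.
  - apply: measurable_funD => //; apply: measurable_funD.
      by apply: measurable_funM => //; exact: measurable_funD.
    by apply: measurable_funM => //; exact: measurable_funM.
  - by move=> w; rewrite addr_ge0 ?exprn_ge0.
  - by move=> w; apply: kahane_pointwise.
move: main.
have t1 : measurable_fun setT (fun w : Om * Om => 3 / 4 * (S w.1 ^+ (2 * r) + S w.2 ^+ (2 * r)))%R.
  by apply: measurable_funM => //; exact: measurable_funD.
have t2 : measurable_fun setT (fun w : Om * Om => 10 ^+ r * (S w.1 ^+ r * S w.2 ^+ r))%R.
  by apply: measurable_funM => //; exact: measurable_funM.
have t3 : measurable_fun setT (fun w : Om * Om => S w.1 ^+ r * S w.2 ^+ r)%R by exact: measurable_funM.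
have q1 (w : Om * Om) : (0 <= 3 / 4 * (S w.1 ^+ (2 * r) + S w.2 ^+ (2 * r)))%R by rewrite mulr_ge0 ?addr_ge0.
have q3 (w : Om * Om) : (0 <= S w.1 ^+ r * S w.2 ^+ r)%R by rewrite mulr_ge0.
have q2 (w : Om * Om) : (0 <= 10 ^+ r * (S w.1 ^+ r * S w.2 ^+ r))%R by rewrite mulr_ge0 ?exprn_ge0.
rewrite (meanD _ (measurable_funD t1 t2) mP); last 2 first.
- by move=> w; rewrite addr_ge0.
- by move=> w; rewrite mulr_ge0 ?exprn_ge0.
rewrite (meanD _ t1 t2 q1 q2) (meanZ _ t3 q3 (exprn_ge0 r (ler0n R 10))).
rewrite (meanZ _ (measurable_funD (m1 (2 * r)%N) (m2 (2 * r)%N)) (fun w => addr_ge0 (SX0 _ _) (SX0 _ _)) (_ : 0 <= 3 / 4)%R)//.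
rewrite (meanD _ (m1 (2 * r)%N) (m2 (2 * r)%N) (fun w => SX0 _ _) (fun w => SX0 _ _)).
rewrite (integral_prod_fst P P (mSX (2 * r)%N) (SX0 _)) (integral_prod_snd P P (mSX (2 * r)%N) (SX0 _)).
rewrite (meanD _ mA0 mA1 (fun v => exprn_ge0 _ (T0 false _)) (fun v => exprn_ge0 _ (T0 true _))).
rewrite eA0' eA1' eP' prodB AE BE -!EFinM -!EFinD -?EFin_expe -?EFinM -?EFinD lee_fin => main.
by rewrite -?EFin_expe -?EFinM lee_fin; move: main; rewrite !expr2; lra.
Qed.

(** The constant obtained by iterating [gsum_doubling] with r = 2, 4, ..., 2^k from the second
    moment; it involves neither the space nor the number of terms. *)
Fixpoint kahane_cst (k : nat) : R :=
  if k is i.+1 then (2 * (1 + 10 ^+ (2 ^ k)) * kahane_cst i ^+ 2)%R else 1%R.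

Lemma kahane_cst_ge0 k : (0 <= kahane_cst k)%R.
Proof.
elim: k => //= k IH; rewrite mulr_ge0 ?sqr_ge0// mulr_ge0// addr_ge0// exprn_ge0//.
Qed.

Lemma gsum_kahane (k : nat) (tau : R) : (0 <= tau)%R -> \int[P]_w (S w ^+ 2)%:E <= (tau ^+ 2)%:E ->
  \int[P]_w (S w ^+ (2 ^ k.+1))%:E <= (kahane_cst k * tau ^+ (2 ^ k.+1))%:E.
Proof.
move=> t0 h1; elim: k => [|k IH]; first by rewrite mul1r.
rewrite (expnS 2 k.+1) [kahane_cst _]/=.
apply: (le_trans (gsum_doubling _)); first by rewrite expn_gt0.
have [B B0 BE] := mean_fin (fun w => exprn_ge0 (2 ^ k.+1) (S0 w)) (gsum_moment hg x n (2 ^ k.+1)).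
move: IH; rewrite BE lee_fin => IH; rewrite -EFin_expe -EFinM lee_fin.
rewrite -(mulrA _ (kahane_cst k ^+ 2)%R) ler_wpM2l ?mulr_ge0 ?addr_ge0 ?exprn_ge0//.
rewrite (mulnC 2%N) exprM -exprMn lerXn2r// nnegrE//.
by apply: le_trans IH.
Qed.

(** A real exponent p is reached from the dyadic one q >= p by the pointwise bound S^p <= tau^p (1 +
    (S / tau)^q), which needs tau > 0. *)
Let powR_moment_gt0 (k : nat) (p tau : R) : (0 < p)%R -> (p <= (2 ^ k.+1)%:R)%R -> (0 < tau)%R ->
  \int[P]_w (S w ^+ 2)%:E <= (tau ^+ 2)%:E ->
  \int[P]_w (S w `^ p)%:E <= ((1 + kahane_cst k) * tau `^ p)%:E.
Proof.
move=> p0 pk t0 h1.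
have mSp : measurable_fun setT (fun w => S w `^ p)%R by exact: (measurableT_comp (measurable_powR _)).
set q := (2 ^ k.+1)%N in pk *.
have tq : (0 < tau ^+ q)%R by rewrite exprn_gt0.
have c0 : (0 <= tau `^ p / tau ^+ q)%R by rewrite divr_ge0 ?powR_ge0// ltW.
apply: (@le_trans _ _ (\int[P]_w (tau `^ p + tau `^ p / tau ^+ q * S w ^+ q)%:E)).
  apply: mean_le => //.
  - by apply: measurable_funD => //; apply: measurable_funM => //; exact: measurable_funX.
  - by move=> w; exact: powR_ge0.
  move=> w; have [st|ts] := leP (S w) tau.
    apply: (@le_trans _ _ (tau `^ p)%R); last by rewrite lerDl mulr_ge0// exprn_ge0.
    by apply: ge0_ler_powR; rewrite ?nnegrE ?(ltW p0) ?(ltW t0).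
  apply: (@le_trans _ _ (tau `^ p / tau ^+ q * S w ^+ q)%R); last by rewrite lerDr powR_ge0.
  have sp : (0 < S w)%R by exact: lt_trans ts.
  have -> : (S w `^ p = tau `^ p * (S w / tau) `^ p)%R.
    by rewrite -powRM ?divr_ge0 ?(ltW t0)// mulrC divfK// gt_eqF.
  rewrite -mulrA ler_wpM2l ?powR_ge0//.
  have -> : ((tau ^+ q)^-1 * S w ^+ q = (S w / tau) `^ q%:R)%R.
    by rewrite powR_mulrn ?divr_ge0 ?(ltW t0)// expr_div_n mulrC.
  by apply: ler_powR => //; rewrite ler_pdivlMr// mul1r ltW.
rewrite meanD ?powR_ge0//; last 2 first.
- by apply: measurable_funM => //; exact: measurable_funX.
- by move=> w; rewrite mulr_ge0 ?exprn_ge0.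
rewrite mean_cst meanZ//; last 2 first.
- exact: measurable_funX.
- by move=> w; rewrite exprn_ge0.
rewrite mulrDl mul1r EFinD leeD2l//.
apply: (le_trans (lee_wpmul2l _ (gsum_kahane k (ltW t0) h1))); first by rewrite lee_fin.
by rewrite -EFinM lee_fin mulrCA divfK ?gt_eqF.
Qed.

Lemma gsum_powR_moment (k : nat) (p tau : R) : (0 < p)%R -> (p <= (2 ^ k.+1)%:R)%R -> (0 <= tau)%R ->
  \int[P]_w (S w ^+ 2)%:E <= (tau ^+ 2)%:E ->
  \int[P]_w (S w `^ p)%:E <= ((1 + kahane_cst k) * tau `^ p)%:E.
Proof.
move=> p0 pk; rewrite le_eqVlt => /predU1P[<- h1|t0]; last exact: powR_moment_gt0.
have c1 : (0 < 1 + kahane_cst k)%R by rewrite ltr_pwDl// kahane_cst_ge0.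
rewrite powR0 ?gt_eqF// mulr0; apply/lee_addgt0Pr => e e0; rewrite add0e.
(* For tau = 0 the positive case is applied with t such that (1 + [kahane_cst k]) t^p = e, for
   arbitrary e > 0. *)
pose t : R := ((e / (1 + kahane_cst k)) `^ p^-1)%R.
have ec : (0 < e / (1 + kahane_cst k))%R by rewrite divr_gt0.
have t0 : (0 < t)%R by exact: powR_gt0.
apply: (le_trans (powR_moment_gt0 p0 pk t0 _)).
  by apply: (le_trans h1); rewrite lee_fin expr0n sqr_ge0.
by rewrite lee_fin /t -powRrM mulVf ?gt_eqF// powRr1 ?(ltW ec)// mulrC divfK ?gt_eqF.
Qed.

End kahane_khintchine.

Section gaussian_family_sums.
Context (R : realType) (s : scalar_kind).
Local Notation K := (scalars R s).
Context (X : completeNormedModType K).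
Context dG (OmG : measurableType dG) (PG : probability OmG R) (g : nat -> {RV PG >-> R}).
Hypothesis hg : iid_std_gaussian g.
Context d (Om : measurableType d) (P : probability Om R).
Local Open Scope ereal_scope.

(** Smooth spaces have type 2: Burkholder at p = 2 for the identity operator, with b_j = ||x_j||
    because the Gaussian coefficients have variance 1. It turns square summability into small
    Gaussian tails. *)
Lemma gsum_type2 (D : R) : (1 <= D)%R -> smooth2 X D -> exists2 C : R, (0 <= C)%R &
  forall (x : nat -> X) n, \int[PG]_w (nrm (gsum g x n w) ^+ 2)%:E <= (C * \sum_(i < n) nrm (x i) ^+ 2)%:E.
Proof.
move=> D1 hX; have [C C0 hC] := burkholder (lexx 2 : (2 <= 2 :> R)%R) D1.
exists C => // x n.
have sqE (y : R) : (0 <= y)%R -> (y `^ 2 = y ^+ 2)%R by move=> y0; rewrite -powR_mulrn.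
have hb j : (j < n)%N -> \int[PG]_w (nrm (of_real s (g j w) *: x j) `^ 2)%:E <= (nrm (x j) `^ 2)%:E.
  move=> _; under eq_integral do rewrite sqE ?nrm_ge0// nrmZ nrm_of_real exprMn (real_normK (num_real _)) mulrC.
  have mgj : measurable_fun setT (fun w => g j w ^+ 2)%R by apply: measurable_funX; exact: measurable_funP.
  rewrite meanZ//; last 2 first.
  - by move=> w; exact: sqr_ge0.
  - by rewrite sqr_ge0.
  have hm (B : set R) : measurable B -> PG (g j @^-1` B) = normal_prob 0 1 B by exact: hg.1.
  rewrite (@integral_law _ _ _ PG (g j) (normal_prob 0%R 1%R) (fun y => y ^+ 2)%R)//; last first.
    by move=> y; exact: sqr_ge0.
  by rewrite integral_normal_sqr ?oner_eq0// expr1n mule1 sqE// nrm_ge0.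
have := hC s X (idfun : {additive X -> X}) _ OmG PG (fun i w => of_real s (g i w) *: x i)%R n
  (fun j => nrm (x j)) hX (fun y => lexx _) (iid_symmetric_steps hg x n) (fun j => nrm_ge0 _) hb.
have trE u j : transported (idfun : {additive X -> X}) u j = (\sum_(i < j) u i)%R.
  by elim: j => [|j IH]; rewrite ?big_ord0// big_ord_recr/= IH.
rewrite divff// powRr1 ?sumr_ge0//; last by move=> i _; exact: sqr_ge0.
apply: le_trans; apply: mean_le.
- by apply: measurable_funX; exact: measurable_gsum.
- apply: (measurableT_comp (measurable_powR _)).
  apply: (measurable_prefix (F := fun u => \big[Num.max/0%R]_(j < n.+1) nrm (transported (idfun : {additive X -> X}) u j)) (iid_symmetric_steps hg x n) (leqnn n)).
  apply: (prefix_continuous_bigmax (F := fun j u => nrm (transported (idfun : {additive X -> X}) u j))) => j jn.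
  apply: prefix_continuous_le (_ : prefix_continuous j _) => //.
  by move=> u v uv; apply: cvg_nrm; exact: transported_continuous.
- by move=> w; exact: sqr_ge0.
- move=> w; rewrite -sqE ?nrm_ge0//; apply: ge0_ler_powR; rewrite ?nnegrE ?nrm_ge0 ?bigmax_ge_id//.
  have -> : gsum g x n w = transported (idfun : {additive X -> X}) (fun i => of_real s (g i w) *: x i)%R n.
    by rewrite trE.
  by rewrite (le_bigmax _ (fun j : 'I_n.+1 => nrm (transported (idfun : {additive X -> X}) _ j)) ord_max).
Qed.

(** Dropping zero terms relabels the remaining Gaussians without changing the joint law. This
    reconciles a basis indexed by a subset of nat with the finite systems in the definition of the
    gamma-norm. *)
Lemma gsum_enum (m : pred nat) (x : nat -> X) n : (forall i, ~~ m i -> x i = 0%R) ->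
  let r := seq.filter m (iota 0 n) in
  \int[PG]_w (nrm (gsum g x n w) ^+ 2)%:E =
  \int[PG]_w (nrm (gsum g (fun k => x (nth 0%N r k)) (size r) w) ^+ 2)%:E.
Proof.
move=> mx r; have ur : uniq r by rewrite filter_uniq ?iota_uniq.
have sumr (V : nmodType) (F : nat -> V) : (\sum_(i < n | m i) F i = \sum_(k < size r) F (nth 0%N r k))%R.
  by rewrite -(big_mkord m F) /index_iota subn0 -big_filter -/r (big_nth 0%N) big_mkord.
pose N (u : nat -> K) := (nrm (\sum_(k < size r) u k *: x (nth 0%N r k))%R ^+ 2)%R.
have cN : prefix_continuous (size r) N.
  move=> u v uv; rewrite /N; under eq_fun do rewrite expr2; rewrite expr2.
  have h : nrm (\sum_(k < size r) u m k *: x (nth 0%N r k))%R @[m --> \oo] --> nrm (\sum_(k < size r) v k *: x (nth 0%N r k))%R.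
    by apply: cvg_nrm; apply: cvg_sumr => i; apply: cvgZ; [exact: uv|exact: cvg_cst].
  exact: cvgM.
pose c (a : nat -> K) i : R := if m i then sre (a (index i r)) else 0%R.
have zE (a : nat -> K) w : (sre (\sum_(k < size r) a k * of_real s (g (nth 0%N r k) w)) = \sum_(i < n) c a i * g i w)%R.
  transitivity (\sum_(i < n | m i) c a i * g i w)%R; last first.
    by rewrite big_mkcond/=; apply: eq_bigr => i _; rewrite /c; case: (m i); rewrite ?mul0r.
  rewrite (sumr _ (fun i => c a i * g i w)%R) sre_sum; apply: eq_bigr => k _.
  rewrite sreM sre_of_real sim_of_real mulr0 subr0 /c index_uniq//.
  by have := mem_nth 0%N (ltn_ord k); rewrite mem_filter => /andP[->].
have gE (a : nat -> K) w : (sre (\sum_(k < size r) a k * of_real s (g k w)) = \sum_(k < size r) sre (a k) * g k w)%R.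
  by rewrite sre_sum; apply: eq_bigr => k _; rewrite sreM sre_of_real sim_of_real mulr0 subr0.
have sqE (a : nat -> K) : (\sum_(i < n) c a i ^+ 2 = \sum_(k < size r) sre (a k) ^+ 2)%R.
  transitivity (\sum_(i < n | m i) c a i ^+ 2)%R.
    by rewrite [RHS]big_mkcond/=; apply: eq_bigr => i _; rewrite /c; case: (m i); rewrite ?expr0n.
  rewrite (sumr _ (fun i => c a i ^+ 2)%R); apply: eq_bigr => k _; rewrite /c index_uniq//.
  by have := mem_nth 0%N (ltn_ord k); rewrite mem_filter => /andP[->].
have mg i : smeasurable (fun w => of_real s (g i w)) by apply: smeasurable_of_real; exact: measurable_funP.
have cosE (a : nat -> K) :
    \int[PG]_w (cos (sre (\sum_(k < size r) a k * of_real s (g (nth 0%N r k) w))))%:E =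
    \int[PG]_w (cos (sre (\sum_(k < size r) a k * of_real s (g k w))))%:E.
  under eq_integral do rewrite zE; under [RHS]eq_integral do rewrite gE.
  by rewrite !(iid_gaussian_cos hg) (iid_gaussian_cos hg (fun k => sre (a k))) sqE.
have sinE (a : nat -> K) :
    \int[PG]_w (sin (sre (\sum_(k < size r) a k * of_real s (g (nth 0%N r k) w))))%:E =
    \int[PG]_w (sin (sre (\sum_(k < size r) a k * of_real s (g k w))))%:E.
  under eq_integral do rewrite zE; under [RHS]eq_integral do rewrite gE.
  by rewrite !(iid_gaussian_sin hg) (iid_gaussian_sin hg (fun k => sre (a k))).
have [_ _ e] := cramer_wold_scalar (z := fun k w => of_real s (g (nth 0%N r k) w)) (z' := fun k w => of_real s (g k w))
  (fun k _ => mg _) (fun k _ => mg _) cosE sinE cN (fun u => sqr_ge0 _).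
rewrite -[RHS]e; apply: eq_integral => w _; rewrite /N /gsum.
rewrite -(sumr _ (fun i => of_real s (g i w) *: x i)%R) [in RHS]big_mkcond/=.
congr (nrm _ ^+ 2)%:E; apply: eq_bigr => i _; case: ifPn => // /mx ->.
by rewrite scaler0.
Qed.

Lemma gsum_gamma (H : completeNormedModType K) (ip : {dot H for @sconj R s}) (J : set nat)
    (h : nat -> H) (f : H -> X) (c : R) (m n : nat) :
  orthonormal_on ip J h -> (0 <= c)%R -> gamma_norm ip g f <= c%:E ->
  \int[PG]_w (nrm (gsum g (fun i => if (m + i)%N \in J then f (h (m + i)%N) else 0%R) n w) ^+ 2)%:E <= (c ^+ 2)%:E.
Proof.
move=> oh c0 hf.
rewrite (@gsum_enum (fun i => (m + i)%N \in J)); last by move=> i /negbTE ->.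
set r := seq.filter _ _.
have mem k : (k < size r)%N -> (m + nth 0%N r k)%N \in J.
  by move=> /(mem_nth 0%N); rewrite mem_filter => /andP[].
have ur : uniq r by rewrite filter_uniq ?iota_uniq.
pose h' (k : 'I_(size r)) := h (m + nth 0%N r k)%N.
have oh' : orthonormal_on ip setT h'.
  move=> i j _ _; rewrite oh; [|exact/set_mem/mem|exact/set_mem/mem].
  by rewrite eqn_add2l nth_uniq.
have : poweR (expectation PG (fun w => nrm (\sum_(i < size r) of_real s (g i w) *: f (h' i))%R ^+ 2)%R) 2^-1 <= c%:E.
  by apply: le_trans hf; apply: ereal_sup_ubound; exists (size r), h'.
rewrite unlock.
have -> : \int[PG]_w (nrm (\sum_(i < size r) of_real s (g i w) *: f (h' i))%R ^+ 2)%:E =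
  \int[PG]_w (nrm (gsum g (fun k => if (m + nth 0%N r k)%N \in J then f (h (m + nth 0%N r k)%N) else 0%R) (size r) w) ^+ 2)%:E.
  apply: eq_integral => w _; rewrite /gsum; congr (nrm _ ^+ 2)%:E; apply: eq_bigr => k _.
  by rewrite mem.
set I := \int[PG]_w _.
have I0 : 0 <= I by apply: mean_ge0 => w; exact: sqr_ge0.
move: I0; case: I => [y| |]//.
  rewrite poweR_EFin !lee_fin => y0 hy; rewrite -[leLHS](powRr1 y0) -(mulVf (_ : 2 != 0 :> R)%R)// powRrM.
  rewrite -[leRHS]powR_mulrn//; apply: ge0_ler_powR; rewrite ?nnegrE ?powR_ge0//.
by rewrite poweRyr// leye_eq.
Qed.

Section family.
Variables (n : nat) (q : nat -> R) (z : nat -> Om -> K) (x : nat -> X) (kappa tau : R).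
Hypothesis q0 : forall i, (0 <= q i)%R.
Hypothesis kappa0 : (0 <= kappa)%R.
Hypothesis hz : gaussian_family P n q z.
Hypothesis qx : forall i, (i < n)%N -> q i = kappa \/ x i = 0%R.
Hypothesis tau0 : (0 <= tau)%R.
Hypothesis htau : \int[PG]_w (nrm (gsum g x n w) ^+ 2)%:E <= (tau ^+ 2)%:E.

Let partial (u : nat -> K) j : X := (\sum_(i < j) u i *: x i)%R.

Let partial_cvg j : (j <= n)%N -> prefix_continuous n (fun u => nrm (partial u j)).
Proof.
move=> jn u v uv; apply: cvg_nrm; apply: cvg_sumr => i; apply: cvgZ; last exact: cvg_cst.
by apply: uv; exact: leq_trans jn.
Qed.

Let partialD u v j : (nrm (partial (fun i => u i + v i) j) <= nrm (partial u j) + nrm (partial v j))%R.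
Proof.
apply: le_trans (nrmD _ _); rewrite /partial -big_split/=.
by under eq_bigr do rewrite scalerDl.
Qed.

Let partialZ (a : K) u j : (nrm (partial (fun i => a * u i) j) = nrm a * nrm (partial u j))%R.
Proof.
by rewrite -nrmZ /partial scaler_sumr; congr nrm; apply: eq_bigr => i _; rewrite scalerA.
Qed.

Let partialZ_le j (a : K) u : (nrm (partial (fun i => a * u i) j) <= nrm a * nrm (partial u j))%R.
Proof. by rewrite partialZ. Qed.

Let partialG w j : (j <= n)%N -> (nrm (partial (fun i => of_real s (Num.sqrt (q i)) * of_real s (g i w)) j) =
  Num.sqrt kappa * nrm (gsum g x j w))%R.
Proof.
move=> jn; rewrite -[X in (X * _)%R](ger0_norm (sqrtr_ge0 _)) -(nrm_of_real s) -nrmZ scaler_sumr.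
congr nrm; apply: eq_bigr => i _; rewrite scalerA.
by have [->//|->] := qx (leq_trans (ltn_ord i) jn); rewrite !scaler0.
Qed.

(** Where the variance q_i differs from kappa the vector x_i is 0, so sqrt kappa factors out of the
    comparison sum; the moment of the latter is bounded by Kahane-Khintchine. *)
Lemma family_moment (k : nat) (p : R) : (1 <= p)%R -> (p <= (2 ^ k.+1)%:R)%R ->
  \int[P]_w (nrm (\sum_(i < n) z i w *: x i)%R `^ p)%:E <=
  ((4 * 2 `^ p * (1 + kahane_cst R k)) * (Num.sqrt kappa * tau) `^ p)%:E.
Proof.
move=> p1 pk; have p0 : (0 < p)%R by exact: lt_le_trans p1.
apply: (le_trans (gaussian_comparison hg q0 hz (partial_cvg (leqnn n)) (fun u => nrm_ge0 _)
  (fun u v => partialD u v n) (partialZ_le n) p1)).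
under eq_integral do rewrite partialG// powRM ?sqrtr_ge0 ?nrm_ge0//.
rewrite meanZ ?powR_ge0//; last 2 first.
- by apply: (measurableT_comp (measurable_powR _)); exact: measurable_gsum.
- by move=> w; exact: powR_ge0.
have h := gsum_powR_moment hg p0 pk tau0 htau.
rewrite -mulrA [leRHS]EFinM; apply: lee_wpmul2l; first by rewrite lee_fin mulr_ge0 ?powR_ge0.
apply: (le_trans (lee_wpmul2l _ h)); first by rewrite lee_fin powR_ge0.
by rewrite -EFinM lee_fin powRM ?sqrtr_ge0// mulrCA.
Qed.

(** The maximum over partial sums is itself a seminorm of the coefficients, so the Gaussian
    comparison applies to it. One factor 16 is its constant 4 * 2^2, the other comes from
    [gsum_maximal]. *)
Lemma family_maximal :
  \int[P]_w ((\big[Num.max/0%R]_(j < n.+1) nrm (\sum_(i < j) z i w *: x i)%R) `^ 2)%:E <=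
  (16 * 16 * (kappa * tau ^+ 2))%:E.
Proof.
pose N (u : nat -> K) : R := \big[Num.max/0%R]_(j < n.+1) nrm (partial u j).
have cN : prefix_continuous n N.
  by apply: (prefix_continuous_bigmax (F := fun j u => nrm (partial u j))) => j jn; exact: partial_cvg.
have N0 u : (0 <= N u)%R by exact: bigmax_ge_id.
have ND u v : (N (fun i => u i + v i) <= N u + N v)%R.
  apply: bigmax_le => [|j _]; first by rewrite addr_ge0.
  apply: (le_trans (partialD _ _ _)); apply: lerD.
    by rewrite /N (le_bigmax _ (fun j : 'I_n.+1 => nrm (partial u j)) j).
  by rewrite /N (le_bigmax _ (fun j : 'I_n.+1 => nrm (partial v j)) j).
have NZ (a : K) u : (N (fun i => a * u i) <= nrm a * N u)%R.
  apply: bigmax_le => [|j _]; first by rewrite mulr_ge0// nrm_ge0.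
  rewrite partialZ ler_wpM2l ?nrm_ge0//.
  by rewrite /N (le_bigmax _ (fun j : 'I_n.+1 => nrm (partial u j)) j).
have p1 : (1 <= 2 :> R)%R by rewrite ler1n.
apply: (le_trans (gaussian_comparison hg q0 hz cN N0 ND NZ p1)).
have -> : (4 * 2 `^ 2 = 16 :> R)%R.
  by rewrite (powR_mulrn 2 (ler0n R 2)); ring.
have NG w : N (fun i => of_real s (Num.sqrt (q i)) * of_real s (g i w))%R =
    (Num.sqrt kappa * \big[Num.max/0%R]_(j < n.+1) nrm (gsum g x j w))%R.
  have sk : (0 <= Num.sqrt kappa)%R by exact: sqrtr_ge0.
  rewrite -[RHS]/(Num.sqrt kappa * (fun y : R => y) (\big[Num.max/0%R]_(j < n.+1) nrm (gsum g x j w)))%R.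
  rewrite (big_morph (fun y => Num.sqrt kappa * y)%R (id1 := 0%R) (op1 := Num.max)); last 2 first.
  - by move=> a b; rewrite maxr_pMr.
  - by rewrite mulr0.
  by rewrite /N; apply: eq_bigr => j _; rewrite partialG// -ltnS.
have mm : measurable_fun setT (fun w => \big[Num.max/0%R]_(j < n.+1) nrm (gsum g x j w)).
  apply: (measurable_prefix (F := fun u => \big[Num.max/0%R]_(j < n.+1) nrm (\sum_(i < j) u i)%R) (iid_symmetric_steps hg x n) (leqnn n)).
  apply: (prefix_continuous_bigmax (F := fun j u => nrm (\sum_(i < j) u i)%R)) => j jn u v uv.
  by apply: cvg_nrm; apply: cvg_sumr => i; apply: uv; exact: leq_trans (ltn_ord i) jn.
under eq_integral do rewrite NG powRM ?sqrtr_ge0 ?bigmax_ge_id//.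
rewrite meanZ ?powR_ge0//; last 2 first.
- exact: (measurableT_comp (measurable_powR _)).
- by move=> w; exact: powR_ge0.
rewrite -mulrA [leRHS]EFinM lee_wpmul2l ?lee_fin//.
rewrite powR_mulrn ?sqrtr_ge0// sqr_sqrtr//.
apply: (le_trans (lee_wpmul2l _ (gsum_maximal hg x n))); first by rewrite lee_fin.
apply: (le_trans (lee_wpmul2l _ (lee_wpmul2l _ htau))); rewrite ?lee_fin//.
by rewrite mulrCA.
Qed.

End family.
End gaussian_family_sums.

(** * Finite rank operators *)

Section real_span.
Context (R : realType) (s : scalar_kind) (X : normedModType (scalars R s)).
Variable y : nat -> X.

(** Real coefficients are used for both fields, so that limits of coordinates can be found from the
    order completeness of R; a complex span is later treated as a real one with twice as many
    generators. *)
Definition rspan N (c : nat -> R) : X := \sum_(i < N) of_real s (c i) *: y i.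

Lemma rspanS N c : rspan N.+1 c = rspan N c + of_real s (c N) *: y N.
Proof. by rewrite /rspan big_ord_recr. Qed.

Lemma eq_rspan N c c' : (forall i, (i < N)%N -> c i = c' i) -> rspan N c = rspan N c'.
Proof. by move=> cc'; apply: eq_bigr => i _; rewrite cc'. Qed.

Lemma rspan_lin N (a b : R) c c' :
  rspan N (fun i => a * c i + b * c' i) = of_real s a *: rspan N c + of_real s b *: rspan N c'.
Proof.
rewrite /rspan !scaler_sumr -big_split/=; apply: eq_bigr => i _.
by rewrite of_realD !of_realM scalerDl !scalerA.
Qed.

Lemma rspan_cut N (c : nat -> R) (t : R) :
  rspan N.+1 (fun i => if i == N then t else c i) = rspan N c + of_real s t *: y N.
Proof.
by rewrite rspanS eqxx; congr (_ + _); apply: eq_rspan => i iN; rewrite ltn_eqF.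
Qed.

(** Equivalently, the coordinate along y_N is a well-defined functional on the enlarged span, of
    norm at most 1 / delta. *)
Definition separated N (delta : R) :=
  0 < delta /\ forall t c, `|t| * delta <= nrm (of_real s t *: y N + rspan N c).

Definition rspan_closed N := forall v : X,
  (forall e : R, 0 < e -> exists c, nrm (v - rspan N c) < e) -> exists c, v = rspan N c.

Lemma rspan_separated N : rspan_closed N -> (exists c, y N = rspan N c) \/ exists delta, separated N delta.
Proof.
move=> closedN; have [|ny] := pselect (exists c, y N = rspan N c); [by left|right].
have [e e0 he] : exists2 e : R, 0 < e & forall c, e <= nrm (y N - rspan N c).
  apply: contrapT => /forall2NP h; apply: ny; apply: closedN => e e0.
  have [//|] := h e => /existsNP[c /negP]; rewrite -ltNge => hc; by exists c.
exists e; split => // t c; have [->|t0] := eqVneq t 0.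
  by rewrite normr0 mul0r nrm_ge0.
have -> : of_real s t *: y N + rspan N c = of_real s t *: (y N - rspan N (fun i => - t^-1 * c i + 0 * c i)).
  rewrite rspan_lin of_real0 scale0r addr0 scalerBr scalerA -of_realM mulrN divff//.
  by rewrite of_realN of_real1 scaleN1r opprK.
by rewrite nrmZ nrm_of_real ler_wpM2l.
Qed.

(** Induction on the number of generators. If y_N is at positive distance from the span of the
    earlier ones, its coefficients in an approximating sequence converge, and subtracting their
    limit leaves a limit of elements of the smaller span. *)
Lemma rspan_is_closed N : rspan_closed N.
Proof.
elim: N => [|N IH] v hv.
  exists (fun=> 0); rewrite /rspan big_ord0; apply/eqP; rewrite -nrm_eq0; apply/eqP/le_anti.
  rewrite nrm_ge0 andbT; apply/ler_addgt0Pr => e /hv[c]; rewrite /rspan big_ord0 subr0 add0r.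
  exact: ltW.
have [[c yc]|[delta [d0 hd]]] := rspan_separated IH.
  have [c' ->] : exists c', v = rspan N c'.
    apply: IH => e /hv[c' hc']; exists (fun i => 1 * c' i + c' N * c i).
    by rewrite rspan_lin of_real1 scale1r -yc -rspanS.
  by exists (fun i => if i == N then 0 else c' i); rewrite rspan_cut of_real0 scale0r addr0.
have /choice[c hc] : forall k : nat, exists c, nrm (v - rspan N.+1 c) < k.+1%:R^-1.
  by move=> k; apply: hv; rewrite invr_gt0.
pose t k := c k N; pose a k : R := (k.+1%:R * delta)^-1.
have tt k l : `|t k - t l| <= a k + a l.
  have h1 := hd (t k - t l) (fun i => 1 * c k i + (-1) * c l i).
  have e1 : of_real s (t k - t l) *: y N + rspan N (fun i => 1 * c k i + -1 * c l i) =
      - ((v - rspan N.+1 (c k)) - (v - rspan N.+1 (c l))).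
    rewrite rspan_lin !rspanS -/(t k) -/(t l) !of_realD !of_realN of_real1 scale1r scaleN1r scalerBl.
    by rewrite opprB opprB [RHS]addrC [RHS]addrA subrK opprD [RHS]addrACA [RHS]addrC.
  rewrite -(ler_pM2r d0); apply: (le_trans h1); rewrite e1 nrmN.
  apply: (le_trans (nrmB _ _)); rewrite mulrDl /a !invfM -!mulrA mulVf ?gt_eqF// !mulr1.
  by apply: lerD; apply: ltW.
(* The intervals [t_k - a_k, t_k + a_k] meet pairwise, so the supremum of their left ends lies in
   all of them. *)
pose T := sup (range (fun k => t k - a k)).
have ubT l : ubound (range (fun k => t k - a k)) (t l + a l).
  by move=> _ [k _ <-]; have := tt k l; rewrite ler_norml => /andP[_]; lra.
have hsup : has_sup (range (fun k => t k - a k)).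
  by split; [exists (t 0%N - a 0%N); exists 0%N|exists (t 0%N + a 0%N); exact: ubT].
have Tt k : `|T - t k| <= a k.
  rewrite ler_norml; apply/andP; split.
    by have : t k - a k <= T by [apply: sup_upper_bound => //; exists k]; lra.
  by have : T <= t k + a k by [apply: ge_sup; [exact: hsup.1|exact: ubT]]; lra.
have [c' hc'] : exists c', v - of_real s T *: y N = rspan N c'.
  apply: IH => e e0.
  pose M : R := 1 + delta^-1 * nrm (y N).
  have M0 : 0 < M by rewrite ltr_pwDl// mulr_ge0 ?nrm_ge0// invr_ge0 ltW.
  have [k hk] : exists k : nat, k.+1%:R^-1 < e / M.
    exists (Num.bound (M / e)); rewrite -[ltRHS]invrK ltf_pV2 ?posrE ?invr_gt0 ?divr_gt0//.
    rewrite invf_div (lt_trans (archi_boundP _))// ?ltr_nat//.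
    by rewrite divr_ge0// ltW.
  exists (c k).
  have -> : v - of_real s T *: y N - rspan N (c k) = (v - rspan N.+1 (c k)) - of_real s (T - t k) *: y N.
    rewrite rspanS -/(t k) of_realD of_realN scalerBl !opprD opprK -!addrA; congr (_ + _).
    by rewrite (addrC (- (of_real s T *: y N)) (of_real s (t k) *: y N)) addKr addrC.
  apply: (le_lt_trans (nrmB _ _)); rewrite nrmZ nrm_of_real.
  apply: (@lt_le_trans _ _ (k.+1%:R^-1 + a k * nrm (y N))).
    by rewrite ltr_leD// ler_wpM2r ?nrm_ge0.
  rewrite /a invfM -mulrA -[X in X + _]mulr1 -mulrDr -/M.
  by rewrite -ler_pdivlMr// ltW.
exists (fun i => if i == N then T else c' i); rewrite rspan_cut -hc' subrK//.
Qed.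

End real_span.

Section finite_rank_summable.
Context (R : realType) (s : scalar_kind) (H X : normedModType (scalars R s)).

(** An inequality rather than an equality, since vectors with index outside J are replaced by 0. *)
Definition bessel (h : nat -> H) n := forall c : nat -> R,
  nrm (\sum_(i < n) of_real s (c i) *: h i) ^+ 2 <= \sum_(i < n) c i ^+ 2.

(** The coordinate phi along a separated generator is a bounded real-linear functional, for which
    Bessel's inequality gives square summability; what remains of f takes values in the span of one
    generator less. Only real linearity of f is asked, so that the complex case fits. *)
Lemma real_rank_summable (y : nat -> X) N : forall f : H -> X,
  (forall a b x x', f (of_real s a *: x + of_real s b *: x') = of_real s a *: f x + of_real s b *: f x') ->
  (exists L, forall x, nrm (f x) <= L * nrm x) ->
  (forall x, exists c, f x = rspan y N c) ->
  exists C : R, forall h n, bessel h n -> \sum_(i < n) nrm (f (h i)) ^+ 2 <= C.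
Proof.
elim: N => [|N IH] f lf [L hL] hf.
  exists 0 => h n _; rewrite big1// => i _; have [c ->] := hf (h i).
  by rewrite /rspan big_ord0 nrm0 expr0n.
have [[c yc]|[delta [d0 hd]]] := rspan_separated (@rspan_is_closed _ _ _ y N).
  apply: IH => //; first by exists L.
  move=> x; have [c' ->] := hf x; exists (fun i => 1 * c' i + c' N * c i).
  by rewrite rspan_lin of_real1 scale1r -yc -rspanS.
have /choice[c hc] := hf.
pose phi x := c x N.
have fE x : f x = rspan y N (c x) + of_real s (phi x) *: y N by rewrite hc rspanS.
have phi_bound x : `|phi x| <= L / delta * nrm x.
  rewrite mulrAC ler_pdivlMr//; apply: le_trans (hL x).
  by rewrite fE addrC; exact: hd.
have phi_lin a b x x' : phi (of_real s a *: x + of_real s b *: x') = a * phi x + b * phi x'.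
  apply/eqP; rewrite -subr_eq0 -normr_eq0; apply/eqP/le_anti; rewrite normr_ge0 andbT.
  rewrite -(pmulr_lle0 _ d0).
  pose cc i := 1 * c (of_real s a *: x + of_real s b *: x') i + (-1) * (a * c x i + b * c x' i).
  apply: (le_trans (hd _ cc)); rewrite /cc rspan_lin rspan_lin.
  have := lf a b x x'; rewrite !fE => e.
  rewrite of_real1 scale1r of_realN of_real1 scaleN1r.
  move: e; set P := phi _; set S := rspan _ _ _; set S1 := rspan _ _ _; set S2 := rspan _ _ _ => e.
  have -> : of_real s (P - (a * phi x + b * phi x')) *: y N + (S - (of_real s a *: S1 + of_real s b *: S2)) =
     (S + of_real s P *: y N) - (of_real s a *: (S1 + of_real s (phi x) *: y N) + of_real s b *: (S2 + of_real s (phi x') *: y N)).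
    rewrite of_realD of_realN of_realD !of_realM !scalerDr !scalerA scalerBl scalerDl.
    rewrite addrACA [in RHS](addrC S) -!addrA; congr (_ + _).
    by congr (_ + _); rewrite -opprD; congr (- _); rewrite [LHS]addrC addrACA -addrA.
  by rewrite e subrr nrm0.
pose g x := f x - of_real s (phi x) *: y N.
have [C hC] : exists C : R, forall h n, bessel h n -> \sum_(i < n) nrm (g (h i)) ^+ 2 <= C.
  apply: IH.
  - move=> a b x x'; rewrite /g lf phi_lin of_realD !of_realM scalerDl !scalerBr !scalerA.
    by rewrite opprD addrACA.
  - exists (L + L / delta * nrm (y N)) => x; rewrite /g; apply: (le_trans (nrmB _ _)).
    by rewrite mulrDl lerD ?hL// nrmZ nrm_of_real mulrAC ler_wpM2r ?nrm_ge0.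
  - by move=> x; exists (c x); rewrite /g fE addrK.
exists (2 * C + 2 * ((L / delta) ^+ 2 * nrm (y N) ^+ 2)) => h n hn.
have phiB : \sum_(i < n) phi (h i) ^+ 2 <= (L / delta) ^+ 2.
  (* Testing Bessel's inequality with the coefficients phi (h_i) gives B <= (L / delta) sqrt B,
     hence B <= (L / delta)^2. *)
  set B := \sum_(i < n) _.
  have B0 : 0 <= B by apply: sumr_ge0 => i _; exact: sqr_ge0.
  have phi_sum (m : nat) (a : nat -> R) : phi (\sum_(i < m) of_real s (a i) *: h i) = \sum_(i < m) a i * phi (h i).
    elim: m => [|m IHm].
      rewrite !big_ord0; apply/normr0_eq0/le_anti; rewrite normr_ge0 andbT.
      by apply: (le_trans (phi_bound _)); rewrite nrm0 mulr0.
    rewrite !big_ord_recr/= -[X in X + _]scale1r -(of_real1 R s) phi_lin mul1r IHm//.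
  have BE : phi (\sum_(i < n) of_real s (phi (h i)) *: h i) = B.
    by rewrite (phi_sum n (fun i => phi (h i))); apply: eq_bigr => i _; rewrite expr2.
  have h1 := phi_bound (\sum_(i < n) of_real s (phi (h i)) *: h i); rewrite BE ger0_norm// in h1.
  have h2 := hn (fun i => phi (h i)); rewrite -/B in h2.
  have [->|B00] := eqVneq B 0; first exact: sqr_ge0.
  have Bp : 0 < B by rewrite lt_neqAle eq_sym B00.
  rewrite -(ler_pM2r Bp) -expr2.
  set w := nrm _ in h1 h2.
  have h3 : B ^+ 2 <= (L / delta * w) ^+ 2.
    by rewrite ler_pXn2r ?nnegrE// (le_trans B0 h1).
  by apply: (le_trans h3); rewrite exprMn ler_wpM2l// sqr_ge0.
apply: (@le_trans _ _ (\sum_(i < n) (2 * nrm (g (h i)) ^+ 2 + 2 * nrm (y N) ^+ 2 * phi (h i) ^+ 2))).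
  apply: ler_sum => i _.
  have -> : f (h i) = g (h i) + of_real s (phi (h i)) *: y N by rewrite /g subrK.
  have h1 : nrm (g (h i) + of_real s (phi (h i)) *: y N) ^+ 2 <= (nrm (g (h i)) + `|phi (h i)| * nrm (y N)) ^+ 2.
    rewrite ler_pXn2r ?nnegrE ?nrm_ge0 ?addr_ge0 ?mulr_ge0 ?nrm_ge0//.
    by apply: (le_trans (nrmD _ _)); rewrite nrmZ nrm_of_real.
  apply: (le_trans h1); have := sqr_ge0 (nrm (g (h i)) - `|phi (h i)| * nrm (y N)).
  rewrite -(real_normK (num_real (phi (h i)))) sqrrB sqrrD exprMn.
  by move: (`|phi _|) (nrm (g _)) (nrm (y _)) => u v w; lra.
rewrite big_split/= -!mulr_sumr lerD// ?ler_wpM2l// ?hC//.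
by rewrite -mulrA ler_wpM2l// mulrC ler_wpM2r ?sqr_ge0.
Qed.

Lemma linear_continuous_bounded (f : H -> X) : linear f -> continuous f ->
  exists L, forall x, nrm (f x) <= L * nrm x.
Proof.
move=> lf cf.
have f0 : f 0 = 0.
  by have := lf (-1) 0 0; rewrite scaler0 addr0 scaleN1r addNr.
have fZ a x : f (a *: x) = a *: f x by have := lf a x 0; rewrite addr0 f0 addr0.
have [r r0 hr] : exists2 r : R, 0 < r & forall x, nrm x < r -> nrm (f x) < 1.
  have : \forall x \near (0 : H), `|f 0 - f x| < 1.
    by move/cvgrPdist_lt : (cf 0) => /(_ 1 ltr01).
  move=> /nbhs_ballP[e/= e0 he]; exists (sre e); first exact: sre_gt0.
  move=> x xe; have : `|f 0 - f x| < 1.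
    apply: he; rewrite -ball_normE/= sub0r normrN -of_real_nrm -(of_real_sre (ltW e0)).
    by rewrite of_real_lt.
  by rewrite f0 sub0r normrN -of_real_nrm -(of_real1 R s) of_real_lt.
exists (2 / r) => x; have [->|x0] := eqVneq x 0; first by rewrite f0 !nrm0 mulr0.
have nx : 0 < nrm x by rewrite lt_neqAle nrm_ge0 eq_sym nrm_eq0 x0.
pose t := r / (2 * nrm x); have t0 : 0 < t by rewrite divr_gt0// mulr_gt0.
have := hr (of_real s t *: x); rewrite fZ !nrmZ nrm_of_real gtr0_norm// => h.
have tx : t * nrm x = r / 2 by rewrite /t; field; rewrite gt_eqF.
have {}h : t * nrm (f x) < 1 by apply: h; rewrite tx; lra.
rewrite -(ler_pM2l t0) mulrCA tx; apply: (le_trans (ltW h)).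
by rewrite (_ : 2 / r * (r / 2) = 1)//; field; rewrite gt_eqF.
Qed.

Lemma finite_rank_summable (f : H -> X) : finite_rank f ->
  exists C : R, forall h n, bessel h n -> \sum_(i < n) nrm (f (h i)) ^+ 2 <= C.
Proof.
move=> [lf cf [n [y hy]]].
(* The scalar span of the y_i is contained in the real span of the y_i followed by the [imag_unit]
   multiples of the y_i. *)
pose y' k : X := if insub k is Some i then y i else
  if insub (k - n)%N is Some i then imag_unit R s *: y i else 0.
apply: (@real_rank_summable y' (n + n)).
- move=> a b x x'; rewrite lf; congr (_ + _).
  have f0 : f 0 = 0 by have := lf (-1) 0 0; rewrite scaler0 addr0 scaleN1r addNr.
  by have := lf (of_real s b) x' 0; rewrite addr0 f0 addr0.
- exact: linear_continuous_bounded.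
- move=> x; have [c ->] := hy x.
  exists (fun k => if insub k is Some i then sre (c i) else
    if insub (k - n)%N is Some i then sim (c i) else 0).
  rewrite /rspan big_split_ord/= -big_split/=; apply: eq_bigr => i _.
  rewrite /y' /= valK insubF; last by rewrite ltnNge leq_addr.
  rewrite addKn valK scalerA -scalerDl; congr (_ *: _).
  by rewrite {1}(scalar_decomp (c i)) mulrC [X in _ = _ + X]mulrC [in LHS]mulrC.
Qed.

End finite_rank_summable.

Section orthonormal_sums.
Context (R : realType) (s : scalar_kind) (H : completeNormedModType (scalars R s)).
Local Notation K := (scalars R s).
Variables (ip : {dot H for @sconj R s}) (J : set nat) (h : nat -> H).
Hypothesis hH : hilbert_inner ip.
Hypothesis oh : orthonormal_on ip J h.

Lemma inner_sum (n : nat) (x y : nat -> H) :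
  ip (\sum_(i < n) x i) (\sum_(i < n) y i) = \sum_(i < n) \sum_(j < n) ip (x i) (y j).
Proof.
rewrite linear_sumlz; apply: eq_bigr => i _.
by rewrite linear_sumr.
Qed.

Lemma inner_self_nrm (x : H) : ip x x = of_real s (nrm x ^+ 2).
Proof. by rewrite hH -of_real_nrm expr2 -of_realM -expr2. Qed.

Lemma mul_sconj (a : K) : a * sconj a = of_real s (nrm a ^+ 2).
Proof.
apply: scalar_ext; rewrite ?sre_of_real ?sim_of_real ?sreM ?simM sre_sconj sim_sconj ?sqr_nrm_scalar.
  by rewrite mulrN opprK !expr2.
by rewrite mulrN mulrC addNr.
Qed.

Lemma orthonormal_sum (m n : nat) (a : nat -> K) :
  nrm (\sum_(i < n) a i *: (if (m + i)%N \in J then h (m + i)%N else 0)) ^+ 2 =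
  \sum_(i < n) (if (m + i)%N \in J then nrm (a i) ^+ 2 else 0).
Proof.
pose k i : H := if (m + i)%N \in J then h (m + i)%N else 0.
suff e : ip (\sum_(i < n) a i *: k i) (\sum_(i < n) a i *: k i) =
    of_real s (\sum_(i < n) (if (m + i)%N \in J then nrm (a i) ^+ 2 else 0)).
  by move: e; rewrite inner_self_nrm => /(f_equal (@sre R s)); rewrite !sre_of_real.
rewrite (inner_sum n (fun i => a i *: k i) (fun i => a i *: k i)).
rewrite (big_morph (of_real s) (@of_realD R s) (of_real0 R s)).
apply: eq_bigr => i _.
rewrite (bigD1 i)//= big1 ?addr0.
  rewrite linearZl_LR linearZr_LR/= mulrA mul_sconj /k; case: ifPn => [iJ|_].
    by rewrite oh ?eqxx ?mulr1//; exact/set_mem.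
  by rewrite linear0r mulr0 of_real0.
move=> j ji; rewrite linearZl_LR linearZr_LR/= /k.
case: ifPn => [iJ|_]; last by rewrite linear0l !mulr0.
case: ifPn => [jJ|_]; last by rewrite linear0r !mulr0.
rewrite oh; [|exact/set_mem|exact/set_mem].
have -> : (m + i == m + j)%N = false.
  by rewrite eqn_add2l; apply: contraNF ji => /eqP ij; apply/eqP/val_inj.
by rewrite !mulr0.
Qed.

Lemma orthonormal_bessel (m n : nat) :
  bessel (fun i => if (m + i)%N \in J then h (m + i)%N else 0) n.
Proof.
move=> c; rewrite (orthonormal_sum m n (fun i => of_real s (c i))); apply: ler_sum => i _.
by case: ifP => _; rewrite ?sqr_ge0// nrm_of_real real_normK ?num_real.
Qed.

End orthonormal_sums.

Lemma cvgn_of_tails (R : realType) (s : scalar_kind) (X : completeNormedModType (scalars R s))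
    (v : nat -> X) :
  (forall e : R, 0 < e -> exists m, forall n, nrm (\sum_(i < n) v (m + i)%N) <= e) ->
  cvgn (fun n => \sum_(i < n) v i).
Proof.
move=> hv; apply/cauchy_cvgP/cauchy_ballP => e e0; near_simpl.
have e20 : 0 < sre e / 3 by rewrite divr_gt0// sre_gt0.
have [m hm] := hv _ e20.
have tail n : (m <= n)%N -> nrm (\sum_(i < n) v i - \sum_(i < m) v i) <= sre e / 3.
  by move=> mn; rewrite -(subnKC mn) big_split_ord/= addrAC subrr add0r; exact: hm.
near=> p q => /=.
have mp : (m <= p)%N by near: p; exists m.
have mq : (m <= q)%N by near: q; exists m.
rewrite -ball_normE/= -of_real_nrm -(of_real_sre (ltW e0)) of_real_lt.
rewrite (_ : _ - _ = (\sum_(i < p) v i - \sum_(i < m) v i) - (\sum_(i < q) v i - \sum_(i < m) v i)); last first.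
  by rewrite opprB addrA subrK.
apply: (le_lt_trans (nrmB _ _)); apply: (le_lt_trans (lerD (tail p mp) (tail q mq))).
by have := sre_gt0 e0; lra.
Unshelve. all: by end_near. Qed.

(** * Almost sure convergence of Gaussian series *)

Section oscillation.
Context (R : realType) (s : scalar_kind) (X : completeNormedModType (scalars R s)).
Local Open Scope ereal_scope.

(** Squared so that [family_maximal] bounds its mean directly. *)
Definition max_tail (v : nat -> X) m n : R :=
  ((\big[Num.max/0%R]_(j < n.+1) nrm (\sum_(i < j) v (m + i)%N)%R) `^ 2)%R.

Definition sup_tail (v : nat -> X) m : \bar R := ereal_sup (range (fun n => (max_tail v m n)%:E)).

(* limn is a junk value for divergent series, so convergence has to be proved;
   the oscillation turns it into the vanishing of a measurable quantity. *)
Definition osc (v : nat -> X) : \bar R := ereal_inf (range (sup_tail v)).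

Lemma max_tail_ge0 v m n : (0 <= max_tail v m n)%R. Proof. exact: powR_ge0. Qed.

Lemma max_tail_nd v m : {homo (max_tail v m) : n k / (n <= k)%N >-> (n <= k)%R}.
Proof.
move=> n k nk; apply: ge0_ler_powR; rewrite ?nnegrE ?bigmax_ge_id//.
exact: (le_bigmax_ord xpredT (fun j => nrm (\sum_(i < j) v (m + i)%N)%R)).
Qed.

Lemma sup_tail_ge0 v m : 0 <= sup_tail v m.
Proof.
apply: (@le_trans _ _ (max_tail v m 0)%:E); first by rewrite lee_fin max_tail_ge0.
by apply: ereal_sup_ubound; exists 0%N.
Qed.

Lemma osc_ge0 v : 0 <= osc v.
Proof. by apply: le_ereal_inf_tmp => _ [m _ <-]; exact: sup_tail_ge0. Qed.

Lemma osc_eq0_cvg v : osc v = 0 -> cvgn (fun n => \sum_(i < n) v i)%R.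
Proof.
move=> v0; apply: cvgn_of_tails => e e0.
have : osc v < (e ^+ 2)%:E by rewrite v0 lte_fin exprn_gt0.
move=> /ereal_inf_lt[_ [m _ <-] hm]; exists m => n.
have : (max_tail v m n)%:E < (e ^+ 2)%:E.
  by apply: le_lt_trans hm; apply: ereal_sup_ubound; exists n.
rewrite lte_fin /max_tail powR_mulrn ?bigmax_ge_id// ltr_pXn2r ?nnegrE ?bigmax_ge_id ?(ltW e0)// => h.
apply: le_trans (ltW h).
exact: (le_bigmax _ (fun j : 'I_n.+1 => nrm (\sum_(i < j) v (m + i)%N)%R) ord_max).
Qed.

Section measurability.
Context d (T : measurableType d) (v : nat -> T -> X).
Hypothesis mv : forall i, smeasurable (v i).

Lemma measurable_max_tail m n : measurable_fun setT (fun w => max_tail (v ^~ w) m n).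
Proof.
apply: (measurableT_comp (measurable_powR _)).
elim: n.+1 => [|k IH]; first by under eq_fun do rewrite big_ord0; exact: measurable_cst.
rewrite (_ : (fun w => _) = fun w => Num.max (\big[Num.max/0%R]_(j < k) nrm (\sum_(i < j) v (m + i)%N w)%R)
  (nrm (\sum_(i < k) v (m + i)%N w)%R)); last first.
  by apply/funext => w; rewrite (bigmax_ordS (fun j => nrm (\sum_(i < j) v (m + i)%N w)%R)).
apply: measurable_maxr => //; apply: smeasurable_nrm.
by apply: smeasurable_sum => i _; exact: mv.
Qed.

Lemma measurable_sup_tail m : measurable_fun setT (fun w => sup_tail (v ^~ w) m).
Proof.
rewrite (_ : (fun w => _) = fun w => esups (fun n => (max_tail (v ^~ w) m n)%:E) 0%N).
  by apply: measurable_fun_esups => n; apply/measurable_EFinP; exact: measurable_max_tail.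
by apply/funext => w; rewrite /esups/= /sup_tail; congr ereal_sup; apply/seteqP; split => x [n _ <-]; exists n.
Qed.

Lemma measurable_osc : measurable_fun setT (fun w => osc (v ^~ w)).
Proof.
rewrite (_ : (fun w => _) = fun w => einfs (fun m => sup_tail (v ^~ w) m) 0%N).
  by apply: measurable_fun_einfs => m; exact: measurable_sup_tail.
by apply/funext => w; rewrite /einfs/= /osc; congr ereal_inf; apply/seteqP; split => x [n _ <-]; exists n.
Qed.

Lemma integral_sup_tail_le (mu : {measure set T -> \bar R}) m (c : \bar R) :
  (forall n, \int[mu]_w (max_tail (v ^~ w) m n)%:E <= c) -> \int[mu]_w sup_tail (v ^~ w) m <= c.
Proof.
move=> hc.
have lE w : sup_tail (v ^~ w) m = limn (fun n => (max_tail (v ^~ w) m n)%:E).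
  apply/esym/cvg_lim => //; apply: ereal_nondecreasing_cvgn => n k nk.
  by rewrite lee_fin max_tail_nd.
under eq_integral do rewrite lE.
rewrite monotone_convergence//.
- apply: lime_le; last exact: nearW.
  apply: ereal_nondecreasing_is_cvgn => n k nk; apply: mean_le; try exact: measurable_max_tail.
    by move=> w; exact: max_tail_ge0.
  by move=> w; exact: max_tail_nd.
- by move=> n; apply/measurable_EFinP; exact: measurable_max_tail.
- by move=> n w _; rewrite lee_fin max_tail_ge0.
- by move=> w _ n k nk; rewrite lee_fin max_tail_nd.
Qed.

End measurability.
End oscillation.

Section gamma_tails.
Context (R : realType) (s : scalar_kind).
Local Notation K := (scalars R s).
Context (X H : completeNormedModType K) (ip : {dot H for @sconj R s}).
Context dG (OmG : measurableType dG) (PG : probability OmG R) (g : nat -> {RV PG >-> R}).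
Hypothesis hg : iid_std_gaussian g.
Variables (D : R) (J : set nat) (h : nat -> H).
Hypothesis D1 : (1 <= D)%R.
Hypothesis hX : smooth2 X D.
Hypothesis hH : hilbert_inner ip.
Hypothesis oh : orthonormal_on ip J h.
Local Open Scope ereal_scope.

Definition masked (f : H -> X) i : X := if i \in J then f (h i) else 0%R.

(** f is split into a finite rank f0 and a remainder of gamma-norm below e / 2. The remainder is
    small on every block of indices, the f0 part on late blocks by type 2 and square summability,
    and 2 ((e / 2)^2 + e^2 / 4) = e^2. *)
Lemma gamma_tail (f : H -> X) : gamma_space ip g f -> forall e : R, (0 < e)%R ->
  exists m0, forall m n, (m0 <= m)%N ->
    \int[PG]_w (nrm (gsum g (fun i => masked f (m + i)) n w) ^+ 2)%:E <= (e ^+ 2)%:E.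
Proof.
move=> [lf cf hf] e e0.
have e20 : (0 < e / 2)%R by rewrite divr_gt0.
have [f0 [rf0 df0]] := hf _ e20.
have [C hC] := finite_rank_summable rf0.
have [B B0 hB] := gsum_type2 hg D1 hX.
pose u n : R := (\sum_(i < n) nrm (masked f0 i) ^+ 2)%R.
have f00 : f0 0%R = 0%R by have [l0 _ _] := rf0; have := l0 (-1)%R 0%R 0%R; rewrite scaler0 addr0 scaleN1r addNr.
have uC n : (u n <= C)%R.
  apply: le_trans (hC _ n (orthonormal_bessel hH oh 0 n)); apply: ler_sum => i _.
  by rewrite add0n /masked; case: ifP => _; rewrite ?f00 ?nrm0.
have uD m n : (u (m + n)%N = u m + \sum_(i < n) nrm (masked f0 (m + i)) ^+ 2)%R.
  by rewrite /u big_split_ord.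
pose S := sup (range u).
have hS : has_sup (range u) by split; [exists (u 0%N); exists 0%N|exists C => _ [n _ <-]; exact: uC].
(* Chosen so that B * ee <= e^2 / 4; B + 1 avoids a division by zero. *)
pose ee : R := (e ^+ 2 / (4 * (B + 1)))%R.
have B10 : (0 < B + 1)%R by rewrite ltr_wpDl.
have ee0 : (0 < ee)%R by rewrite divr_gt0 ?exprn_gt0// mulr_gt0.
have [_ [m0 _ <-] hm0] := sup_adherent ee0 hS.
exists m0 => m n m0m.
have tail : (\sum_(i < n) nrm (masked f0 (m + i)) ^+ 2 <= ee)%R.
  have h1 : (u (m + n)%N <= S)%R by apply: sup_upper_bound => //; exists (m + n)%N.
  have h2 : (u m0 <= u m)%R.
    by rewrite -(subnKC m0m) uD lerDl sumr_ge0// => i _; exact: sqr_ge0.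
  by move: h1 h2 hm0; rewrite uD -/S; lra.
have t1 : \int[PG]_w (nrm (gsum g (fun i => masked f0 (m + i)) n w) ^+ 2)%:E <= (e ^+ 2 / 4)%:E.
  apply: (le_trans (hB _ _)); rewrite lee_fin.
  apply: (@le_trans _ _ (B * ee)%R); first by rewrite ler_wpM2l.
  have -> : (B * ee = e ^+ 2 / 4 * (B / (B + 1)))%R by rewrite /ee; field; rewrite gt_eqF.
  by rewrite ler_piMr ?divr_ge0 ?sqr_ge0// ler_pdivrMr// mul1r lerDl.
have t2 : \int[PG]_w (nrm (gsum g (fun i => masked (fun x => f x - f0 x)%R (m + i)) n w) ^+ 2)%:E <= ((e / 2) ^+ 2)%:E.
  exact: (gsum_gamma hg m n oh (ltW e20) (ltW df0)).
have mm x : measurable_fun setT (fun w => nrm (gsum g x n w : X) ^+ 2)%R.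
  by apply: measurable_funX; exact: measurable_gsum.
apply: (@le_trans _ _ (2%:E * (\int[PG]_w (nrm (gsum g (fun i => masked (fun x => f x - f0 x)%R (m + i)) n w) ^+ 2)%:E +
   \int[PG]_w (nrm (gsum g (fun i => masked f0 (m + i)) n w) ^+ 2)%:E))); last first.
  apply: (le_trans (lee_wpmul2l _ (leeD t2 t1))); first by rewrite lee_fin.
  rewrite -EFinD -EFinM lee_fin.
  rewrite expr_div_n (_ : 2 ^+ 2 = 4 :> R)%R; last by ring.
  by lra.
rewrite -meanD//; do ?[by move=> w; exact: sqr_ge0].
rewrite -meanZ//; do ?[by move=> w; rewrite addr_ge0 ?sqr_ge0|exact: measurable_funD].
apply: mean_le => //.
- by apply: measurable_funM => //; exact: measurable_funD.
- by move=> w; exact: sqr_ge0.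
move=> w.
have -> : gsum g (fun i => masked f (m + i)) n w =
  (gsum g (fun i => masked (fun x => f x - f0 x)%R (m + i)) n w + gsum g (fun i => masked f0 (m + i)) n w)%R.
  rewrite /gsum -big_split/=; apply: eq_bigr => i _; rewrite -scalerDr /masked.
  by case: ifP => _; rewrite ?subrK ?addr0.
set a := gsum _ _ _ _; set b := gsum _ _ _ _.
have h1 : (nrm (a + b) ^+ 2 <= (nrm a + nrm b) ^+ 2)%R.
  by rewrite ler_pXn2r ?nnegrE ?nrm_ge0 ?addr_ge0 ?nrm_ge0 ?nrmD.
apply: (le_trans h1); have := sqr_ge0 (nrm a - nrm b); rewrite sqrrB sqrrD.
by move: (nrm a) (nrm b) => x y; lra.
Qed.

Context d (Om : measurableType d) (P : probability Om R).

(** The oscillation lies below every [sup_tail], and the mean of a late one is at most 16 * 16 *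
    kappa * t^2 with t as small as desired; t is taken so that this is at most e. *)
Lemma gaussian_series_osc (z : nat -> Om -> K) (kappa : R) (f : H -> X) : (0 <= kappa)%R ->
  (forall m n, gaussian_family P n (fun i => if (m + i)%N \in J then kappa else 0%R) (fun i => z (m + i)%N)) ->
  gamma_space ip g f ->
  \int[P]_w osc (fun i => z i w *: masked f i) = 0.
Proof.
move=> k0 hz hf.
have mz i : smeasurable (z i).
  by have [/(_ 0%N erefl)] := hz i 1%N; rewrite addn0.
have mv i : smeasurable (fun w => z i w *: masked f i).
  by apply: smeasurableZ => //; exact: smeasurable_cst.
apply/le_anti/andP; split; last by apply: integral_ge0 => w _; exact: osc_ge0.
apply/lee_addgt0Pr => e e0; rewrite add0e.
pose t : R := Num.sqrt (e / (16 * 16 * (kappa + 1))).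
have k10 : (0 < kappa + 1)%R by rewrite ltr_wpDl.
have q0 : (0 < e / (16 * 16 * (kappa + 1)))%R by rewrite divr_gt0// mulr_gt0.
have t0 : (0 < t)%R by rewrite sqrtr_gt0.
have t2 : (t ^+ 2 = e / (16 * 16 * (kappa + 1)))%R by rewrite sqr_sqrtr// ltW.
have [m0 hm0] := gamma_tail hf t0.
apply: (@le_trans _ _ (\int[P]_w sup_tail (fun i => z i w *: masked f i)%R m0)).
  apply: ge0_le_integral => //.
  - by move=> w _; exact: osc_ge0.
  - exact: (measurable_osc mv).
  - exact: (measurable_sup_tail mv).
  - by move=> w _; apply: ereal_inf_lbound; exists m0.
apply: (integral_sup_tail_le mv) => n.
have qx i : (i < n)%N -> (if (m0 + i)%N \in J then kappa else 0%R) = kappa \/ masked f (m0 + i) = 0%R.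
  by move=> _; rewrite /masked; case: ifP => _; [left|right].
have q00 i : (0 <= (if (m0 + i)%N \in J then kappa else 0))%R by case: ifP.
apply: (le_trans (family_maximal hg q00 k0 (hz m0 n) qx (hm0 m0 n (leqnn m0)))).
rewrite lee_fin t2.
have -> : (16 * 16 * (kappa * (e / (16 * 16 * (kappa + 1)))) = e * (kappa / (kappa + 1)))%R.
  by field; rewrite gt_eqF.
by rewrite ler_piMr ?(ltW e0)// ler_pdivrMr// mul1r lerDl.
Qed.

End gamma_tails.

(** * Independent sigma-algebras *)

Section decoupling.
Context (R : realType) d (Om : measurableType d) (P : probability Om R).
Variables (G1 G2 : set (set Om)).
Hypothesis sG1 : sigma_algebra setT G1.
Hypothesis sG2 : sigma_algebra setT G2.
Hypothesis mG1 : G1 `<=` measurable.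
Hypothesis mG2 : G2 `<=` measurable.
Hypothesis ind : independent_classes P G1 G2.
Local Open Scope ereal_scope.

Local Notation T1 := (g_sigma_algebraType G1).
Local Notation T2 := (g_sigma_algebraType G2).

Lemma measurable_to_sigma (G : set (set Om)) (sG : sigma_algebra setT G) (mG : G `<=` measurable) :
  measurable_fun setT (fun w : Om => w : g_sigma_algebraType G).
Proof.
move=> _ B mB; rewrite setTI; apply: mG.
by move: mB; rewrite /measurable/= (sigma_algebra_id sG).
Qed.

Let X2_mfun : {RV P >-> T2} := mfun_Sub (mem_set (measurable_to_sigma sG2 mG2)).

Let inner (F : T1 * T2 -> \bar R) x : measurable_fun setT F -> (forall u, 0 <= F u) ->
  \int[distribution P X2_mfun]_y F (x, y) = \int[P]_t F (x, t).
Proof.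
move=> mF F0; rewrite (ge0_integral_distribution X2_mfun (f := fun y => F (x, y)))//.
by apply: (measurableT_comp mF); exact: measurable_pair1.
Qed.

Let measurable_inner (F : T1 * T2 -> \bar R) : measurable_fun setT F -> (forall u, 0 <= F u) ->
  measurable_fun setT (fun x => \int[distribution P X2_mfun]_y F (x, y)).
Proof.
by move=> mF F0; have := @measurable_fun_fubini_tonelli_F _ _ _ _ R (distribution P X2_mfun) F mF F0; apply.
Qed.

Lemma measurable_section (F : T1 * T2 -> \bar R) : measurable_fun setT F -> (forall u, 0 <= F u) ->
  measurable_fun setT (fun w : Om => \int[P]_t F (w, t)).
Proof.
move=> mF F0; rewrite (_ : (fun w => _) = (fun x => \int[distribution P X2_mfun]_y F (x, y)) \o (fun w : Om => w : T1)).
  exact: (measurableT_comp (measurable_inner mF F0) (measurable_to_sigma sG1 mG1)).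
by apply/funext => w; rewrite /= inner.
Qed.

(* By independence, w |-> (w, w) carries P to a product measure on the product
   of the two sigma-algebras. *)
Lemma decoupling (F : T1 * T2 -> \bar R) : measurable_fun setT F -> (forall u, 0 <= F u) ->
  \int[P]_w F (w, w) = \int[P]_w \int[P]_t F (w, t).
Proof.
move=> mF F0.
have mi1 := measurable_to_sigma sG1 mG1; have mi2 := measurable_to_sigma sG2 mG2.
pose X1 : {RV P >-> T1} := mfun_Sub (mem_set mi1).
pose m1 := distribution P X1; pose m2 := distribution P X2_mfun.
have meas1 (A : set T1) : measurable A -> G1 A by rewrite /measurable/= (sigma_algebra_id sG1).
have meas2 (A : set T2) : measurable A -> G2 A by rewrite /measurable/= (sigma_algebra_id sG2).
have indep (A : set T1) (B : set T2) : measurable A -> measurable B ->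
    P ((fun w : Om => w : T1) @^-1` A `&` (fun w : Om => w : T2) @^-1` B) = m1 A * m2 B.
  by move=> /meas1 mA /meas2 mB; exact: ind.
rewrite [LHS](independent_integral (m1 := m1) (m2 := m2) mi1 mi2 indep mF F0).
rewrite (ge0_integral_distribution X1 (f := fun x => \int[m2]_y F (x, y)))//.
- by apply: eq_integral => w _; rewrite -inner.
- exact: measurable_inner.
- by move=> x; apply: integral_ge0.
Qed.

End decoupling.

(** * Cylindrical Brownian motion *)

Section scalar_integral.
Context (R : realType) (s : scalar_kind).
Local Notation K := (scalars R s).
Context d (T : measurableType d) (mu : {measure set T -> \bar R}) (A : set T).
Hypothesis mA : measurable A.

Definition sintegrable (f : T -> K) : Prop :=
  mu.-integrable A (fun x => (sre (f x))%:E) /\ mu.-integrable A (fun x => (sim (f x))%:E).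

Lemma sre_scalar_integral (f : T -> K) :
  sre (scalar_integral mu A f) = Rintegral mu A (fun x => sre (f x)).
Proof. by move: f; rewrite /scalar_integral /sre; case: s. Qed.

Lemma sim_scalar_integral (f : T -> K) :
  sim (scalar_integral mu A f) = Rintegral mu A (fun x => sim (f x)).
Proof.
move: f; rewrite /scalar_integral /sim; case: s => //= _.
by rewrite Rintegral_cst// mul0r.
Qed.

Lemma scalar_integral0 : scalar_integral mu A (fun=> 0 : K) = 0.
Proof.
apply: scalar_ext; rewrite ?sre_scalar_integral ?sim_scalar_integral ?sre0 ?sim0.
  by rewrite Rintegral_cst// mul0r.
by rewrite Rintegral_cst// mul0r.
Qed.

Lemma scalar_integral_sum (I : Type) (r : seq I) (c : I -> K) (F : I -> T -> K) :
  (forall i, sintegrable (F i)) ->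
  sintegrable (fun x => \sum_(i <- r) c i * F i x) /\
  scalar_integral mu A (fun x => \sum_(i <- r) c i * F i x) =
  \sum_(i <- r) c i * scalar_integral mu A (F i).
Proof.
move=> hF; elim: r => [|i r [[IH1 IH2] IH3]].
  under eq_fun do rewrite big_nil; rewrite big_nil scalar_integral0; split => //.
  split; rewrite ?sre0 ?sim0; exact: integrable0.
have iZ (a : R) (f : T -> R) : mu.-integrable A (EFin \o f) -> mu.-integrable A (fun x => (a * f x)%:E).
  by move=> h; under eq_fun do rewrite EFinM; exact: integrableZl.
have [h1 h2] := hF i.
have reE x : sre (\sum_(j <- i :: r) c j * F j x) =
    (sre (c i) * sre (F i x) - sim (c i) * sim (F i x)) + sre (\sum_(j <- r) c j * F j x).
  by rewrite big_cons sreD sreM.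
have imE x : sim (\sum_(j <- i :: r) c j * F j x) =
    (sre (c i) * sim (F i x) + sim (c i) * sre (F i x)) + sim (\sum_(j <- r) c j * F j x).
  by rewrite big_cons simD simM.
have i1 : mu.-integrable A (EFin \o (fun x => sre (c i) * sre (F i x) - sim (c i) * sim (F i x))).
  by apply: (@integrableB _ _ _ mu A mA (fun x => (sre (c i) * sre (F i x))%:E) (fun x => (sim (c i) * sim (F i x))%:E)); exact: iZ.
have i2 : mu.-integrable A (EFin \o (fun x => sre (c i) * sim (F i x) + sim (c i) * sre (F i x))).
  by apply: (@integrableD _ _ _ mu A mA (fun x => (sre (c i) * sim (F i x))%:E) (fun x => (sim (c i) * sre (F i x))%:E)); exact: iZ.
split.
  split; under eq_fun do rewrite ?reE ?imE EFinD; exact: integrableD.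
apply: scalar_ext.
  rewrite sre_scalar_integral; under eq_Rintegral do rewrite reE.
  rewrite RintegralD// RintegralB//; [|exact: iZ|exact: iZ].
  rewrite !RintegralZl// big_cons sreD sreM -IH3.
  by rewrite !sre_scalar_integral !sim_scalar_integral.
rewrite sim_scalar_integral; under eq_Rintegral do rewrite imE.
rewrite RintegralD// RintegralD//; [|exact: iZ|exact: iZ].
rewrite !RintegralZl// big_cons simD simM -IH3.
by rewrite !sre_scalar_integral !sim_scalar_integral.
Qed.

End scalar_integral.

Section sconj.
Context (R : realType) (s : scalar_kind).
Implicit Types a b : scalars R s.

Lemma sconjD a b : sconj (a + b) = sconj a + sconj b.
Proof. by apply: scalar_ext; rewrite ?(sreD, simD, sre_sconj, sim_sconj) ?opprD. Qed.

Lemma sconjM a b : sconj (a * b) = sconj a * sconj b.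
Proof.
apply: scalar_ext; rewrite ?(sreM, simM, sre_sconj, sim_sconj).
  by rewrite mulrNN.
by rewrite mulrN mulNr opprD.
Qed.

Lemma sconj0 : sconj (0 : scalars R s) = 0.
Proof. by apply: scalar_ext; rewrite ?(sre_sconj, sim_sconj) ?sre0 ?sim0 ?oppr0. Qed.

Lemma sconj_sum (I : Type) (r : seq I) (P : pred I) (F : I -> scalars R s) :
  sconj (\sum_(i <- r | P i) F i) = \sum_(i <- r | P i) sconj (F i).
Proof. exact: (big_morph _ sconjD sconj0). Qed.

End sconj.

Lemma simple_fun_bounded d (T : measurableType d) (R : realType) (f : T -> R) :
  simple_fun f -> exists C, forall x, `|f x| <= C.
Proof.
move=> [/finite_fsetP[A hA] _]; exists (\sum_(x <- finmap.enum_fset A) `|x|) => x.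
have xA : f x \in finmap.enum_fset A.
  by have : range f (f x) by [exists x]; rewrite hA.
rewrite (big_rem (f x))//= lerDl; exact: sumr_ge0.
Qed.

Section simple_L2.
Context (R : realType) (s : scalar_kind) (H : completeNormedModType (scalars R s)).
Variable T : R.
Hypothesis T0 : 0 <= T.
Local Notation mu := (lebesgue_measure : {measure set (measurableTypeR R) -> \bar R}).

Let mD : measurable (`]0, T[%classic : set (measurableTypeR R)).
Proof. exact: measurable_itv. Qed.

Let finD : (mu `]0%R, T[%classic < +oo)%E.
Proof. by rewrite /= lebesgue_measure_itv/=; case: ifP => _; rewrite ?ltry//= -EFinB ltry. Qed.

Lemma simple_real_integrable (f : measurableTypeR R -> R) : simple_fun f ->
  mu.-integrable `]0, T[%classic (EFin \o f).
Proof.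
move=> sf; have [C hC] := simple_fun_bounded sf.
have mf : measurable_fun setT f.
  by apply/smeasurable_realP; exists (fun=> f); split => [//|x]; exact: cvg_cst.
apply: (@le_integrable _ (measurableTypeR R) R mu _ mD _ (EFin \o cst C)).
- by apply/measurable_EFinP; exact: measurable_funTS.
- by move=> x _; rewrite /= lee_fin (le_trans (hC x))// ler_norm.
- apply/integrableP; split; first by apply/measurable_EFinP; exact: measurable_cst.
  rewrite [ltLHS](_ : _ = `|C|%:E * mu `]0%R, T[%classic)%E; last exact: (integral_cst mu mD `|C|%:E).
  by rewrite lte_mul_pinfty ?lee_fin.
Qed.

Lemma simple_L2_interval (f : measurableTypeR R -> H) : simple_fun f -> L2_interval T f.
Proof.
move=> sf; split.
  split => //; exists (fun=> f); split.
    by move=> n; have [h1 h2] := sf; split.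
  by move=> x; rewrite /norm_dist subrr nrm0; exact: cvg_cst.
have sn : simple_fun (fun t => nrm (f t) ^+ 2) by exact: (simple_fun_comp (fun x : H => nrm x ^+ 2)).
have /integrableP[_] := simple_real_integrable sn.
apply: le_lt_trans; rewrite le_eqVlt; apply/orP; left; apply/eqP.
by apply: eq_integral => t _; rewrite /= ger0_norm// sqr_ge0.
Qed.

Lemma step_simple (t : R) (x : H) : simple_fun (step t x : measurableTypeR R -> H).
Proof.
rewrite (_ : step t x = fun u => (fun b : bool => if b then x else 0) (0 < u < t)); last by apply/funext.
apply: (simple_fun_comp (fun b : bool => if b then x else 0)); split.
  by apply: (sub_finite_set (@subsetT _ _)); exact: finite_finset.
have mI : measurable (`]0, t[%classic : set (measurableTypeR R)) by exact: measurable_itv.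
case.
  by rewrite (_ : _ @^-1` _ = `]0, t[%classic).
rewrite (_ : _ @^-1` _ = ~` `]0, t[%classic); first exact: measurableC.
apply/seteqP; split => u /=; rewrite in_itv/=; last by move/negP/negbTE.
by move=> ->.
Qed.

End simple_L2.

Section cylindrical.
Context (R : realType) (s : scalar_kind).
Local Notation K := (scalars R s).
Context (H : completeNormedModType K) (ip : {dot H for @sconj R s}).
Context d (Om : measurableType d) (P : probability Om R) (T : R) (F : R -> set (set Om)).
Variable W : (R -> H) -> Om -> K.
Hypothesis hH : hilbert_inner ip.
Hypothesis T0 : 0 <= T.
Hypothesis hW : cylindrical_BM ip P T F W.
Local Notation mu := (lebesgue_measure : {measure set (measurableTypeR R) -> \bar R}).

Lemma W_gaussian_sre f : L2_interval T f -> centred_gaussian P (fun w => sre (W f w)).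
Proof.
have [gW _ _ _] := hW; move=> /gW/(_ 1 0); congr (centred_gaussian P _).
by apply/funext => w; rewrite mul1r mul0r addr0.
Qed.

Lemma W_gaussian_sim f : L2_interval T f -> centred_gaussian P (fun w => sim (W f w)).
Proof.
have [gW _ _ _] := hW; move=> /gW/(_ 0 1); congr (centred_gaussian P _).
by apply/funext => w; rewrite mul1r mul0r add0r.
Qed.

Lemma W_smeasurable f : L2_interval T f -> smeasurable (W f).
Proof.
move=> hf; apply/smeasurable_scalarP; split.
  by have [] := W_gaussian_sre hf.
by have [] := W_gaussian_sim hf.
Qed.

Lemma gaussian_prod_integrable (Y Z : Om -> R) : centred_gaussian P Y -> centred_gaussian P Z ->
  P.-integrable setT (fun w => (Y w * Z w)%:E).
Proof.
move=> gY gZ; have [v [_ _ _ _ /(_ 2) iY]] := gaussian_char gY.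
have [v' [_ _ _ _ /(_ 2) iZ]] := gaussian_char gZ.
have [mY _] := gY; have [mZ _] := gZ.
apply: (le_integrable measurableT _ _ (integrableD measurableT iY iZ)).
  by apply/measurable_EFinP; exact: measurable_funM.
move=> w _; rewrite -EFinD !abse_EFin lee_fin [leRHS]ger0_norm ?addr_ge0 ?exprn_ge0// normrM.
have := sqr_ge0 (`|Y w| - `|Z w|); have := sqr_ge0 (`|Y w|); have := sqr_ge0 (`|Z w|).
by rewrite sqrrB; move: (`|Y w|) (`|Z w|) => y z; nra.
Qed.

Lemma W_prod_integrable f g : L2_interval T f -> L2_interval T g ->
  sintegrable P setT (fun w => W f w * sconj (W g w)).
Proof.
move=> hf hg.
have f1 := W_gaussian_sre hf; have f2 := W_gaussian_sim hf.
have g1 := W_gaussian_sre hg; have g2 := W_gaussian_sim hg.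
split.
  rewrite (_ : (fun w => _) = (fun w => (sre (W f w) * sre (W g w))%:E + (sim (W f w) * sim (W g w))%:E)%E).
    by apply: integrableD => //; exact: gaussian_prod_integrable.
  by apply/funext => w; rewrite sreM sre_sconj sim_sconj mulrN opprK.
rewrite (_ : (fun w => _) = (fun w => (sim (W f w) * sre (W g w))%:E - (sre (W f w) * sim (W g w))%:E)%E).
  by apply: integrableB => //; exact: gaussian_prod_integrable.
by apply/funext => w; rewrite simM sre_sconj sim_sconj mulrN addrC.
Qed.

(* W is not assumed linear: E |sum b_k W f_k|^2 is computed from the covariance
   identity. *)
Lemma W_linear_relation (I : finType) (b : I -> K) (f : I -> R -> H) :
  (forall k, simple_fun (f k : measurableTypeR R -> H)) ->
  (forall t, \sum_k b k *: f k t = 0) ->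
  {ae P, forall w, \sum_k b k * W (f k) w = 0}.
Proof.
move=> sf rel.
have fL2 k : L2_interval T (f k) by exact: simple_L2_interval.
pose Z w := \sum_k b k * W (f k) w.
pose c (p : I * I) := b p.1 * sconj (b p.2).
pose G (p : I * I) w := W (f p.1) w * sconj (W (f p.2) w).
pose g (p : I * I) t := ip (f p.1 t) (f p.2 t).
have iG p : sintegrable P setT (G p) by exact: W_prod_integrable.
have mD : measurable (`]0, T[%classic : set (measurableTypeR R)) by exact: measurable_itv.
have ig p : sintegrable mu `]0, T[%classic (g p).
  have sg : simple_fun (g p : measurableTypeR R -> K) by exact: (simple_fun_comp2 (fun x y => ip x y)).
  by split; apply: simple_real_integrable => //; apply: (simple_fun_comp _ sg).
have ZE w : Z w * sconj (Z w) = \sum_(p : I * I) c p * G p w.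
  rewrite /Z sconj_sum mulr_suml.
  rewrite -(pair_bigA _ (fun k l => c (k, l) * G (k, l) w))/=.
  apply: eq_bigr => k _; rewrite mulr_sumr; apply: eq_bigr => l _.
  by rewrite sconjM /c /G/= mulrACA.
have gE t : \sum_(p : I * I) c p * g p t = 0.
  transitivity (ip (\sum_k b k *: f k t) (\sum_k b k *: f k t)); last by rewrite rel linear0l.
  rewrite linear_sumlz -(pair_bigA _ (fun k l => c (k, l) * g (k, l) t))/=.
  apply: eq_bigr => k _; rewrite linear_sumr; apply: eq_bigr => l _.
  by rewrite [RHS]linearZl_LR [in RHS]linearZr_LR/= /c /g/= mulrA.
have [_ cov _ _] := hW.
have [iZ ZI] := scalar_integral_sum measurableT (index_enum _) c iG.
have [_ gI] := scalar_integral_sum mD (index_enum _) c ig.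
have Z0 : scalar_integral P setT (fun w => Z w * sconj (Z w)) = 0.
  under eq_fun do rewrite ZE.
  rewrite ZI (eq_bigr (fun p => c p * scalar_integral mu `]0, T[%classic (g p))).
    rewrite -[LHS]gI (_ : (fun x => _) = fun=> 0); first exact: scalar_integral0.
    by apply/funext => t; exact: gE.
  by move=> p _; rewrite cov.
have iN : P.-integrable setT (fun w => (nrm (Z w) ^+ 2)%:E).
  have := iZ.1; apply: eq_integrable => // w _; rewrite -ZE mul_sconj sre_of_real//.
have N0 : (\int[P]_w (nrm (Z w) ^+ 2)%:E = 0)%E.
  rewrite -[LHS]fineK ?integrable_fin_num//.
  suff -> : fine (\int[P]_w (nrm (Z w) ^+ 2)%:E)%E = 0 by [].
  have := f_equal (@sre R s) Z0; rewrite sre_scalar_integral sre0 /Rintegral => <-.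
  by congr (fine _); apply: eq_integral => w _; rewrite mul_sconj sre_of_real.
have mN := measurable_int P iN.
have : (\int[P]_w `|(nrm (Z w) ^+ 2)%:E| = 0)%E.
  by rewrite -[RHS]N0; apply: eq_integral => w _; rewrite abse_EFin ger0_norm ?sqr_ge0.
move=> /(ae_eq_integral_abs P measurableT mN); apply: filterS => w /(_ Logic.I).
by case=> /eqP; rewrite expf_eq0/= nrm_eq0 => /eqP.
Qed.

Section increments.
Variables (u t : R) (J : set nat) (h : nat -> H).
Hypothesis u0 : 0 <= u.
Hypothesis ut : u <= t.
Hypothesis tT : t <= T.
Hypothesis oh : orthonormal_on ip J h.

Definition increment i w : K :=
  if i \in J then W (step t (h i)) w - W (step u (h i)) w else 0.

Lemma increment_smeasurable i : smeasurable (increment i).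
Proof.
rewrite /increment; case: (i \in J); last exact: smeasurable_cst.
have mW v x : smeasurable (W (step v x)).
  by apply: W_smeasurable; apply: simple_L2_interval => //; exact: step_simple.
apply: (smeasurable_comp2 (phi := fun a b : K => a - b)) => // f g a b fa gb.
exact: cvgB.
Qed.

Let incr (x : H) (r : R) : H := step t x r - step u x r.

Let incr_simple x : simple_fun (incr x : measurableTypeR R -> H).
Proof. by apply: (simple_fun_comp2 (fun y z => y - z)); exact: step_simple. Qed.

Let incrE x r : 0 < r -> incr x r = if (u <= r) && (r < t) then x else 0.
Proof.
move=> r0; rewrite /incr /step r0/= ltNge; have [ur|ru] := leP u r => /=.
  by rewrite -ltNge subr0; case: ifP.
by rewrite -ltNge (lt_le_trans ru ut) subrr.
Qed.

Let incr_norm x :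
  sre (scalar_integral mu `]0, T[%classic (fun r => ip (incr x r) (incr x r))) = (t - u) * nrm x ^+ 2.
Proof.
have mD : measurable (`]0, T[%classic : set (measurableTypeR R)) by exact: measurable_itv.
have mA : measurable (`[u, t[%classic : set (measurableTypeR R)) by exact: measurable_itv.
rewrite sre_scalar_integral.
have -> : Rintegral mu `]0, T[%classic (fun r => sre (ip (incr x r) (incr x r))) =
    Rintegral mu `]0, T[%classic (fun r => nrm x ^+ 2 * \1_(`[u, t[%classic : set (measurableTypeR R)) r).
  apply: eq_Rintegral => r; rewrite inE/= in_itv/= => /andP[r0 _].
  rewrite inner_self_nrm// sre_of_real incrE// indicE.
  have -> : (r \in (`[u, t[%classic : set (measurableTypeR R))) = (u <= r) && (r < t).
    by apply/idP/idP; rewrite inE/= in_itv.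
  by case: ifP => _; rewrite ?mulr1// nrm0 mulr0 expr0n.
have iI : mu.-integrable `]0, T[%classic (EFin \o (\1_(`[u, t[%classic : set (measurableTypeR R)) : measurableTypeR R -> R)).
  apply: simple_real_integrable => //; split.
    apply: (sub_finite_set _ (finite_set2 0 1)) => _ [r _ <-]; rewrite /= indicE.
    by case: (_ \in _); [right|left].
  move=> v; rewrite -[X in measurable X]setTI; exact: measurable_indic.
rewrite RintegralZl// mulrC; congr (_ * _).
rewrite /Rintegral integral_indic//.
(* [step t x] lives on the open interval (0, t), so the difference of two steps lives on [u, t), cut
   by (0, T). The point 0 is lost when u = 0, and the measure is found by squeezing between the open
   and the half-open interval. *)
have itvE a b : mu [set` Interval (BSide a u) (BSide b t)] = (t - u)%:E.
  rewrite /= lebesgue_measure_itv/= lte_fin; case: ltP => [_|tu]; first by rewrite EFinB.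
  by rewrite (le_anti (_ : t <= u <= t)) ?tu ?ut// subrr.
suff -> : mu (`[u, t[%classic `&` `]0, T[%classic) = (t - u)%:E by [].
apply/le_anti/andP; split.
  rewrite -(itvE true true); apply: le_measure; rewrite ?inE//; exact: measurableI.
rewrite -(itvE false true); apply: le_measure; rewrite ?inE//; first exact: measurableI.
move=> r; rewrite /= !in_itv/= => /andP[ur rt]; split; first by rewrite (ltW ur).
by rewrite (le_lt_trans u0 ur) (lt_le_trans rt tT).
Qed.

(** A linear combination of increments equals almost surely the value of W at a single simple
    function, hence is Gaussian; its total variance is (t - u) ||x||^2 by the covariance identity,
    while the split between real and imaginary part stays unknown. *)
Lemma increment_gaussian m n :
  gaussian_family P n (fun i => if (m + i)%N \in J then t - u else 0) (fun i => increment (m + i)).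
Proof.
split=> [i _|a]; first exact: increment_smeasurable.
pose x := \sum_(i < n) a i *: (if (m + i)%N \in J then h (m + i)%N else 0).
pose a' i : K := if (m + i)%N \in J then a i else 0.
pose Y w := \sum_(i < n) a i * increment (m + i) w.
have xE : x = \sum_(i < n) a' i *: h (m + i)%N.
  by apply: eq_bigr => i _; rewrite /a'; case: ifP => _; rewrite ?scaler0 ?scale0r.
have stepE v r : step v x r = \sum_(i < n) a' i *: step v (h (m + i)%N) r.
  rewrite /step; case: ifP => _; first exact: xE.
  by rewrite big1// => i _; rewrite scaler0.
(* The vanishing combination has one term for the step difference of x, n terms at time t and n
   terms at time u. *)
pose b (k : unit + ('I_n + 'I_n)) : K :=
  match k with inl _ => -1 | inr (inl i) => a' i | inr (inr i) => - a' i end.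
pose f (k : unit + ('I_n + 'I_n)) : R -> H :=
  match k with inl _ => incr x | inr (inl i) => step t (h (m + i)%N) | inr (inr i) => step u (h (m + i)%N) end.
have sf k : simple_fun (f k : measurableTypeR R -> H).
  by case: k => [a0|[i|i]]; [exact: incr_simple|exact: step_simple|exact: step_simple].
have rel r : \sum_k b k *: f k r = 0.
  rewrite !big_sumType/= (big_pred1 tt)/=; last by case.
  under [X in _ + (_ + X)]eq_bigr do rewrite scaleNr.
  by rewrite sumrN -!stepE scaleN1r addNr.
have hae : {ae P, forall w, Y w = W (incr x) w}.
  have := W_linear_relation sf rel; apply: filterS => w.
  rewrite !big_sumType/= (big_pred1 tt)/=; last by case.
  rewrite mulN1r => /eqP; rewrite addrC subr_eq0 => /eqP <-.
  rewrite -big_split/=; apply: eq_bigr => i _; rewrite /increment /a'.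
  by case: ifP => _; [rewrite mulrBr mulNr|rewrite oppr0 !mul0r mulr0 addr0].
have iL2 : L2_interval T (incr x) by exact: simple_L2_interval.
have mY : smeasurable Y.
  have := @smeasurable_sum _ _ _ _ (K^o : normedModType K) 'I_n (index_enum _) xpredT
    (fun i w => a i * increment (m + i) w); apply => i _.
  by apply: (@smeasurableZ _ _ _ _ (K^o : normedModType K)); [exact: smeasurable_cst|exact: increment_smeasurable].
have /smeasurable_scalarP[mY1 mY2] := mY.
have /smeasurable_scalarP[mW1 mW2] := W_smeasurable iL2.
have [s1 [_ c1 t1 v1 _]] := gaussian_char (W_gaussian_sre iL2).
have [s2 [_ c2 t2 v2 _]] := gaussian_char (W_gaussian_sim iL2).
have mcos (g : Om -> R) : measurable_fun setT g -> measurable_fun setT (fun w => cos (g w)).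
  by move=> mg; apply: measurableT_comp => //; apply: continuous_measurable_fun; exact: continuous_cos.
have msin (g : Om -> R) : measurable_fun setT g -> measurable_fun setT (fun w => sin (g w)).
  by move=> mg; apply: measurableT_comp => //; apply: continuous_measurable_fun; exact: continuous_sin.
have transfer (phi : R -> R) (pr : K -> R) : measurable_fun setT (fun w => phi (pr (Y w))) ->
    measurable_fun setT (fun w => phi (pr (W (incr x) w))) ->
    (\int[P]_w (phi (pr (Y w)))%:E = \int[P]_w (phi (1 * pr (W (incr x) w)))%:E)%E.
  move=> h1 h2; under [RHS]eq_integral do rewrite mul1r.
  apply: ae_eq_integral => //; [exact/measurable_EFinP|exact/measurable_EFinP|].
  by apply: filterS hae => w -> _.
exists s1, s2; split.
- have [_ cov _ _] := hW.
  have e1 := f_equal (@sre R s) (cov _ _ iL2 iL2).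
  rewrite incr_norm sre_scalar_integral /x (orthonormal_sum hH oh) mulr_sumr in e1.
  rewrite (eq_bigr (fun i : 'I_n => (t - u) * (if (m + i)%N \in J then nrm (a i) ^+ 2 else 0))); last first.
    by move=> i _; case: ifP => _; rewrite ?mul0r ?mulr0.
  rewrite -e1 /Rintegral.
  have -> : (\int[P]_w (sre (W (incr x) w * sconj (W (incr x) w)))%:E)%E =
     (\int[P]_w (sre (W (incr x) w) ^+ 2)%:E + \int[P]_w (sim (W (incr x) w) ^+ 2)%:E)%E.
    rewrite -meanD//; do ?[exact: measurable_funX|by move=> w; exact: sqr_ge0].
    by apply: eq_integral => w _; rewrite mul_sconj sre_of_real sqr_nrm_scalar.
  by rewrite v1 v2.
- have := c1 1; rewrite expr1n mulr1 => <-; apply: (transfer cos (@sre R s)); exact: mcos.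
- rewrite -[RHS](t1 1); apply: (transfer sin (@sre R s)); exact: msin.
- have := c2 1; rewrite expr1n mulr1 => <-; apply: (transfer cos (@sim R s)); exact: mcos.
- rewrite -[RHS](t2 1); apply: (transfer sin (@sim R s)); exact: msin.
Qed.

End increments.

End cylindrical.

Section sigma_measurability.
Context (R : realType) (s : scalar_kind).
Local Notation K := (scalars R s).

Lemma smeasurable_sigma d (Om : measurableType d) (G : set (set Om)) (V : topologicalType) (f : Om -> V) :
  sigma_algebra setT G -> G `<=` measurable ->
  @smeasurable _ (g_sigma_algebraType G) V f -> smeasurable f.
Proof.
move=> sG mG sf.
exact: (@smeasurable_preimage _ _ Om (g_sigma_algebraType G) V f (fun w => w) (measurable_to_sigma sG mG) sf).
Qed.

Lemma smeasurable_sigma_sub (Om : pointedType) (G G' : set (set Om)) (V : topologicalType) (f : Om -> V) :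
  sigma_algebra setT G -> G `<=` G' ->
  @smeasurable _ (g_sigma_algebraType G) V f -> @smeasurable _ (g_sigma_algebraType G') V f.
Proof.
move=> sG GG' sf.
apply: (@smeasurable_preimage _ _ (g_sigma_algebraType G') (g_sigma_algebraType G) V f (fun w => w) _ sf).
move=> _ B mB; rewrite setTI; apply: sub_sigma_algebra; apply: GG'.
by move: mB; rewrite /measurable/= (sigma_algebra_id sG).
Qed.

Lemma simple_in_sigma (Om : pointedType) (V : Type) (C : set V) (G : set (set Om)) (f : Om -> V) :
  simple_in C G f -> @simple_fun _ (g_sigma_algebraType G) V f.
Proof. by move=> [ff _ mf]; split => // v; exact: sub_sigma_algebra. Qed.

Lemma strongly_measurable_norm (Om : pointedType) (V : normedModType K) (G : set (set Om)) (f : Om -> V) :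
  strongly_measurable (@norm_dist R s V) setT G f -> @smeasurable _ (g_sigma_algebraType G) V f.
Proof.
move=> [_ [u [su uf]]]; exists u; split => [n|x]; first exact: (simple_in_sigma (su n)).
apply/cvg_nrmP; have := uf x; rewrite /norm_dist.
by move/fine_cvgP => [_].
Qed.

Context (H X : completeNormedModType K) (ip : {dot H for @sconj R s}).
Context dG (OmG : measurableType dG) (PG : probability OmG R) (g : nat -> {RV PG >-> R}).
Hypothesis hg : iid_std_gaussian g.
Variables (J : set nat) (h : nat -> H).
Hypothesis oh : orthonormal_on ip J h.

Lemma gamma_norm_ge0 (f : H -> X) : (0 <= gamma_norm ip g f)%E.
Proof.
apply: (@le_trans _ _ (poweR
  (expectation PG (fun w => nrm (\sum_(j < 0) of_real s (g j w) *: f (h j))%R ^+ 2)%R) 2^-1)).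
  exact: poweR_ge0.
by apply: ereal_sup_ubound; exists 0%N, (fun j : 'I_0 => h j); split => // -[].
Qed.

Lemma nrm_le_gamma_norm (f : H -> X) i : i \in J -> ((nrm (f (h i)))%:E <= gamma_norm ip g f)%E.
Proof.
move=> iJ; have := gamma_norm_ge0 f; case e : (gamma_norm ip g f) => [c||]//; rewrite ?leey//.
rewrite lee_fin => c0.
have := gsum_gamma hg i 1 oh c0 (_ : (gamma_norm ip g f <= c%:E)%E); rewrite e => /(_ (lexx _)).
under eq_integral do rewrite /gsum big_ord1 addn0 iJ nrmZ nrm_of_real exprMn (real_normK (num_real _)) mulrC.
rewrite meanZ ?sqr_ge0//; last 2 first.
- by apply: measurable_funX; exact: measurable_funP.
- by move=> w; exact: sqr_ge0.
have hm (B : set R) : measurable B -> PG (g 0%N @^-1` B) = normal_prob 0 1 B by exact: hg.1.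
rewrite (@integral_law _ _ _ PG (g 0%N) (normal_prob 0%R 1%R) (fun y => y ^+ 2)%R)//; last first.
  by move=> y; exact: sqr_ge0.
rewrite integral_normal_sqr ?oner_eq0// expr1n mule1 !lee_fin.
by rewrite ler_pXn2r ?nnegrE ?nrm_ge0.
Qed.

Lemma strongly_measurable_gamma (Om : pointedType) (G : set (set Om)) (Q : Om -> H -> X) i :
  strongly_measurable (gamma_dist ip g) (gamma_space ip g) G Q ->
  @smeasurable _ (g_sigma_algebraType G) X (fun w => masked J h (Q w) i).
Proof.
move=> [_ [u [su uf]]]; rewrite /masked; have [iJ|iJ] := boolP (i \in J); last exact: smeasurable_cst.
exists (fun n w => u n w (h i)); split => [n|x].
  exact: (simple_fun_comp (fun f : H -> X => f (h i)) (simple_in_sigma (su n))).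
apply/cvg_nrmP.
have ux := uf x.
suff : ((nrm (u n x (h i) - Q x (h i)))%:E @[n --> \oo] --> 0)%E by move/fine_cvgP => [].
apply: (@squeeze_cvge _ _ _ _ (fun=> 0%E) _ (fun n => gamma_dist ip g (u n x) (Q x))) => //; last exact: cvg_cst.
by apply: nearW => n; rewrite lee_fin nrm_ge0/=; exact: (nrm_le_gamma_norm (fun y => u n x y - Q x y)).
Qed.

End sigma_measurability.

(** * Stochastic increments *)

Section blocks.
Context (R : realType) (s : scalar_kind).
Local Notation K := (scalars R s).
Context (X : completeNormedModType K).
Context d (Om : measurableType d) (P : probability Om R).
Variables (G1 G2 : set (set Om)).
Hypothesis sG1 : sigma_algebra setT G1.
Hypothesis sG2 : sigma_algebra setT G2.
Hypothesis mG1 : G1 `<=` measurable.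
Hypothesis mG2 : G2 `<=` measurable.
Hypothesis ind : independent_classes P G1 G2.
Local Notation T1 := (g_sigma_algebraType G1).
Local Notation T2 := (g_sigma_algebraType G2).
Variables (z : nat -> Om -> K) (y : nat -> Om -> X).
Hypothesis mz : forall l, @smeasurable _ T2 K (z l).
Hypothesis my : forall l, @smeasurable _ T1 X (y l).
Local Open Scope ereal_scope.

(* w carries the coefficients known at the beginning of the step and t the
   increments of the Brownian motion. *)
Definition block m (w t : Om) : X := (\sum_(l < m) z l t *: y l w)%R.

Let mzy l : @smeasurable _ (T1 * T2)%type X (fun u => z l u.2 *: y l u.1)%R.
Proof.
apply: smeasurableZ.
  exact: (@smeasurable_preimage _ _ (T1 * T2)%type T2 K (z l) snd measurable_snd (mz l)).
exact: (@smeasurable_preimage _ _ (T1 * T2)%type T1 X (y l) fst measurable_fst (my l)).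
Qed.

Lemma decoupled_osc :
  \int[P]_w osc (fun l => z l w *: y l w)%R = \int[P]_w \int[P]_t osc (fun l => z l t *: y l w)%R.
Proof.
apply: (decoupling sG1 sG2 mG1 mG2 ind (F := fun u => osc (fun l => z l u.2 *: y l u.1)%R)).
  exact: (measurable_osc mzy).
by move=> u; exact: osc_ge0.
Qed.

Section prefix.
Variables (j m : nat) (e : nat -> Om -> X) (Psi : (nat -> X) -> R).
Hypothesis me : forall i, (i < j)%N -> @smeasurable _ T1 X (e i).
Hypothesis cPsi : prefix_continuous j.+1 Psi.
Hypothesis Psi0 : forall u, (0 <= Psi u)%R.

(** The past steps followed by the current one; repeating x beyond index j is invisible to
    functionals of the first j + 1 coordinates. *)
Definition extend w (x : X) : nat -> X := fun i => if (i < j)%N then e i w else x.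

Let mblock (eps : K) : @measurable_fun _ _ (T1 * T2)%type _ setT
  (fun u => Psi (extend u.1 (eps *: block m u.1 u.2)%R)).
Proof.
apply/smeasurable_realP.
apply: (smeasurable_prefix (D := fun i (u : T1 * T2) => extend u.1 (eps *: block m u.1 u.2)%R i) cPsi) => i _.
rewrite /extend; have [ij|ij] := ltnP i j.
  exact: (@smeasurable_preimage _ _ (T1 * T2)%type T1 X (e i) fst measurable_fst (me ij)).
apply: smeasurableZ; first exact: smeasurable_cst.
by apply: smeasurable_sum => l _; exact: mzy.
Qed.

(** The scalar eps treats a block and its opposite at once. *)
Lemma decoupled_block (eps : K) :
  \int[P]_w (Psi (extend w (eps *: block m w w)%R))%:E =
  \int[P]_w \int[P]_t (Psi (extend w (eps *: block m w t)%R))%:E.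
Proof.
apply: (decoupling sG1 sG2 mG1 mG2 ind (F := fun u => (Psi (extend u.1 (eps *: block m u.1 u.2)%R))%:E)).
  by apply/measurable_EFinP; exact: mblock.
by move=> u; rewrite lee_fin.
Qed.

Lemma measurable_decoupled_block :
  measurable_fun setT (fun w : Om => \int[P]_t (Psi (extend w (block m w t)))%:E).
Proof.
rewrite (_ : (fun w => _) = fun w : Om => \int[P]_t (Psi (extend w (1 *: block m w t)%R))%:E); last first.
  by apply/funext => w; apply: eq_integral => t _; rewrite scale1r.
apply: (measurable_section P sG1 sG2 mG1 mG2 (F := fun u => (Psi (extend u.1 (1 *: block m u.1 u.2)%R))%:E)).
  by apply/measurable_EFinP; exact: mblock.
by move=> u; rewrite lee_fin.
Qed.

(** After decoupling, the coefficients and the past are frozen, and the inner integral is a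
    functional of a Gaussian family, invariant under change of sign. *)
Lemma symmetric_block (q : nat -> R) : gaussian_family P m q z ->
  \int[P]_w (Psi (extend w (block m w w)))%:E = \int[P]_w (Psi (extend w (- block m w w)%R))%:E.
Proof.
move=> hz.
have -> : \int[P]_w (Psi (extend w (block m w w)))%:E = \int[P]_w (Psi (extend w (1 *: block m w w)%R))%:E.
  by apply: eq_integral => w _; rewrite scale1r.
have -> : \int[P]_w (Psi (extend w (- block m w w)%R))%:E = \int[P]_w (Psi (extend w (-1 *: block m w w)%R))%:E.
  by apply: eq_integral => w _; rewrite scaleN1r.
rewrite !decoupled_block; apply: eq_integral => w _.
pose F (u : nat -> K) := Psi (extend w (\sum_(l < m) u l *: y l w)%R).
have cF : prefix_continuous m F.
  move=> u v uv; apply: cPsi => i _; rewrite /extend; case: ifP => _; first exact: cvg_cst.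
  by apply: cvg_sumr => l; apply: cvgZ; [exact: uv|exact: cvg_cst].
transitivity (\int[P]_t (F (z ^~ t))%:E).
  by apply: eq_integral => t _; rewrite scale1r.
rewrite (gaussian_family_opp hz cF (fun u => Psi0 _)).
apply: eq_integral => t _; rewrite scaleN1r /F /block -sumrN; congr (Psi (extend w _))%:E.
by apply: eq_bigr => l _; rewrite scaleNr.
Qed.

End prefix.
End blocks.

Section generated.
Context (R : realType) (s : scalar_kind).
Local Notation K := (scalars R s).

Lemma sigma_generated_algebra (Om : Type) (I : Type) (Y : I -> Om -> K) :
  sigma_algebra setT (sigma_generated Y).
Proof. exact: smallest_sigma_algebra. Qed.

Lemma sigma_generated_measurable d (Om : measurableType d) (I : Type) (Y : I -> Om -> K) :
  (forall i, smeasurable (Y i)) -> sigma_generated Y `<=` measurable.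
Proof.
move=> mY; apply: smallest_sub; first exact: sigma_algebra_measurable.
move=> A [i [B [mB]]]; have /smeasurable_scalarP[h1 h2] := mY i.
by move=> [->|->]; rewrite -[X in measurable X]setTI; [exact: h1|exact: h2].
Qed.

Lemma smeasurable_generated (Om : pointedType) (I : Type) (Y : I -> Om -> K) i :
  @smeasurable _ (g_sigma_algebraType (sigma_generated Y)) K (Y i).
Proof.
apply/smeasurable_scalarP; split => _ B mB; rewrite setTI;
  apply: sub_sigma_algebra; apply: sub_sigma_algebra; exists i, B; split => //; [by left|by right].
Qed.

Context (H : completeNormedModType K) (ip : {dot H for @sconj R s}).
Context d (Om : measurableType d) (P : probability Om R) (T : R) (F : R -> set (set Om)).
Context (W : (R -> H) -> Om -> K).
Hypothesis hW : cylindrical_BM ip P T F W.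

Lemma increment_generated u t J h i :
  @smeasurable _ (g_sigma_algebraType (sigma_generated (fun x w => W (step t x) w - W (step u x) w))) K
    (increment W u t J h i).
Proof.
rewrite (_ : increment W u t J h i = fun w => if i \in J then W (step t (h i)) w - W (step u (h i)) w else 0)//.
have [iJ|iJ] := boolP (i \in J); last exact: smeasurable_cst.
exact: (smeasurable_generated (fun x w => W (step t x) w - W (step u x) w) (h i)).
Qed.

Lemma increments_measurable u t :
  sigma_generated (fun x w => W (step t x) w - W (step u x) w) `<=` measurable.
Proof.
apply: sigma_generated_measurable => x.
have := increment_smeasurable hW u t setT (fun=> x) 0%N.
by rewrite /increment in_setT.
Qed.

Lemma step_adapted (hF : filtration T F) t x : 0 <= t <= T ->
  exists2 Y : Om -> K, @smeasurable _ (g_sigma_algebraType (F t)) K Y & {ae P, forall w, W (step t x) w = Y w}.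
Proof.
move=> tT; have [_ _ adapted _] := hW; have [Y [sY ae]] := adapted t x tT.
by exists Y => //; exact: (strongly_measurable_norm (V := (K^o : normedModType K)) sY).
Qed.

(** Adaptedness of W holds only up to null sets; countably many basis indices allow one exceptional
    set for all of them. *)
Lemma increment_adapted (hF : filtration T F) u t J (h : nat -> H) : 0 <= u -> u <= t -> t <= T ->
  exists2 Y : nat -> Om -> K, (forall i, @smeasurable _ (g_sigma_algebraType (F t)) K (Y i)) &
    {ae P, forall w, forall i, increment W u t J h i w = Y i w}.
Proof.
move=> u0 ut tT.
have tT' : 0 <= t <= T by rewrite (le_trans u0 ut).
have uT' : 0 <= u <= T by rewrite u0 (le_trans ut tT).
have [_ mF subF] := hF; have [sF _ _] := hF.
have ex i : exists Y : Om -> K, @smeasurable _ (g_sigma_algebraType (F t)) K Y /\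
    {ae P, forall w, increment W u t J h i w = Y w}.
  rewrite /increment; have [iJ|iJ] := boolP (i \in J); last first.
    by exists (fun=> 0); split; [exact: smeasurable_cst|exact: aeW].
  have [Yt mYt aet] := step_adapted hF (h i) tT'.
  have [Yu mYu aeu] := step_adapted hF (h i) uT'.
  exists (fun w => Yt w - Yu w); split.
    apply: (@smeasurableD _ _ _ (g_sigma_algebraType (F t)) (K^o : normedModType K)) => //.
    apply: (@smeasurableN _ _ _ (g_sigma_algebraType (F t)) (K^o : normedModType K)) => //.
    exact: (smeasurable_sigma_sub (sF u uT') (subF u t u0 ut tT)).
  by apply: filterS2 aet aeu => w -> ->.
have [Y hY] := choice ex; exists Y => [i|]; first exact: (hY i).1.
by apply: ae_foralln => i; exact: (hY i).2.
Qed.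

End generated.

Section operators.
Context (R : realType) (s : scalar_kind).
Local Notation K := (scalars R s).

Lemma op_norm_contractive (X : normedModType K) (f : {linear X -> X}) (x : X) :
  (op_norm f <= 1%:E)%E -> nrm (f x) <= nrm x.
Proof.
move=> f1; have [->|x0] := eqVneq x 0; first by rewrite linear0 nrm0.
have nx : 0 < nrm x.
  by rewrite lt_neqAle nrm_ge0 andbT eq_sym; rewrite nrm_eq0.
pose y := of_real s (nrm x)^-1 *: x.
have ny z : nrm (of_real s (nrm x)^-1 *: z) = (nrm x)^-1 * nrm z.
  by rewrite nrmZ nrm_of_real ger0_norm// invr_ge0 ltW.
have : ((nrm (f y))%:E <= 1%:E)%E.
  apply: le_trans f1; apply: ereal_sup_ubound; exists y => //.
  by rewrite /= /y ny mulVf// gt_eqF.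
by rewrite lee_fin /y linearZ/= ny mulrC ler_pdivrMr// mul1r.
Qed.

Lemma transported_iter (X : completeNormedModType K) (A : {additive X -> X}) (u : nat -> X) j :
  transported A u j = \sum_(i < j) iter (j - i) A (u i).
Proof.
elim: j => [|j IH]; first by rewrite big_ord0.
rewrite big_ord_recr/= subSnn/= IH raddfD raddf_sum; congr (_ + _).
by apply: eq_bigr => i _; rewrite subSn// ltnW.
Qed.

Lemma Lnorm_moment d (Om : measurableType d) (P : probability Om R) (q : R) (f : Om -> \bar R) (a : R) :
  0 < q -> (forall w, 0 <= f w)%E -> 0 <= a -> (Lnorm P q%:E f <= a%:E)%E ->
  (\int[P]_w poweR (f w) q <= (a `^ q)%:E)%E.
Proof.
move=> q0 f0 a0; rewrite unlock /Lnorm.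
have -> : (\int[P]_x (`|f x| `^ q) = \int[P]_w poweR (f w) q)%E.
  by apply: eq_integral => w _; rewrite gee0_abs.
have I0 : (0 <= \int[P]_w poweR (f w) q)%E by apply: integral_ge0 => w _; exact: poweR_ge0.
move: I0; case: (\int[P]_w _)%E => [x|_|//]; last first.
  by rewrite poweRyr ?leye_eq// gt_eqF// invr_gt0.
rewrite lee_fin => x0; rewrite poweR_EFin !lee_fin => h.
rewrite -[leLHS](powRr1 x0) -(mulVf (lt0r_neq0 q0)) powRrM.
by apply: ge0_ler_powR; rewrite ?nnegrE ?powR_ge0// ltW.
Qed.

End operators.

Section stochastic_step.
Context (R : realType) (s : scalar_kind).
Local Notation K := (scalars R s).
Context (X H : completeNormedModType K) (ip : {dot H for @sconj R s}).
Context dG (OmG : measurableType dG) (PG : probability OmG R) (g : nat -> {RV PG >-> R}).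
Hypothesis hg : iid_std_gaussian g.
Variables (D : R) (J : set nat) (h : nat -> H).
Hypothesis D1 : 1 <= D.
Hypothesis hX : smooth2 X D.
Hypothesis hH : hilbert_inner ip.
Hypothesis oh : orthonormal_on ip J h.
Context d (Om : measurableType d) (P : probability Om R) (T : R) (F : R -> set (set Om)).
Context (W : (R -> H) -> Om -> K).
Hypothesis hF : filtration T F.
Hypothesis hW : cylindrical_BM ip P T F W.
Variables (u t : R) (Q0 : Om -> H -> X).
Hypothesis u0 : 0 <= u.
Hypothesis ut : u < t.
Hypothesis tT : t <= T.
Hypothesis mQ0 : strongly_measurable (gamma_dist ip g) (gamma_space ip g) (F u) Q0.
Local Open Scope ereal_scope.

Let z := increment W u t J h.
Let y l w := masked J h (Q0 w) l.
Let G2 := sigma_generated (fun x w => W (step t x) w - W (step u x) w)%R.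

Let ule : (u <= t)%R. Proof. exact: ltW. Qed.
Let uT : (0 <= u <= T)%R. Proof. by rewrite u0 (le_trans ule tT). Qed.
Let sG1 : sigma_algebra setT (F u). Proof. by have [sF _ _] := hF; exact: sF. Qed.
Let mG1 : F u `<=` measurable. Proof. by have [_ mF _] := hF; exact: mF. Qed.
Let sG2 : sigma_algebra setT G2. Proof. exact: sigma_generated_algebra. Qed.
Let mG2 : G2 `<=` measurable. Proof. exact: (increments_measurable hW). Qed.
Let ind : independent_classes P (F u) G2. Proof. by have [_ _ _ hi] := hW; exact: hi. Qed.
Let mz l : @smeasurable _ (g_sigma_algebraType G2) K (z l).
Proof. exact: increment_generated. Qed.
Let my l : @smeasurable _ (g_sigma_algebraType (F u)) X (y l).
Proof. exact: (strongly_measurable_gamma hg oh l mQ0). Qed.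
Let mz' l : smeasurable (z l). Proof. exact: (smeasurable_sigma sG2 mG2). Qed.
Let my' l : smeasurable (y l). Proof. exact: (smeasurable_sigma sG1 mG1). Qed.
Let tu0 : (0 < t - u)%R. Proof. by rewrite subr_gt0. Qed.

Definition step_block m w : X := block z y m w w.

Lemma step_block_smeasurable m : smeasurable (step_block m).
Proof. by apply: smeasurable_sum => l _; exact: smeasurableZ. Qed.

(** By decoupling, the mean oscillation is an iterated integral whose inner part, with the operator
    frozen in the gamma space, vanishes by [gaussian_series_osc]. *)
Lemma step_block_cvg :
  {ae P, forall w, step_block m w @[m --> \oo] --> op_increment W J h (Q0 w) u t w}.
Proof.
have I0 : \int[P]_w osc (fun l => z l w *: y l w)%R = 0.
  rewrite (decoupled_osc sG1 sG2 mG1 mG2 ind mz my) integral0_eq// => w _.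
  apply: (gaussian_series_osc hg D1 hX hH oh (ltW tu0)).
    exact: (increment_gaussian hH hW u0 ule tT oh).
  by have [+ _] := mQ0; apply; exists w.
have mo : measurable_fun setT (fun w => osc (fun l => z l w *: y l w)%R).
  by apply: measurable_osc => l; exact: smeasurableZ.
have : {ae P, forall w, setT w -> osc (fun l => z l w *: y l w)%R = 0}.
  apply/(ae_eq_integral_abs P measurableT mo); rewrite -I0.
  by apply: eq_integral => w _; rewrite gee0_abs// osc_ge0.
apply: filterS => w /(_ Logic.I) /osc_eq0_cvg.
rewrite /step_block /block /op_increment.
rewrite (_ : (fun m : nat => (\sum_(n < m | (n : nat) \in J) _)%R) = (fun m => \sum_(l < m) z l w *: y l w)%R)//.
apply/funext => m; rewrite big_mkcond/=; apply: eq_bigr => i _.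
by rewrite /y /z /masked /increment; case: ifP => _; rewrite ?scaler0.
Qed.

(** With the operator frozen, its gamma-norm r bounds the second moment of the truncated Gaussian
    sum, so the inner integral is at most a constant times r^p; this holds for every truncation m
    with the same constant. *)
Lemma step_block_moment (p l : R) (k : nat) (Q : Om -> H -> X) m :
  (1 <= p)%R -> (p <= (2 ^ k.+1)%:R)%R -> (0 <= l)%R -> {ae P, forall w, Q w = Q0 w} ->
  Lnorm P p%:E (fun w => gamma_norm ip g (Q w)) <= l%:E ->
  \int[P]_w (nrm (step_block m w) `^ p)%:E <=
  ((4 * 2 `^ p * (1 + kahane_cst R k)) * (Num.sqrt (t - u) * l) `^ p)%:E.
Proof.
move=> p1 pk l0 QE Ql; have p0 : (0 < p)%R by exact: lt_le_trans p1.
set Cp := (4 * 2 `^ p * (1 + kahane_cst R k))%R.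
have Cp0 : (0 < Cp)%R.
  by rewrite !mulr_gt0 ?powR_gt0// ltr_wpDr// kahane_cst_ge0.
have hz : gaussian_family P m (fun i => if i \in J then t - u else 0)%R z.
  exact: (increment_gaussian hH hW u0 ule tT oh 0 m).
pose Psi (v : nat -> X) : R := (nrm (v 0%N) `^ p)%R.
have cPsi : prefix_continuous 1 Psi.
  move=> v a va; apply: cvg_powR; rewrite ?nrm_ge0//; first by move=> n; exact: nrm_ge0.
  by apply: cvg_nrm; exact: va.
have Psi0 v : (0 <= Psi v)%R by exact: powR_ge0.
pose e0 (i : nat) (w : Om) : X := 0%R.
have me0 i : (i < 0)%N -> @smeasurable _ (g_sigma_algebraType (F u)) X (e0 i) by [].
pose c : R := (Cp * Num.sqrt (t - u) `^ p)%R.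
have c0 : (0 < c)%R by rewrite mulr_gt0// powR_gt0// sqrtr_gt0.
pose I w := \int[P]_r (nrm (block z y m w r) `^ p)%:E.
have IE : \int[P]_w (nrm (step_block m w) `^ p)%:E = \int[P]_w I w.
  have := decoupled_block sG1 sG2 mG1 mG2 ind mz my m me0 cPsi Psi0 1%R.
  rewrite /Psi /extend/= => E; rewrite /I.
  transitivity (\int[P]_w (nrm (1 *: block z y m w w)%R `^ p)%:E).
    by apply: eq_integral => w _; rewrite scale1r.
  rewrite E; apply: eq_integral => w _; apply: eq_integral => r _.
  by rewrite scale1r.
have mI : measurable_fun setT I.
  exact: (measurable_decoupled_block P sG1 sG2 mG1 mG2 mz my m me0 cPsi Psi0).
have I0 w : 0 <= I w by apply: mean_ge0 => r; exact: powR_ge0.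
(* The constant c is kept on the side of I, which is measurable, so that it can be taken out of the
   integral there. *)
have Ile w : (c^-1)%:E * I w <= poweR (gamma_norm ip g (Q0 w)) p.
  have := gamma_norm_ge0 ip g h (Q0 w).
  case E : (gamma_norm ip g (Q0 w)) => [r| |]//; last first.
    by rewrite poweRyr ?leey// gt_eqF.
  rewrite lee_fin => r0; rewrite poweR_EFin.
  have tau : \int[PG]_w' (nrm (gsum g (fun i => y i w) m w') ^+ 2)%:E <= (r ^+ 2)%:E.
    by apply: (gsum_gamma hg 0 m oh r0); rewrite E.
  have Ir : I w <= (Cp * (Num.sqrt (t - u) * r) `^ p)%:E.
    have q0 i : (0 <= (if i \in J then t - u else 0) :> R)%R by case: ifP => // _; exact: ltW.
    apply: (family_moment hg q0 hz _ r0 tau p1 pk) => i _.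
    by rewrite /y /masked; case: ifP => _; [left|right].
  apply: (le_trans (lee_wpmul2l _ Ir)); first by rewrite lee_fin invr_ge0 ltW.
  by rewrite -EFinM lee_fin powRM ?sqrtr_ge0// (mulrA Cp) -/c mulKf// gt_eqF.
have mean : \int[P]_w ((c^-1)%:E * I w) <= (l `^ p)%:E.
  apply: le_trans (Lnorm_moment p0 _ l0 Ql); last first.
    by move=> w; exact: (gamma_norm_ge0 ip g h).
  apply: integral_nonmeasurable_ge.
  - by move=> w; rewrite mule_ge0// lee_fin invr_ge0 ltW.
  - by move=> w; exact: poweR_ge0.
  - exact: measurable_funeM.
  - by apply: filterS QE => w ->; exact: Ile.
rewrite ge0_integralZl// in mean; last by rewrite lee_fin invr_ge0 ltW.
rewrite IE (le_trans _ (_ : c%:E * ((c^-1)%:E * \int[P]_w I w) <= _))//.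
  by rewrite muleA -EFinM mulfV ?gt_eqF// mul1e.
apply: (le_trans (lee_wpmul2l _ mean)); first by rewrite lee_fin ltW.
by rewrite -EFinM lee_fin powRM ?sqrtr_ge0// mulrA.
Qed.

Lemma step_block_symmetric (j m : nat) (e : nat -> Om -> X) (Psi : (nat -> X) -> R) :
  (forall i, (i < j)%N -> @smeasurable _ (g_sigma_algebraType (F u)) X (e i)) ->
  prefix_continuous j.+1 Psi -> (forall v, 0 <= Psi v)%R ->
  \int[P]_w (Psi (extend j e w (step_block m w)))%:E =
  \int[P]_w (Psi (extend j e w (- step_block m w)%R))%:E.
Proof.
move=> me cPsi Psi0.
apply: (symmetric_block sG1 sG2 mG1 mG2 ind mz my me cPsi Psi0).
exact: (increment_gaussian hH hW u0 ule tT oh 0 m).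
Qed.

Lemma step_block_adapted m :
  exists2 e : Om -> X, @smeasurable _ (g_sigma_algebraType (F t)) X e &
    {ae P, forall w, step_block m w = e w}.
Proof.
have [Y mY YE] := increment_adapted hW hF J h u0 ule tT.
have [_ _ subF] := hF.
exists (fun w => \sum_(l < m) Y l w *: y l w)%R; last first.
  by apply: filterS YE => w YE; apply: eq_bigr => l _; rewrite -YE.
apply: (@smeasurable_sum _ _ _ (g_sigma_algebraType (F t))) => l _.
apply: (@smeasurableZ _ _ _ (g_sigma_algebraType (F t))) => //.
exact: (smeasurable_sigma_sub sG1 (subF u t u0 ule tT)).
Qed.

End stochastic_step.

(** * The stochastic convolution and the removal of the truncation *)

Section stochastic_convolution.
Context (R : realType) (s : scalar_kind).
Local Notation K := (scalars R s).
Context (X H : completeNormedModType K) (ip : {dot H for @sconj R s}).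
Context dG (OmG : measurableType dG) (PG : probability OmG R) (g : nat -> {RV PG >-> R}).
Hypothesis hg : iid_std_gaussian g.
Variables (D : R) (J : set nat) (h : nat -> H).
Hypothesis D1 : 1 <= D.
Hypothesis hX : smooth2 X D.
Hypothesis hH : hilbert_inner ip.
Hypothesis oh : orthonormal_on ip J h.
Context d (Om : measurableType d) (P : probability Om R) (T : R) (F : R -> set (set Om)).
Context (W : (R -> H) -> Om -> K).
Hypothesis hF : filtration T F.
Hypothesis hW : cylindrical_BM ip P T F W.
Variables (N : nat) (tau : nat -> R) (Q Q0 : nat -> Om -> H -> X).
Hypothesis tau0 : forall i, 0 <= tau i.
Hypothesis tau_lt : forall i, tau i < tau i.+1.
Hypothesis tauT : forall i, (i < N)%N -> tau i.+1 <= T.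
Hypothesis mQ0 : forall i, (i < N)%N ->
  strongly_measurable (gamma_dist ip g) (gamma_space ip g) (F (tau i)) (Q0 i).
Hypothesis Q0E : forall i, (i < N)%N -> {ae P, forall w, Q i w = Q0 i w}.
Local Open Scope ereal_scope.

Let S m i := step_block J h W (tau i) (tau i.+1) (Q0 i) m.

Let mS m i : (i < N)%N -> smeasurable (S m i).
Proof.
move=> iN.
exact: (step_block_smeasurable hg oh hF hW (tau0 i) (tau_lt i) (tauT iN) (mQ0 iN)).
Qed.

Let tau_le i j : (i <= j)%N -> (tau i <= tau j)%R.
Proof.
by move=> /subnK <-; elim: (j - i)%N => // n IH; rewrite addSn (le_trans IH)// ltW.
Qed.

(** Independence concerns genuinely adapted variables, whereas the earlier blocks are adapted only
    almost surely. They are exchanged for adapted versions, the current block is reflected, and the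
    exchange is undone. *)
Lemma blocks_symmetric m : symmetric_steps P (S m) (@GRing.opp X) N.
Proof.
split=> [i|j jN Psi cPsi Psi0]; first exact: mS.
have [sF _ subF] := hF.
have ex i : exists e : Om -> X, (i < N)%N -> @smeasurable _ (g_sigma_algebraType (F (tau i.+1))) X e /\
    {ae P, forall w, S m i w = e w}.
  have [iN|iN] := ltnP i N; last by exists (S m i).
  have [e me eE] := step_block_adapted hg oh hF hW (tau0 i) (tau_lt i) (tauT iN) (mQ0 iN) m.
  by exists e => _; split.
have [e he] := choice ex.
have tauiT i : (i <= N)%N -> (0 < i)%N -> (0 <= tau i <= T)%R.
  by case: i => // i iN _; rewrite tau0 tauT.
have me i : (i < j)%N -> @smeasurable _ (g_sigma_algebraType (F (tau j))) X (e i).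
  move=> ij; have iN := ltn_trans ij jN.
  have jT : (tau j <= T)%R by rewrite (le_trans (ltW (tau_lt j)))// tauT.
  apply: (smeasurable_sigma_sub _ _ (he i iN).1); last exact: (subF _ _ (tau0 _) (tau_le ij)).
  by apply: sF; rewrite tau0 tauT.
have sFj : sigma_algebra setT (F (tau j)) by apply: sF; rewrite tau0 (le_trans (ltW (tau_lt j)))// tauT.
have mFj : F (tau j) `<=` measurable.
  by have [_ mF _] := hF; apply: mF; rewrite tau0 (le_trans (ltW (tau_lt j)))// tauT.
have mext (x : Om -> X) : smeasurable x -> forall i, (i < j.+1)%N -> smeasurable (fun w => extend j e w (x w) i).
  move=> mx i _; rewrite /extend; have [ij|ij] := ltnP i j => //.
  exact: (smeasurable_sigma sFj mFj (me i ij)).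
have ae : {ae P, forall w, forall i, (i < N)%N -> S m i w = e i w}.
  apply: ae_foralln => i; have [iN|iN] := ltnP i N; last exact: aeW.
  by apply: filterS (he i iN).2 => w ->.
(* The exchange under the integral: earlier coordinates become the versions e_i, the current one
   stays as it is. *)
have key (x : Om -> X) (u : Om -> nat -> X) : smeasurable x ->
    measurable_fun setT (fun w => Psi (u w)) ->
    (forall w i, (i < j)%N -> u w i = S m i w) -> (forall w, u w j = x w) ->
    \int[P]_w (Psi (u w))%:E = \int[P]_w (Psi (extend j e w (x w)))%:E.
  move=> mx mu uS ux; apply: ae_eq_integral => //; first exact/measurable_EFinP.
    apply/measurable_EFinP/smeasurable_realP.
    exact: (smeasurable_prefix (D := fun i w => extend j e w (x w) i) cPsi (mext x mx)).
  apply: filterS ae => w Se _; congr EFin; apply: (prefix_continuous_eq cPsi) => i.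
  rewrite ltnS leq_eqVlt /extend => /predU1P[->|ij]; first by rewrite ltnn ux.
  by rewrite ij uS// Se// (ltn_trans ij).
have mSj := mS m jN.
rewrite (key (S m j))//; last first.
  apply/smeasurable_realP; apply: (smeasurable_prefix cPsi) => i ij.
  by apply: mS; exact: leq_trans jN.
rewrite (step_block_symmetric hg hH oh hF hW (tau0 j) (tau_lt j) (tauT jN) (mQ0 jN) m me cPsi Psi0).
symmetry; apply: (key (fun w => - S m j w)%R) => [||w i ij|w].
- exact: smeasurableN.
- apply/smeasurable_realP.
  apply: (smeasurable_prefix (D := fun i w => flip (@GRing.opp X) j (S m ^~ w) i) cPsi) => i ij.
  rewrite /flip; case: eqP => _; [apply: smeasurableN|]; apply: mS; exact: leq_trans jN.
- by rewrite /flip ltn_eqF.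
- by rewrite /flip eqxx.
Qed.

(** Burkholder's inequality enters as a hypothesis with a given C, so that C remains independent of
    the data. The bound is uniform in the truncation m and passes to the limit. *)
Lemma convolution_moment (p : R) (C : R) (k : nat) (A : {additive X -> X}) (l : nat -> R) :
  (1 <= p)%R -> (p <= (2 ^ k.+1)%:R)%R ->
  (forall x, nrm (A x) <= nrm x)%R ->
  (forall i, 0 <= l i)%R ->
  (forall i, (i < N)%N -> Lnorm P p%:E (fun w => gamma_norm ip g (Q i w)) <= (l i)%:E) ->
  (forall (S : nat -> Om -> X) (b : nat -> R),
    symmetric_steps P S (@GRing.opp X) N -> (forall j, 0 <= b j)%R ->
    (forall j, (j < N)%N -> \int[P]_w (nrm (S j w) `^ p)%:E <= (b j `^ p)%:E) ->
    \int[P]_w ((\big[Num.max/0%R]_(j < N.+1) nrm (transported A (S ^~ w) j)) `^ p)%:E <=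
    (C * (\sum_(j < N) b j ^+ 2) `^ (p / 2))%:E) ->
  \int[P]_w ((\big[Num.max/0%R]_(j < N.+1)
     nrm (transported A (fun i => op_increment W J h (Q i w) (tau i) (tau i.+1) w) j)) `^ p)%:E <=
  (C * (\sum_(j < N) ((4 * 2 `^ p * (1 + kahane_cst R k)) `^ p^-1 *
     (Num.sqrt (tau j.+1 - tau j) * l j)) ^+ 2) `^ (p / 2))%:E.
Proof.
move=> p1 pk hA l0 Ql BDG; have p0 : (0 < p)%R by exact: lt_le_trans p1.
set Cp := (4 * 2 `^ p * (1 + kahane_cst R k))%R.
have Cp0 : (0 <= Cp)%R by rewrite !mulr_ge0 ?powR_ge0// addr_ge0// kahane_cst_ge0.
set rhs := (C * _)%R.
pose M (u : nat -> X) : R := \big[Num.max/0%R]_(j < N.+1) nrm (transported A u j).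
have cM : prefix_continuous N M.
  apply: (prefix_continuous_bigmax (F := fun j u => nrm (transported A u j))) => j jN u v uv.
  apply: cvg_nrm; apply: (transported_continuous hA) => i ij; apply: uv.
  exact: leq_trans ij jN.
have M0 u : (0 <= M u)%R by exact: bigmax_ge_id.
pose V w i := op_increment W J h (Q i w) (tau i) (tau i.+1) w.
pose f m w := (M (S m ^~ w) `^ p)%:E.
have mf m : measurable_fun setT (f m).
  apply/measurable_EFinP; apply: (measurableT_comp (measurable_powR _)).
  apply/smeasurable_realP; apply: (smeasurable_prefix cM) => i iN; exact: mS.
(* The left-hand side is only almost surely a limit of measurable functions; it is placed below
   their lower limit, which is measurable and to which Fatou's lemma applies. *)
have fV : {ae P, forall w, (M (V w) `^ p)%:E <= limn_einf (f ^~ w)}.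
  have : {ae P, forall w, forall i, (i < N)%N -> S m i w @[m --> \oo] --> V w i}.
    apply: ae_foralln => i; have [iN|iN] := ltnP i N; last exact: aeW.
    have := step_block_cvg hg D1 hX hH oh hF hW (tau0 i) (tau_lt i) (tauT iN) (mQ0 iN).
    by apply: filterS2 (Q0E iN) => w; rewrite /V => ->.
  apply: filterS => w SV.
  have fw : f m w @[m --> \oo] --> (M (V w) `^ p)%:E.
    apply: cvg_EFin; first exact: nearW.
    by apply: cvg_powR => //; exact: cM.
  by rewrite is_cvg_limn_einfE ?(cvg_lim _ fw)//; apply/cvg_ex; exists (M (V w) `^ p)%:E.
have f0 m w : 0 <= f m w by rewrite lee_fin powR_ge0.
have le m : \int[P]_w f m w <= rhs%:E.
  (* The bounds b_j contain Cp^(1/p), so that b_j^p is exactly the bound of [step_block_moment]. *)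
  apply: (BDG (S m) (fun j => Cp `^ p^-1 * (Num.sqrt (tau j.+1 - tau j) * l j))%R); first exact: blocks_symmetric.
    by move=> j; rewrite mulr_ge0 ?powR_ge0// mulr_ge0 ?sqrtr_ge0.
  move=> j jN; rewrite powRM ?powR_ge0// ?mulr_ge0 ?sqrtr_ge0//.
  rewrite -powRrM mulVf ?gt_eqF// powRr1//.
  exact: (step_block_moment hg hH oh hF hW (tau0 j) (tau_lt j) (tauT jN) (mQ0 jN) m p1 pk (l0 j) (Q0E jN) (Ql j jN)).
have einf0 (u : nat -> \bar R) : (forall n, 0 <= u n) -> 0 <= limn_einf u.
  move=> u0; rewrite limn_einf_lim; apply: lime_ge; first exact: is_cvg_einfs.
  by apply: nearW => n; apply: le_ereal_inf_tmp => _ [m _ <-].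
apply: (@le_trans _ _ (\int[P]_w limn_einf (f ^~ w))).
  apply: integral_nonmeasurable_le => //.
  - by move=> w; rewrite lee_fin powR_ge0.
  - by move=> w; exact: einf0.
  - apply: (emeasurable_fun_cvg (fun n w => einfs (f ^~ w) n)) => [n|w _]; first exact: measurable_fun_einfs.
    by rewrite limn_einf_lim; exact: is_cvg_einfs.
apply: (le_trans (fatou P measurableT mf (fun n w _ => f0 n w))).
rewrite limn_einf_lim; apply: lime_le; first exact: is_cvg_einfs.
apply: nearW => n; apply: le_trans (le n).
by apply: ereal_inf_lbound; exists n => /=.
Qed.

End stochastic_convolution.

Theorem lemma3p5 (R : realType) (p D : R) (hp : 2 <= p) (hD : 1 <= D) :
  exists B : R, 0 <= B /\
  forall (s : scalar_kind)
    (X : completeNormedModType (scalars R s)) (hX : smooth2 X D)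
    (H : completeNormedModType (scalars R s)) (ip : {dot H for @sconj R s})
    (hH : hilbert_inner ip) (hsep : separable_space H)
    (J : set nat) (h : nat -> H) (hbasis : orthonormal_basis ip J h)
    (dG : measure_display) (OmegaG : measurableType dG)
    (PG : probability OmegaG R) (gam : nat -> {RV PG >-> R})
    (hgam : iid_std_gaussian gam)
    (dO : measure_display) (Omega : measurableType dO)
    (P : probability Omega R)
    (T : R) (hT : 0 < T) (F : R -> set (set Omega)) (hF : filtration T F)
    (W : (R -> H) -> Omega -> scalars R s) (hW : cylindrical_BM ip P T F W)
    (k : R) (hk : 0 < k) (Nk : nat) (hNk : T / k = Nk%:R)
    (N : nat) (hN : (N <= Nk)%N)
    (Q : Omega -> R -> H -> X)
    (hQ : forall (w : Omega) (t : R), 0 <= t <= T -> gamma_space ip gam (Q w t))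
    (hQmeas : forall i : nat, (i < N)%N ->
       ae_strongly_measurable P (gamma_dist ip gam) (gamma_space ip gam)
         (F (i%:R * k)%R) (fun w => Q w (i%:R * k)%R))
    (hQLp : forall i : nat, (i < N)%N ->
       (Lnorm P p%:E (fun w => gamma_norm ip gam (Q w (i%:R * k)%R)) < +oo)%E)
    (Rk : R -> {linear X -> X})
    (hRkcont : forall r : R, 0 < r -> continuous (Rk r))
    (hRk : forall r : R, 0 < r -> (op_norm (Rk r) <= 1%:E)%E),
  (Lnorm P p%:E (fun w =>
     (\big[Num.max/0]_(j < N.+1)
        nrm (\sum_(i < j)
               iter (j - i) (Rk k)
                 (op_increment W J h (Q w (i%:R * k)%R)
                    (i%:R * k)%R (i.+1%:R * k)%R w)))%:E)
   <= B%:E *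
      poweR (k%:E * \sum_(i < N)
               (Lnorm P p%:E
                  (fun w => gamma_norm ip gam (Q w (i%:R * k)%R))) ^+ 2) 2^-1)%E.
Proof.
have p0 : 0 < p by exact: lt_le_trans hp.
have p1 : 1 <= p by apply: le_trans hp; rewrite ler1n.
have [C C0 BDG] := burkholder hp hD.
(* Kahane-Khintchine was iterated along dyadic exponents; one above p is fixed here, depending on p
   only. *)
have [k0 pk0] : exists k0 : nat, p <= (2 ^ k0.+1)%:R.
  exists (Num.bound p); apply: (le_trans (ltW (archi_boundP (ltW p0)))).
  by rewrite ler_nat (leq_trans (leqnSn _))// ltnW// ltn_expl.
pose Cp : R := 4 * 2 `^ p * (1 + kahane_cst R k0).
have Cp0 : 0 <= Cp by rewrite !mulr_ge0 ?powR_ge0// addr_ge0// kahane_cst_ge0.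
(* The step constant enters Burkholder's bound as (Cp^(2/p))^(p/2) = Cp, so the p-th power of B is C
   * Cp. *)
exists ((C * Cp) `^ p^-1); split; first exact: powR_ge0.
move=> s X hX H ip hH hsep J h hbasis dG OmG PG gam hgam dO Om P T hT F hF W hW k hk Nk hNk N hN Q hQ
  hQmeas hQLp Rk hRkcont hRk.
have oh : orthonormal_on ip J h by have [] := hbasis.
pose tau (i : nat) : R := i%:R * k.
have tau0 i : 0 <= tau i by rewrite mulr_ge0// ltW.
have tau_lt i : tau i < tau i.+1 by rewrite /tau ltr_pM2r// ltr_nat.
have tauT i : (i < N)%N -> tau i.+1 <= T.
  move=> iN; have -> : T = Nk%:R * k by rewrite -hNk divfK ?gt_eqF.
  by rewrite /tau ler_pM2r// ler_nat (leq_trans iN).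
have dtau i : tau i.+1 - tau i = k by rewrite /tau -mulrBl -natrB// subSnn mul1r.
have /choice[Q0 hQ0] : forall i, exists f0 : Om -> H -> X, (i < N)%N ->
    strongly_measurable (gamma_dist ip gam) (gamma_space ip gam) (F (tau i)) f0 /\
    {ae P, forall w, Q w (tau i) = f0 w}.
  move=> i; have [iN|iN] := ltnP i N; last by exists (fun w => Q w 0).
  by have [f0 ?] := hQmeas i iN; exists f0.
pose L i := Lnorm P p%:E (fun w => gamma_norm ip gam (Q w (tau i))).
pose l i : R := fine (L i).
have l0 i : 0 <= l i by apply: fine_ge0; exact: Lnorm_ge0.
have LE i : (i < N)%N -> L i = (l i)%:E.
  by move=> iN; rewrite fineK// ge0_fin_numE ?Lnorm_ge0//; exact: hQLp.
have Ll i : (i < N)%N -> (L i <= (l i)%:E)%E by move=> /LE ->.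
pose A : {additive X -> X} := Rk k.
have hA x : nrm (A x) <= nrm x by exact: (op_norm_contractive x (hRk k hk)).
have main := @convolution_moment _ _ _ _ _ _ _ _ _ hgam D J h hD hX hH oh _ _ P T F W hF hW N tau
  (fun i w => Q w (tau i)) Q0 tau0 tau_lt tauT (fun i iN => (hQ0 i iN).1) (fun i iN => (hQ0 i iN).2)
  p C k0 A l p1 pk0 hA l0 Ll (fun S b => BDG s X A _ _ P S N b hX hA).
under eq_bigr => i _ do rewrite [Lnorm _ _ _](LE i (ltn_ord i)) -EFin_expe.
pose E := \sum_(i < N) l i ^+ 2.
rewrite sumEFin -/E -[(k%:E * _)%E]EFinM poweR_EFin -[(_ * _)%E]EFinM.
have E0 : 0 <= E by apply: sumr_ge0 => i _; exact: sqr_ge0.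
have kE0 : 0 <= k * E by rewrite mulr_ge0// ltW.
rewrite (Lnorm_le P (f := fun w => \big[Num.max/0]_(j < N.+1) nrm (\sum_(i < j)
  iter (j - i) (Rk k) (op_increment W J h (Q w (tau i)) (tau i) (tau i.+1) w))) p0); last 2 first.
- by move=> w; exact: bigmax_ge_id.
- by rewrite mulr_ge0 ?powR_ge0.
move: main; rewrite -/Cp.
have -> : \sum_(j < N) (Cp `^ p^-1 * (Num.sqrt (tau j.+1 - tau j) * l j)) ^+ 2 = (Cp `^ p^-1) ^+ 2 * (k * E).
  rewrite /E !mulr_sumr; apply: eq_bigr => j _.
  by rewrite dtau !exprMn sqr_sqrtr ?(ltW hk).
have -> : C * ((Cp `^ p^-1) ^+ 2 * (k * E)) `^ (p / 2) = ((C * Cp) `^ p^-1 * (k * E) `^ 2^-1) `^ p.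
  have pow1 x : 0 <= x -> (x `^ p^-1) `^ p = x.
    by move=> x0; rewrite -powRrM mulVf ?gt_eqF// powRr1.
  have sqrp x : 0 <= x -> (x ^+ 2) `^ (p / 2) = x `^ p.
    by move=> x0; rewrite -powR_mulrn// -powRrM [2 * _]mulrC divfK.
  rewrite (powRM _ (sqr_ge0 _) kE0) (sqrp _ (powR_ge0 _ _)) (pow1 _ Cp0).
  rewrite (powRM _ (powR_ge0 _ _) (powR_ge0 _ _)) (pow1 _ (mulr_ge0 C0 Cp0)).
  by rewrite -powRrM [2^-1 * p]mulrC mulrA.
move=> main; apply: le_trans main.
rewrite le_eqVlt; apply/orP; left; apply/eqP; apply: eq_integral => w _.
by congr ((_ `^ p)%:E); apply: eq_bigr => j _; rewrite transported_iter.
Qed.
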